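(* Let $p_1, p_2, \alpha_1, \alpha_2$ be non-zero complex constants with $\alpha_1\neq\alpha_2$, let $\beta\in\mathbb{C}$ be any constant, let $a(z)$ be a non-zero polynomial and let $k\geq 0$ be an integer. Suppose that $f$ is a transcendental entire function with $\rho_2(f)<1$ which is a solution of the differential-difference equation $$f^2(z)+a(z)f^{(k)}(z+\beta)=p_1e^{\alpha_1 z}+p_2e^{\alpha_2 z}$$ and which satisfies $N\left(r,\frac{1}{f}\right)=S(r,f)$. Then $\rho(f)=1$, $a(z)\equiv a$ must be a constant, and one of the following holds: (i) $f(z)=c_1e^{\frac{\alpha_1 z}{2}}$, $\; a c_1\left(\frac{\alpha_1}{2}\right)^k e^{\frac{\alpha_1\beta}{2}}=p_2$, $\;\alpha_1=2\alpha_2$; (ii) $f(z)=c_2e^{\frac{\alpha_2 z}{2}}$, $\; a c_2\left(\frac{\alpha_2}{2}\right)^k e^{\frac{\alpha_2\beta}{2}}=p_1$, $\;\alpha_2=2\alpha_1$; where $c_1, c_2$ are constants satisfying $c_i^2=p_i$, $i=1,2$.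
   Context: Standard Nevanlinna theory notation: for a meromorphic function $f$ on $\mathbb{C}$, $T(r,f)$ is the characteristic function, $N(r,f)$ the counting function of poles (with multiplicity) and $m(r,f)$ the proximity function; so $N(r,1/f)$ counts the zeros of $f$ with multiplicity. $S(r,f)$ denotes any quantity that is $o(T(r,f))$ as $r\to\infty$ outside a set of finite linear measure. The order is $\rho(f)=\limsup_{r\to\infty}\frac{\log^+ T(r,f)}{\log r}$ and the hyper-order is $\rho_2(f)=\limsup_{r\to\infty}\frac{\log^+\log^+ T(r,f)}{\log r}$. $f^{(k)}$ is the $k$-th derivative, $f^{(0)}=f$, and $f^2(z)=(f(z))^2$. *)

(* Defs.v *)
(* R : realType is an arbitrary complete real field; the complex numbers are R[i]. *)
From mathcomp Require Import all_boot all_order all_algebra.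
From mathcomp Require Export complex.
From mathcomp Require Import all_classical all_reals all_analysis.
Import Order.TTheory GRing.Theory Num.Theory.
Import numFieldNormedType.Exports.

Set Implicit Arguments.
Unset Strict Implicit.
Unset Printing Implicit Defensive.

Local Open Scope classical_set_scope.
Local Open Scope ring_scope.
Local Open Scope complex_scope.

(* The notions below that involve the topology of the complex plane are stated
   for a numFieldType K, which carries the topology of its norm, and are used
   at K := R[i], where derivability is complex differentiability. *)
Section NumField.
Context {K : numFieldType}.

Definition entire (f : K -> K) : Prop := forall z : K, derivable f z 1.

Definition transcendental_entire (f : K -> K) : Prop :=
  entire f /\ ~ (exists p : {poly K}, forall z, f z = p.[z]).

Definition cderiv (k : nat) (f : K -> K) : K -> K := derive1n k f.

(* (w - z)^n g(w) has a finite nonzero limit as w -> z, w <> z.  There is at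
   most one such n. *)
Definition has_pole_order (g : K -> K) (z : K) (n : nat) : Prop :=
  exists2 l : K, l != 0 & (w - z) ^+ n * g w @[w --> z^'] --> l.

(* 0 when g is regular at z (in particular when g has a zero there); the value
   of g at z itself is irrelevant, so the poles of 1/f may be computed from
   fun z => (f z)^-1 in spite of the convention 0^-1 = 0. *)
Definition pole_order (g : K -> K) (z : K) : nat :=
  xget 0%N [set n | has_pole_order g z n].

End NumField.

Section Nevanlinna.
Context {R : realType}.
Local Notation C := R[i].
Local Notation mu := (@lebesgue_measure R).

Definition cexp (z : C) : C :=
  (expR (complex.Re z) * cos (complex.Im z)) +i*
  (expR (complex.Re z) * sin (complex.Im z)).

(* The modulus as an element of R: the generic norm `|z| of R[i] lands in R[i]. *)
Definition cmod (z : C) : R := ComplexField.Normc.normc z.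

(* r e^(i theta) *)
Definition circle_pt (r theta : R) : C := (r * cos theta) +i* (r * sin theta).

(* log^+ x (ln is 0 on nonpositive numbers) *)
Definition logp (x : R) : R := Num.max 0 (ln x).

(* n(t, g): poles in the closed disc of radius t, with multiplicity.  The sum is
   over the (finite, for g meromorphic) set of points with pole_order <> 0. *)
Definition nevanlinna_n (g : C -> C) (t : R) : R :=
  \sum_(z \in [set z : C | cmod z <= t]) ((pole_order g z)%:R : R).

Definition nevanlinna_N (g : C -> C) (r : R) : R :=
  (\int[mu]_(t in `]0, r]) ((nevanlinna_n g t - nevanlinna_n g 0) / t))
  + nevanlinna_n g 0 * ln r.

Definition nevanlinna_m (g : C -> C) (r : R) : R :=
  (2 * pi)^-1 *
  \int[mu]_(theta in `[0, 2 * pi]) logp (cmod (g (circle_pt r theta))).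

Definition nevanlinna_T (g : C -> C) (r : R) : R :=
  nevanlinna_m g r + nevanlinna_N g r.

Definition growth_order (f : C -> C) : \bar R :=
  limf_esup (fun r : R => (logp (nevanlinna_T f r) / ln r)%:E) +oo.

Definition hyper_order (f : C -> C) : \bar R :=
  limf_esup (fun r : R => (logp (logp (nevanlinna_T f r)) / ln r)%:E) +oo.

(* phi(r) = S(r, f): o(T(r, f)) as r -> +oo outside a set E of finite measure. *)
Definition is_S (phi : R -> R) (f : C -> C) : Prop :=
  exists E : set R, [/\ measurable E, (mu E < +oo)%E &
    forall eps : R, 0 < eps ->
      \forall r \near +oo, ~ E r -> `|phi r| <= eps * nevanlinna_T f r].

End Nevanlinna.

(* Main.v *)
(* If V(z) = log |f(z)| - c |z| - e were positive somewhere, for suitable c and e,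
   the equation and Cauchy's estimates for f^(k)(z + beta) would yield a point at
   bounded distance from z where V is at least twice as large.  Iterating, log |f|
   grows geometrically along points whose moduli grow linearly, against
   rho_2(f) < 1.  So f has exponential type.

   Since N(r, 1/f) = o(r) on a sequence of radii, dividing f by its Blaschke product
   on a disc of radius rho costs only o(rho), and the logarithm of the zero-free
   quotient is an affine function up to O(|z|^2 / rho), by the Schwarz formula.
   Hence there are one gamma and arbitrarily large r with
   |f(z)| <= exp(Re(gamma z) + o(r)) for all |z| <= r, and the same bound holds for
   the term a(z) f^(k)(z + beta).

   Comparing both sides of the equation along rays gives alpha_1 = s gamma and
   alpha_2 = t gamma with s <> t in [1, 2].  Say t < s.  Subtract from f^2 the
   exponential of exponent 2 gamma, if there is one, and multiply by
   exp(-2 gamma z): the result h is exp(o(r)) everywhere and exponentially small in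
   a sector of opening more than pi / 2.  The product of its four rotates by powers
   of i is then exponentially small on circles, so h = 0.  As f <> 0, this
   forces s = 2 and f^2 = p_1 exp(alpha_1 z), and the rest is a computation. *)

(* N(r, 1/f) is small only off an exceptional set, so f is controlled only at certain arbitrarily
   large radii, never on all large circles. Every estimate from then on has the form: for all eps
   and r0 there is some r >= r0 with a bound on the whole disc of radius r. Phragmen-Lindelof
   arguments, which need all large radii, are replaced by Cauchy's formula on a single circle, and f
   and the derivative term have to be bounded at the same r.

   The exponents lie in the segment from gamma to 2 gamma because the left side of the equation is
   at most exp(max(2 Re(gamma z), Re(gamma z)) + o(r)), and this maximum is the support function of
   that segment.

   The threshold 1 for the hyper-order comes from the doubling: after n steps of bounded length, log
   |f| is of size 2^n at distance O(n), so T(r) would be at least exp(const r), whereas rho_2(f) < 1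
   gives T(r) <= exp(r^sigma) with sigma < 1. *)
From HB Require Import structures.
Require Import Defs.
From mathcomp Require Import all_boot all_order all_algebra.
From mathcomp Require Import complex.
From mathcomp Require Import ring lra.
From mathcomp Require Import all_classical all_reals all_analysis.
Import Order.TTheory GRing.Theory Num.Theory.
Import numFieldNormedType.Exports.

Set Implicit Arguments.
Unset Strict Implicit.
Unset Printing Implicit Defensive.

Local Open Scope classical_set_scope.
Local Open Scope ring_scope.
Local Open Scope complex_scope.

(** * Complex modulus, derivative and exponential *)

(* The norm topology of the field R[i], as in the definitions; it makes R[i] a
   normed module over itself, so that the generic theory of derivatives applies. *)
HB.instance Definition _ (R : realType) :=
  NormedModule.copy R[i] (R[i] : numFieldType)^o.

Section Modulus.
Context {R : realType}.
Local Notation C := R[i].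
Local Notation Re := (@complex.Re R).
Local Notation Im := (@complex.Im R).
Implicit Types (z w : C) (f g : C -> C).

Lemma normc_cmod z : `|z| = (cmod z)%:C.
Proof. by []. Qed.

Lemma cmod_ge0 z : 0 <= cmod z.
Proof. by rewrite -lecR -normc_cmod normr_ge0. Qed.

Lemma cmodM z w : cmod (z * w) = cmod z * cmod w.
Proof. exact: ComplexField.Normc.normcM. Qed.

Lemma cmodD z w : cmod (z + w) <= cmod z + cmod w.
Proof. exact: le_normcD. Qed.

Lemma cmodN z : cmod (- z) = cmod z.
Proof. exact: normcN. Qed.

Lemma cmodB z w : cmod (z - w) <= cmod z + cmod w.
Proof. by rewrite -(cmodN w) cmodD. Qed.

Lemma cmod_distC z w : cmod (z - w) = cmod (w - z).
Proof. by rewrite -cmodN opprB. Qed.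

Lemma lerB_cmod z w : cmod z - cmod w <= cmod (z - w).
Proof. by rewrite lerBlDr (le_trans _ (cmodD _ _))// subrK. Qed.

Lemma cmod0 : cmod (0 : C) = 0.
Proof. exact: ComplexField.Normc.normc0. Qed.

Lemma cmod1 : cmod (1 : C) = 1.
Proof. exact: ComplexField.Normc.normc1. Qed.

Lemma cmod_eq0 z : (cmod z == 0) = (z == 0).
Proof.
apply/eqP/eqP => [|->]; last exact: cmod0.
exact: ComplexField.Normc.eq0_normc.
Qed.

Lemma cmod_gt0 z : (0 < cmod z) = (z != 0).
Proof. by rewrite lt_def cmod_eq0 cmod_ge0 andbT. Qed.

Lemma cmodV z : cmod z^-1 = (cmod z)^-1.
Proof. exact: ComplexField.Normc.normcV. Qed.

Lemma cmodX z n : cmod (z ^+ n) = cmod z ^+ n.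
Proof. by elim: n => [|n IH]; rewrite ?expr0 ?cmod1// !exprS cmodM IH. Qed.

Lemma cmod_prod (I : Type) (r : seq I) (F : I -> C) :
  cmod (\prod_(i <- r) F i) = \prod_(i <- r) cmod (F i).
Proof. by apply: (big_morph _ cmodM cmod1). Qed.

Lemma cmod_real (x : R) : cmod x%:C = `|x|.
Proof. by rewrite /cmod /= expr0n /= addr0 sqrtr_sqr. Qed.

Lemma cmodZ (x : R) z : cmod (x%:C * z) = `|x| * cmod z.
Proof. by rewrite cmodM cmod_real. Qed.

Lemma cmod_nat n : cmod (n%:R : C) = n%:R.
Proof. by rewrite -(rmorph_nat (real_complex R)) cmod_real ger0_norm. Qed.

Lemma cmodJ z : cmod (conjc z) = cmod z.
Proof. by case: z => a b; rewrite /cmod /= sqrrN. Qed.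

Lemma sqr_cmod z : cmod z ^+ 2 = Re z ^+ 2 + Im z ^+ 2.
Proof. by case: z => a b; rewrite /cmod /= sqr_sqrtr// addr_ge0// sqr_ge0. Qed.

Lemma mulcJ z : z * conjc z = (cmod z ^+ 2)%:C.
Proof.
by rewrite sqr_cmod; case: z => a b; apply/eqP; rewrite eq_complex /=;
  apply/andP; split; apply/eqP; ring.
Qed.

Lemma Re_cmod z : `|Re z| <= cmod z.
Proof. by rewrite -lecR; exact: normc_ge_Re. Qed.

Lemma Im_cmod z : `|Im z| <= cmod z.
Proof.
rewrite -ler_sqr ?nnegrE ?cmod_ge0// sqr_cmod real_normK ?num_real//.
by rewrite lerDr sqr_ge0.
Qed.

Lemma ReD z w : Re (z + w) = Re z + Re w. Proof. by case: z w => ? ? []. Qed.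
Lemma ImD z w : Im (z + w) = Im z + Im w. Proof. by case: z w => ? ? []. Qed.
Lemma ReN z : Re (- z) = - Re z. Proof. by case: z. Qed.
Lemma ImN z : Im (- z) = - Im z. Proof. by case: z. Qed.
Lemma ReB z w : Re (z - w) = Re z - Re w. Proof. by rewrite ReD ReN. Qed.
Lemma ImB z w : Im (z - w) = Im z - Im w. Proof. by rewrite ImD ImN. Qed.
Lemma ReM z w : Re (z * w) = Re z * Re w - Im z * Im w.
Proof. by case: z w => ? ? []. Qed.
Lemma ImM z w : Im (z * w) = Re z * Im w + Im z * Re w.
Proof. by case: z w => ? ? []. Qed.
Lemma ReZ (x : R) z : Re (x%:C * z) = x * Re z.
Proof. by case: z => ? ? /=; rewrite mul0r subr0. Qed.
Lemma ImZ (x : R) z : Im (x%:C * z) = x * Im z.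
Proof. by case: z => ? ? /=; rewrite mul0r addr0. Qed.

Lemma cmod_ReIm z : cmod z <= `|Re z| + `|Im z|.
Proof.
rewrite -ler_sqr ?nnegrE ?cmod_ge0// ?addr_ge0// sqr_cmod sqrrD.
rewrite !real_normK ?num_real//.
by rewrite lerD2r lerDl mulrn_wge0// mulr_ge0.
Qed.

(** Balls of R[i] have radii in R[i]; a radius e with 0 < e has zero imaginary part, so Re e can
    replace it. *)
Lemma nbhs_cmodP z (P : C -> Prop) :
  nbhs z P <-> exists2 d : R, 0 < d & forall w, cmod (w - z) < d -> P w.
Proof.
split=> [/nbhs_ballP[e /= e0 H]|[d d0 H]].
- move: e0; rewrite ltcE /= => /andP[/eqP e2 e1].
  exists (Re e) => // w wd; apply: H; rewrite /ball /= normc_cmod ltcE /=.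
  by rewrite e2 eqxx /= -/(cmod (z - w)) cmod_distC.
- apply/nbhs_ballP; exists d%:C; first by rewrite /= ltcR.
  by move=> w; rewrite /ball /= ltcR -/(cmod (z - w)) cmod_distC => /H.
Qed.

Lemma cvg_cmodP {T : Type} (F : set_system T) {FF : Filter F} (f : T -> C) z :
  f @ F --> z <-> forall e : R, 0 < e -> \forall x \near F, cmod (f x - z) < e.
Proof.
split=> [+ e e0|H P /nbhs_cmodP[d d0 dP]].
- by move=> /(_ [set w | cmod (w - z) < e]); apply; apply/nbhs_cmodP; exists e.
- by rewrite nbhs_simpl; apply: filterS (H d d0) => x /dP.
Qed.

Lemma continuous_Re : continuous (Re : C -> R).
Proof.
move=> z P /nbhs_ballP[e /= e0 H]; apply/nbhs_cmodP; exists e => // w.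
move=> wz; apply: H; move: wz; rewrite /ball /=.
by rewrite cmod_distC; apply: le_lt_trans; rewrite -ReB Re_cmod.
Qed.

Lemma continuous_Im : continuous (Im : C -> R).
Proof.
move=> z P /nbhs_ballP[e /= e0 H]; apply/nbhs_cmodP; exists e => // w.
move=> wz; apply: H; move: wz; rewrite /ball /=.
by rewrite cmod_distC; apply: le_lt_trans; rewrite -ImB Im_cmod.
Qed.

Lemma continuous_cmod : continuous (cmod : C -> R).
Proof.
move=> z P /nbhs_ballP[e /= e0 H]; apply/nbhs_cmodP; exists e => // w.
move=> wz; apply: H; move: wz; rewrite /ball /=.
apply: le_lt_trans; rewrite ler_norml lerNl opprB lerB_cmod.
by rewrite cmod_distC lerB_cmod.
Qed.

Lemma cvg_complex {T : Type} (F : set_system T) {FF : Filter F}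
    (f g : T -> R) a b :
  f @ F --> a -> g @ F --> b -> (f x +i* g x : C) @[x --> F] --> (a +i* b : C).
Proof.
move=> fa gb; apply/cvg_cmodP => e e0; near=> x.
apply: le_lt_trans (cmod_ReIm _) _; rewrite /= -!/(_ - _).
rewrite (splitr e) ltrD// distrC; near: x; apply: cvgr_dist_lt => //;
  exact: divr_gt0.
Unshelve. all: by end_near. Qed.

(** The division-free form of the derivative: it includes w = z, so the chain rule needs no separate
    case f w = f z. *)
Lemma is_derive_cmodP f z d : is_derive z 1 f d <->
  forall e : R, 0 < e -> exists2 r : R, 0 < r &
    forall w, cmod (w - z) < r -> cmod (f w - f z - d * (w - z)) <= e * cmod (w - z).
Proof.
split.
- case=> df fd e e0.
  have : h^-1 *: (f (h *: 1 + z) - f z) @[h --> 0^'] --> d by rewrite -fd.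
  move=> /cvg_cmodP /(_ e e0); rewrite /= /nbhs /= /dnbhs /within /=.
  move=> /nbhs_cmodP[r r0 H]; exists r => // w wz.
  have [->|wz0] := eqVneq w z; first by rewrite !subrr mulr0 subr0 cmod0 mulr0.
  have := H (w - z); rewrite subr0 => /(_ wz); rewrite subr_eq0 => /(_ wz0).
  rewrite /GRing.scale /= mulr1 subrK => /ltW H1.
  rewrite (_ : f w - f z - _ = ((w - z)^-1 * (f w - f z) - d) * (w - z)).
    by rewrite cmodM ler_wpM2r// cmod_ge0.
  by rewrite mulrBl mulrAC mulVf ?mul1r// subr_eq0.
- move=> H.
  have : h^-1 *: (f (h *: 1 + z) - f z) @[h --> 0^'] --> d.
    apply/cvg_cmodP => e e0; rewrite /= /nbhs /= /dnbhs /within /=.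
    have [|r r0 Hr] := H (e / 2); first by rewrite divr_gt0.
    apply/nbhs_cmodP; exists r => // h; rewrite subr0 => hr h0.
    have := Hr (h + z); rewrite addrK => /(_ hr) H1.
    rewrite /GRing.scale /= mulr1.
    have hp : 0 < cmod h by rewrite cmod_gt0.
    rewrite -(ltr_pM2r hp) -cmodM mulrBl mulrAC mulVf// mul1r.
    by apply: le_lt_trans H1 _; rewrite ltr_pM2r// ltr_pdivrMr// ltr_pMr// ltr1n.
  by move=> cf; split; [apply/cvg_ex; exists d|exact/cvg_lim].
Qed.

Lemma derive_continuous f z : derivable f z 1 -> {for z, continuous f}.
Proof.
move=> /derivable1_diffP /differentiable_continuous; exact.
Qed.

Lemma is_derive_comp f g z d e : is_derive z 1 f d -> is_derive (f z) 1 g e ->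
  is_derive z 1 (fun w => g (f w)) (e * d).
Proof.
move=> fd ge; have fc : {for z, continuous f} by apply: derive_continuous.
move: (fd) (ge) => /is_derive_cmodP Hf /is_derive_cmodP Hg.
apply/is_derive_cmodP => eps eps0.
(* The added 1 keeps the divisors positive when d or e is 0. *)
have d1 : 0 < cmod d + 1 by rewrite ltr_wpDl// cmod_ge0.
have e1 : 0 < cmod e + 1 by rewrite ltr_wpDl// cmod_ge0.
have [r1 r10 H1] := Hf _ (@ltr01 R).
have [|r2 r20 H2] := Hf (eps / (2 * (cmod e + 1))).
  by rewrite divr_gt0// mulr_gt0.
have [|r3 r30 H3] := Hg (eps / (2 * (cmod d + 1))).
  by rewrite divr_gt0// mulr_gt0.
have [r4 r40 H4] : exists2 r4 : R, 0 < r4 &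
    forall w, cmod (w - z) < r4 -> cmod (f w - f z) < r3.
  by apply/nbhs_cmodP; move/cvg_cmodP: fc => /(_ _ r30).
exists (Num.min r1 (Num.min r2 r4)); first by rewrite !lt_min r10 r20.
move=> w; rewrite !lt_min => /andP[w1 /andP[w2 w4]].
rewrite (_ : _ - _ - _ = (g (f w) - g (f z) - e * (f w - f z))
  + e * (f w - f z - d * (w - z))); last by ring.
apply: le_trans (cmodD _ _) _; rewrite (splitr eps) mulrDl lerD//.
- apply: le_trans (H3 _ (H4 _ w4)) _.
  have : cmod (f w - f z) <= (cmod d + 1) * cmod (w - z).
    rewrite -(subrK (d * (w - z)) (f w - f z)) (le_trans (cmodD _ _))//.
    by rewrite cmodM mulrDl addrC lerD2l H1.
  move=> H5; apply: le_trans (ler_wpM2l _ H5) _.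
    by rewrite divr_ge0// ltW// mulr_gt0.
  rewrite mulrA ler_wpM2r ?cmod_ge0// le_eqVlt; apply/orP; left; apply/eqP.
  by field; rewrite gt_eqF//= ltr0Sn.
- rewrite cmodM (le_trans (ler_wpM2l (cmod_ge0 _) (H2 _ w2)))//.
  rewrite mulrA ler_wpM2r ?cmod_ge0//.
  rewrite [leRHS](_ : _ = (cmod e + 1) * (eps / (2 * (cmod e + 1)))).
    by rewrite ler_wpM2r ?lerDl// divr_ge0// ltW// mulr_gt0.
  by field; rewrite gt_eqF.
Qed.

End Modulus.

Section ComplexDerivative.
Context {R : realType}.
Local Notation C := R[i].
Implicit Types (z w : C) (f g : C -> C).

Lemma derivable_is_derive f z : derivable f z 1 -> is_derive z 1 f (derive1 f z).
Proof. by move=> df; rewrite derive1E; apply/derivableP. Qed.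

Lemma is_derive_derive1 f z d : is_derive z 1 f d -> derive1 f z = d.
Proof. by case=> _ <-; rewrite derive1E. Qed.

Lemma cderiveD f g z d e : is_derive z 1 f d -> is_derive z 1 g e ->
  is_derive z 1 (fun w => f w + g w) (d + e).
Proof. exact: is_deriveD. Qed.

Lemma cderiveM f g z d e : is_derive z 1 f d -> is_derive z 1 g e ->
  is_derive z 1 (fun w => f w * g w) (d * g z + f z * e).
Proof.
move=> df dg; have := is_deriveM df dg => /is_derive_eq; apply.
by rewrite /GRing.scale /= addrC [g z * _]mulrC.
Qed.

Lemma cderive_cst c z : is_derive z 1 (fun=> c : C) 0.
Proof. exact: is_derive_cst. Qed.

Lemma cderive_id z : is_derive z 1 (fun w : C => w) 1.
Proof. exact: is_derive_id. Qed.

Lemma cderive_shift b z : is_derive z 1 (fun w : C => w + b) 1.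
Proof.
by have := cderiveD (cderive_id z) (cderive_cst b z); rewrite addr0.
Qed.

Lemma cderiveZ c z : is_derive z 1 (fun w : C => c * w) c.
Proof.
have := cderiveM (cderive_cst c z) (cderive_id z).
by rewrite mul0r add0r mulr1.
Qed.

Lemma eq_cderive f g z d : f =1 g -> is_derive z 1 f d -> is_derive z 1 g d.
Proof. by move=> /funext ->. Qed.

Lemma cderivableD f g z : derivable f z 1 -> derivable g z 1 ->
  derivable (fun w => f w + g w) z 1.
Proof. exact: derivableD. Qed.

Lemma cderivableB f g z : derivable f z 1 -> derivable g z 1 ->
  derivable (fun w => f w - g w) z 1.
Proof. exact: derivableB. Qed.

Lemma cderivableM f g z : derivable f z 1 -> derivable g z 1 ->
  derivable (fun w => f w * g w) z 1.
Proof. exact: derivableM. Qed.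

Lemma cderivableV f z : f z != 0 -> derivable f z 1 ->
  derivable (fun w => (f w)^-1) z 1.
Proof. exact: derivableV. Qed.

Lemma cderivable_comp f g z : derivable f z 1 -> derivable g (f z) 1 ->
  derivable (fun w => g (f w)) z 1.
Proof.
move=> /derivable_is_derive df /derivable_is_derive dg.
by have [] := is_derive_comp df dg.
Qed.

Lemma entire_cst c : entire (fun=> c : C).
Proof. by move=> z; have [] := cderive_cst c z. Qed.

Lemma entire_id : entire (fun w : C => w).
Proof. by move=> z; have [] := cderive_id z. Qed.

Lemma entireD f g : entire f -> entire g -> entire (fun w => f w + g w).
Proof. by move=> ef eg z; apply: cderivableD. Qed.

Lemma entireB f g : entire f -> entire g -> entire (fun w => f w - g w).
Proof. by move=> ef eg z; apply: cderivableB. Qed.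

Lemma entireM f g : entire f -> entire g -> entire (fun w => f w * g w).
Proof. by move=> ef eg z; apply: cderivableM. Qed.

Lemma entire_comp f g : entire f -> entire g -> entire (fun w => g (f w)).
Proof. by move=> ef eg z; apply: cderivable_comp. Qed.

Lemma entire_shift b : entire (fun w : C => w + b).
Proof. by apply: entireD; [exact: entire_id|exact: entire_cst]. Qed.

Lemma entireZ c : entire (fun w : C => c * w).
Proof. by apply: entireM; [exact: entire_cst|exact: entire_id]. Qed.

Lemma eq_entire f g : f =1 g -> entire f -> entire g.
Proof. by move=> /funext ->. Qed.

Lemma entire_prod (I : Type) (r : seq I) (F : I -> C -> C) :
  (forall i, entire (F i)) -> entire (fun z : C => \prod_(i <- r) F i z : C).
Proof.
move=> eF; elim: r => [|i r IH].
  by apply: eq_entire (@entire_cst 1) => z; rewrite big_nil.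
by apply: eq_entire (entireM (eF i) IH) => z; rewrite big_cons.
Qed.

Lemma entireX f n : entire f -> entire (fun z => f z ^+ n).
Proof.
move=> ef; elim: n => [|n IH]; first exact: eq_entire (@entire_cst 1).
by apply: eq_entire (entireM ef IH) => z; rewrite exprS.
Qed.

End ComplexDerivative.

Arguments entire_cst {R} c z.
Arguments entire_shift {R} b z.
Arguments entireZ {R} c z.

Section ComplexExponential.
Context {R : realType}.
Local Notation C := R[i].
Local Notation Re := (@complex.Re R).
Local Notation Im := (@complex.Im R).
Implicit Types (z w : C) (f g : C -> C).

Lemma cexpD z w : cexp (z + w) = cexp z * cexp w.
Proof.
rewrite /cexp ReD ImD expRD cosD sinD; apply/eqP.
by rewrite eq_complex /=; apply/andP; split; apply/eqP; ring.
Qed.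

Lemma cexp0 : cexp (0 : C) = 1.
Proof. by rewrite /cexp /= expR0 cos0 sin0 mulr1 mulr0. Qed.

Lemma cmod_cexp z : cmod (cexp z) = expR (Re z).
Proof.
apply/eqP; rewrite -(@eqrXn2 _ 2) ?cmod_ge0 ?expR_ge0// sqr_cmod /cexp /=.
by rewrite !exprMn -mulrDr cos2Dsin2 mulr1.
Qed.

Lemma cexp_neq0 z : cexp z != 0.
Proof. by rewrite -cmod_gt0 cmod_cexp expR_gt0. Qed.

Lemma cexpN z : cexp (- z) = (cexp z)^-1.
Proof.
apply: (mulfI (cexp_neq0 z)).
by rewrite -cexpD subrr cexp0 mulfV// cexp_neq0.
Qed.

Lemma cexpB z w : cexp (z - w) = cexp z / cexp w.
Proof. by rewrite cexpD cexpN. Qed.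

Lemma cexpX z n : cexp z ^+ n = cexp (n%:R * z).
Proof.
elim: n => [|n IH]; first by rewrite mul0r cexp0.
by rewrite exprS IH -cexpD -natr1 mulrDl mul1r addrC.
Qed.

Lemma is_derive_normP (f : R -> R) (t d : R) : is_derive t (1 : R) f d <->
  forall e : R, 0 < e -> exists2 r : R, 0 < r &
    forall s, `|s - t| < r -> `|f s - f t - d * (s - t)| <= e * `|s - t|.
Proof.
split.
- case=> df fd e e0.
  have : h^-1 *: (f (h *: 1 + t) - f t) @[h --> 0^'] --> d by rewrite -fd.
  move=> /cvgrPdist_le /(_ e e0); rewrite near_withinE => /nbhs_ballP[r /= r0 H].
  exists r => // s sr.
  have [->|st] := eqVneq s t; first by rewrite !subrr mulr0 subr0 normr0 mulr0.
  have := H (s - t); rewrite /ball /= sub0r normrN subr_eq0 => /(_ sr st).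
  rewrite /GRing.scale /= mulr1 subrK distrC => H1.
  rewrite (_ : f s - f t - _ = ((s - t)^-1 * (f s - f t) - d) * (s - t)).
    by rewrite normrM ler_wpM2r.
  by rewrite mulrBl mulrAC mulVf ?mul1r// subr_eq0.
- move=> H.
  have : h^-1 *: (f (h *: 1 + t) - f t) @[h --> 0^'] --> d.
    apply/cvgrPdist_le => e e0; rewrite near_withinE; apply/nbhs_ballP.
    have [r r0 Hr] := H e e0; exists r => // h; rewrite /ball /= sub0r normrN => hr h0.
    have := Hr (h + t); rewrite addrK => /(_ hr) H1.
    rewrite /GRing.scale /= mulr1 distrC.
    have hp : 0 < `|h| by rewrite normr_gt0.
    by rewrite -(ler_pM2r hp) -normrM mulrBl mulrAC mulVf// mul1r.
  by move=> cf; split; [apply/cvg_ex; exists d|exact/cvg_lim].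
Qed.

(** The real first-order expansions of expR, cos and sin at 0 combine into the complex one; the
    functional equation then carries it to every point. *)
Lemma is_derive_cexp0 : is_derive (0 : C) 1 cexp 1.
Proof.
apply/is_derive_cmodP => e e0; rewrite cexp0.
(* The error is at most 4 m |w| in the real part and, as m <= 1, at most 5 m |w| in the imaginary
   part: 9 m |w| in all. *)
have [m [m0 m1 m6]] : exists m : R, [/\ 0 < m, m <= 1 & m * 9 <= e].
  exists (Num.min (e / 9) 1); split; rewrite ?lt_min ?ltr01 ?divr_gt0//.
    by rewrite ge_min lexx orbT.
  by rewrite -ler_pdivlMr// ge_min lexx.
have dx : is_derive (0 : R) 1 expR 1 by have := @is_derive_expR R 0; rewrite expR0.
have dc : is_derive (0 : R) 1 cos 0 by have := @is_derive_cos R 0; rewrite sin0 oppr0.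
have ds : is_derive (0 : R) 1 sin 1 by have := @is_derive_sin R 0; rewrite cos0.
have [rx rx0 Hx] := (is_derive_normP _ _ _).1 dx m m0.
have [rc rc0 Hc] := (is_derive_normP _ _ _).1 dc m m0.
have [rs rs0 Hs] := (is_derive_normP _ _ _).1 ds m m0.
exists (Num.min m (Num.min rx (Num.min rc rs))); first by rewrite !lt_min m0 rx0 rc0.
move=> w; rewrite !subr0 mul1r !lt_min => /and4P[wm wx wc ws].
have xw := Re_cmod w; have yw := Im_cmod w.
move: (Hx (Re w)) (Hc (Im w)) (Hs (Im w)); rewrite !subr0.
move=> /(_ (le_lt_trans xw wx)) {}Hx /(_ (le_lt_trans yw wc)) {}Hc /(_ (le_lt_trans yw ws)) {}Hs.
move: Hx Hc Hs; rewrite expR0 cos0 sin0 mul0r !subr0 !mul1r => {}Hx {}Hc {}Hs.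
have w0 := cmod_ge0 w; have x0 := normr_ge0 (Re w); have y0 := normr_ge0 (Im w).
have Ex : `|expR (Re w) - 1| <= 2 * cmod w.
  rewrite -(subrK (Re w) (expR (Re w) - 1)) (le_trans (ler_normD _ _))//.
  apply: le_trans (lerD Hx xw) _; nra.
have Eb : `|expR (Re w)| <= 3.
  rewrite -(subrK 1 (expR (Re w))) (le_trans (ler_normD _ _))// normr1.
  apply: le_trans (lerD Ex (lexx _)) _; nra.
have A1 : `|expR (Re w) * cos (Im w) - 1 - Re w| <= m * cmod w + 3 * (m * cmod w).
  rewrite (_ : _ - _ - _ = (expR (Re w) - 1 - Re w) + expR (Re w) * (cos (Im w) - 1));
    last by ring.
  apply: le_trans (ler_normD _ _) _; rewrite lerD//.
    by rewrite (le_trans Hx)// ler_wpM2l// ltW.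
  rewrite normrM ler_pM// (le_trans Hc)// ler_wpM2l// ltW//.
have A2 : `|expR (Re w) * sin (Im w) - Im w| <= m * cmod w + 2 * cmod w * (m + 1) * m.
  rewrite (_ : _ - _ = (sin (Im w) - Im w) + (expR (Re w) - 1) * sin (Im w)); last by ring.
  apply: le_trans (ler_normD _ _) _; rewrite lerD//.
    by rewrite (le_trans Hs)// ler_wpM2l// ltW.
  rewrite normrM -mulrA ler_pM//.
  rewrite -(subrK (Im w) (sin (Im w))) (le_trans (ler_normD _ _))//.
  apply: le_trans (lerD Hs (le_refl _)) _.
  have ym := le_trans yw (ltW wm).
  by rewrite -[X in _ + X]mul1r -mulrDl ler_wpM2l// addr_ge0// ltW.
apply: le_trans (cmod_ReIm _) _; rewrite !ReB !ImB /= oppr0 addr0.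
apply: le_trans (lerD A1 A2) _.
have mw : 0 <= m * cmod w by rewrite mulr_ge0// ltW.
have := ler_wpM2r w0 m6; have := ler_wpM2l mw m1; lra.
Qed.

Lemma is_derive_cexp z : is_derive z 1 cexp (cexp z).
Proof.
apply: (@eq_cderive R (fun w => cexp z * cexp (w + (- z)))) => [w|].
  by rewrite -cexpD addrC subrK.
have H : is_derive z 1 (fun w => cexp (w + - z)) (1 * 1).
  apply: is_derive_comp (cderive_shift _ _) _.
  by rewrite subrr; exact: is_derive_cexp0.
have := cderiveM (cderive_cst (cexp z) z) H.
by rewrite mul0r add0r !mulr1.
Qed.

Lemma entire_cexp : entire (@cexp R).
Proof. by move=> z; have [] := is_derive_cexp z. Qed.

Lemma entire_cexpZ (c : C) : entire (fun z => cexp (c * z)).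
Proof. exact: entire_comp (entireZ c) entire_cexp. Qed.

Lemma is_derive_cexpZ (c z : C) :
  is_derive z 1 (fun w => cexp (c * w)) (c * cexp (c * z)).
Proof.
rewrite mulrC; apply: (@is_derive_comp _ (fun w => c * w) cexp).
  exact: cderiveZ.
exact: is_derive_cexp.
Qed.

End ComplexExponential.

(** * Curve integrals and Cauchy's formula *)

Section CurveIntegral.
Context {R : realType}.
Local Notation C := R[i].
Local Notation Re := (@complex.Re R).
Local Notation Im := (@complex.Im R).
Local Notation mu := (@lebesgue_measure R).
Implicit Types (a b c t : R) (f g F G : R -> C).

Definition cint a b f : C :=
  (\int[mu]_(t in `[a, b]) Re (f t)) +i* (\int[mu]_(t in `[a, b]) Im (f t)).

Definition segment_continuous a b (f : R -> C) : Prop := {within `[a, b], continuous f}.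

(** R[i] is normed over itself, so the derivative along a real parameter is taken componentwise. *)
Definition curve_derive F t (d : C) :=
  is_derive t 1 (fun s => Re (F s)) (Re d) /\
  is_derive t 1 (fun s => Im (F s)) (Im d).

Lemma within_continuous_integrable a b (f : R -> R) :
  {within `[a, b], continuous f} -> mu.-integrable `[a, b] (EFin \o f).
Proof.
by move=> cf; apply: continuous_compact_integrable => //; exact: segment_compact.
Qed.

Section WithinContinuity.
Variable A : set R.
Implicit Types (u v : R -> R) (h k : R -> C).

Lemma within_continuous_Re h : {within A, continuous h} ->
  {within A, continuous (fun t => Re (h t))}.
Proof.
move=> ch x; apply: (@continuous_comp _ _ _ (h : subspace A -> C) Re); first exact: ch.
exact: continuous_Re.
Qed.

Lemma within_continuous_Im h : {within A, continuous h} ->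
  {within A, continuous (fun t => Im (h t))}.
Proof.
move=> ch x; apply: (@continuous_comp _ _ _ (h : subspace A -> C) Im); first exact: ch.
exact: continuous_Im.
Qed.

Lemma within_continuous_cmod h : {within A, continuous h} ->
  {within A, continuous (fun t => cmod (h t))}.
Proof.
move=> ch x; apply: (@continuous_comp _ _ _ (h : subspace A -> C) cmod); first exact: ch.
exact: continuous_cmod.
Qed.

Lemma within_continuous_complex u v : {within A, continuous u} ->
  {within A, continuous v} -> {within A, continuous (fun t => u t +i* v t : C)}.
Proof. by move=> cu cv x; apply: cvg_complex; [exact: cu|exact: cv]. Qed.

Lemma within_continuousD h k : {within A, continuous h} ->
  {within A, continuous k} -> {within A, continuous (fun t => h t + k t)}.
Proof. by move=> ch ck x; apply: continuousD; [exact: ch|exact: ck]. Qed.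

Lemma within_continuousB h k : {within A, continuous h} ->
  {within A, continuous k} -> {within A, continuous (fun t => h t - k t)}.
Proof. by move=> ch ck x; apply: continuousB; [exact: ch|exact: ck]. Qed.

Lemma within_continuousM h k : {within A, continuous h} ->
  {within A, continuous k} -> {within A, continuous (fun t => h t * k t)}.
Proof. by move=> ch ck x; apply: continuousM; [exact: ch|exact: ck]. Qed.

Lemma within_continuousV h : (forall t, A t -> h t != 0) -> {within A, continuous h} ->
  {within A, continuous (fun t => (h t)^-1)}.
Proof.
move=> h0 ch; rewrite continuous_subspace_in => t; rewrite inE => At.
by apply: (@continuousV _ (subspace A) h t (h0 _ At)); exact: ch.
Qed.

Lemma within_continuous_cst (d : C) : {within A, continuous (fun=> d)}.
Proof. by move=> x; exact: cst_continuous. Qed.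

Lemma continuous_within h : continuous h -> {within A, continuous h}.
Proof. by move=> ch; exact: continuous_subspaceT. Qed.

End WithinContinuity.

Lemma eq_cint a b f g : (forall t, a <= t <= b -> f t = g t) ->
  cint a b f = cint a b g.
Proof.
move=> fg; rewrite /cint; congr (_ +i* _); apply: eq_Rintegral => t;
  by rewrite inE /= in_itv /= => /fg ->.
Qed.

Lemma cintD a b f g : segment_continuous a b f -> segment_continuous a b g ->
  cint a b (fun t => f t + g t) = cint a b f + cint a b g.
Proof.
move=> cf cg; apply/eqP; rewrite eq_complex ReD ImD /=.
apply/andP; split; apply/eqP.
- under eq_Rintegral do rewrite ReD.
  have rf := within_continuous_integrable (within_continuous_Re cf).
  have rg := within_continuous_integrable (within_continuous_Re cg).
  exact: (RintegralD _ rf rg).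
- under eq_Rintegral do rewrite ImD.
  have rf := within_continuous_integrable (within_continuous_Im cf).
  have rg := within_continuous_integrable (within_continuous_Im cg).
  exact: (RintegralD _ rf rg).
Qed.

Lemma cintZ a b (d : C) f : segment_continuous a b f ->
  cint a b (fun t => d * f t) = d * cint a b f.
Proof.
move=> cf; have iRe := within_continuous_integrable (within_continuous_Re cf).
have iIm := within_continuous_integrable (within_continuous_Im cf).
have iZ (x : R) (h : R -> R) : mu.-integrable `[a, b] (EFin \o h) ->
    mu.-integrable `[a, b] (EFin \o (fun t => x * h t)).
  by move=> ih; exact: (@integrableZl _ _ _ mu `[a, b] _ x (EFin \o h)).
case: d => x y; rewrite /cint; apply/eqP; rewrite eq_complex /=.
apply/andP; split; apply/eqP.
- under eq_Rintegral do rewrite ReM /=.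
  by rewrite (RintegralB _ (iZ x _ iRe) (iZ y _ iIm)) ?(RintegralZl _ _ iRe) ?(RintegralZl _ _ iIm).
- under eq_Rintegral do rewrite ImM /=.
  by rewrite (RintegralD _ (iZ x _ iIm) (iZ y _ iRe)) ?(RintegralZl _ _ iRe) ?(RintegralZl _ _ iIm).
Qed.

Lemma cintB a b f g : segment_continuous a b f -> segment_continuous a b g ->
  cint a b (fun t => f t - g t) = cint a b f - cint a b g.
Proof.
move=> cf cg; have cNg : segment_continuous a b (fun t => -1 * g t).
  apply: within_continuousM.
    exact: within_continuous_cst.
  exact: cg.
rewrite -[- cint a b g]mulN1r -(cintZ (-1) cg) -(cintD cf cNg).
by apply: eq_cint => t _; rewrite mulN1r.
Qed.

(** With I the integral, |I|^2 is the integral of Re (conj(I) f), whose integrand is at most |I|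
    |f|; divide by |I|. *)
Lemma le_cmod_cint a b f : segment_continuous a b f ->
  cmod (cint a b f) <= \int[mu]_(t in `[a, b]) cmod (f t).
Proof.
move=> cf; have [->|I0] := eqVneq (cint a b f) 0.
  by rewrite cmod0; apply: Rintegral_ge0 => t _; exact: cmod_ge0.
have Ip : 0 < cmod (cint a b f) by rewrite cmod_gt0.
have cI : segment_continuous a b (fun t => conjc (cint a b f) * f t).
  apply: within_continuousM.
    exact: within_continuous_cst.
  exact: cf.
have icf := within_continuous_integrable (within_continuous_cmod cf).
rewrite -(ler_pM2l Ip) -expr2 -(RintegralZl _ _ icf).
have -> : cmod (cint a b f) ^+ 2 =
    \int[mu]_(t in `[a, b]) Re (conjc (cint a b f) * f t).
  have := mulcJ (cint a b f); rewrite mulrC -cintZ// /cint => /(congr1 Re) /= <-.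
  by [].
apply: le_Rintegral => //.
- exact/within_continuous_integrable/within_continuous_Re.
- exact: (@integrableZl _ _ _ mu `[a, b] _ (cmod (cint a b f)) (EFin \o (fun t => cmod (f t)))).
- move=> t _; apply: le_trans (ler_norm _) _.
  by apply: le_trans (Re_cmod _) _; rewrite cmodM cmodJ.
- exact: measurable_itv.
Qed.

Lemma cmod_cint_le a b f (B : R) : a <= b -> segment_continuous a b f ->
  (forall t, a <= t <= b -> cmod (f t) <= B) ->
  cmod (cint a b f) <= B * (b - a).
Proof.
move=> ab cf fB; apply: le_trans (le_cmod_cint cf) _.
have <- : \int[mu]_(t in `[a, b]) B = B * (b - a).
  by rewrite Rintegral_cst//= lebesgue_measure_itv/= lte_fin; case: ltgtP ab => // -> _;
    rewrite subrr.
have iB : mu.-integrable `[a, b] (EFin \o (fun=> B)).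
  have cB : {within `[a, b], continuous (fun=> B : R)} by move=> x; exact: cst_continuous.
  exact: within_continuous_integrable cB.
have icf := within_continuous_integrable (within_continuous_cmod cf).
apply: (le_Rintegral _ icf iB).
- exact: measurable_itv.
- by move=> t; rewrite /= in_itv /=; exact: fB.
Qed.

Lemma cint_split c a b f : a <= c -> c <= b -> segment_continuous a b f ->
  cint a b f = cint a c f + cint c b f.
Proof.
move=> ac cb cf.
have H (h : R -> R) : {within `[a, b], continuous h} ->
    \int[mu]_(t in `[a, b]) h t =
    \int[mu]_(t in `[a, c]) h t + \int[mu]_(t in `[c, b]) h t.
  move=> ch; have ih := within_continuous_integrable ch.
  have := @Rintegral_itvB _ h (BLeft a) (BRight b) c ih.
  rewrite !bnd_simp => /(_ ac cb)/eqP; rewrite subr_eq => /eqP ->.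
  rewrite addrC Rintegral_itv_obnd_cbnd//.
  by apply: integrableS ih => // t /=; rewrite !in_itv/= => /andP[/ltW ct ->];
    rewrite (le_trans ac ct).
apply/eqP; rewrite eq_complex ReD ImD /=; apply/andP; split; apply/eqP; apply: H.
- exact: within_continuous_Re.
- exact: within_continuous_Im.
Qed.

Lemma is_derive_real_continuous (F : R -> R) t d : is_derive t 1 F d ->
  {for t, continuous F}.
Proof. by case=> /derivable1_diffP /differentiable_continuous. Qed.

Lemma Rintegral_FTC (h H : R -> R) a b : a <= b ->
  {within `[a, b], continuous h} ->
  (forall t, a <= t <= b -> is_derive t 1 H (h t)) ->
  \int[mu]_(t in `[a, b]) h t = H b - H a.
Proof.
rewrite le_eqVlt => /predU1P[->|ab] ch dH.
  by rewrite set_itv1 Rintegral_set1 subrr.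
rewrite /Rintegral (@continuous_FTC2 _ _ H)//.
  split.
  - by move=> t /[!in_itv]/= /andP[/ltW ta /ltW tb]; case: (dH t); rewrite ?ta.
  - apply: cvg_at_right_filter; apply: is_derive_real_continuous (dH a _).
    by rewrite lexx ltW.
  - apply: cvg_at_left_filter; apply: is_derive_real_continuous (dH b _).
    by rewrite lexx ltW.
move=> t /[!in_itv]/= /andP[/ltW ta /ltW tb]; rewrite derive1E.
by case: (dH t); rewrite ?ta.
Qed.

Lemma cint_FTC a b f F : a <= b -> segment_continuous a b f ->
  (forall t, a <= t <= b -> curve_derive F t (f t)) -> cint a b f = F b - F a.
Proof.
move=> ab cf dF; rewrite /cint.
rewrite (Rintegral_FTC ab (within_continuous_Re cf) (fun t tab => proj1 (dF t tab))).
rewrite (Rintegral_FTC ab (within_continuous_Im cf) (fun t tab => proj2 (dF t tab))).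
by apply/eqP; rewrite eq_complex /= ReB ImB !eqxx.
Qed.

Lemma curve_deriveD F G t d e : curve_derive F t d -> curve_derive G t e ->
  curve_derive (fun s => F s + G s) t (d + e).
Proof.
move=> [F1 F2] [G1 G2]; split.
- rewrite (_ : (fun s => _) = (fun s => Re (F s)) + (fun s => Re (G s))).
    by rewrite ReD; exact: is_deriveD.
  by apply/funext => s; rewrite ReD.
- rewrite (_ : (fun s => _) = (fun s => Im (F s)) + (fun s => Im (G s))).
    by rewrite ImD; exact: is_deriveD.
  by apply/funext => s; rewrite ImD.
Qed.

Lemma curve_deriveM F G t d e : curve_derive F t d -> curve_derive G t e ->
  curve_derive (fun s => F s * G s) t (d * G t + F t * e).
Proof.
move=> [F1 F2] [G1 G2]; split.
- rewrite (_ : (fun s => _) = (fun s => Re (F s)) * (fun s => Re (G s))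
     - (fun s => Im (F s)) * (fun s => Im (G s))); last first.
    by apply/funext => s; rewrite ReM.
  apply: is_derive_eq (is_deriveB (is_deriveM F1 G1) (is_deriveM F2 G2)) _.
  by rewrite ReD !ReM /GRing.scale /=; ring.
- rewrite (_ : (fun s => _) = (fun s => Re (F s)) * (fun s => Im (G s))
     + (fun s => Im (F s)) * (fun s => Re (G s))); last first.
    by apply/funext => s; rewrite ImM.
  apply: is_derive_eq (is_deriveD (is_deriveM F1 G2) (is_deriveM F2 G1)) _.
  by rewrite ImD !ImM /GRing.scale /=; ring.
Qed.

Lemma curve_derive_cst (d : C) t : curve_derive (fun=> d) t 0.
Proof. by split; exact: is_derive_cst. Qed.

Lemma curve_derive_id t : curve_derive (fun s => s%:C) t 1.
Proof. by split; [exact: is_derive_id|exact: is_derive_cst]. Qed.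

Lemma curve_derive_continuous F t d : curve_derive F t d -> {for t, continuous F}.
Proof.
move=> [/is_derive_real_continuous c1 /is_derive_real_continuous c2].
have -> : F = fun s => Re (F s) +i* Im (F s).
  by apply/funext => s; case: (F s).
exact: cvg_complex.
Qed.

Lemma curve_derive_cmodP F t d : curve_derive F t d <->
  forall e : R, 0 < e -> exists2 r : R, 0 < r &
    forall s, `|s - t| < r -> cmod (F s - F t - (s - t)%:C * d) <= e * `|s - t|.
Proof.
split=> [[/is_derive_normP d1 /is_derive_normP d2] e e0|H].
- have e20 : 0 < e / 2 by rewrite divr_gt0.
  have [r1 r10 H1] := d1 _ e20; have [r2 r20 H2] := d2 _ e20.
  exists (Num.min r1 r2) => [|s]; first by rewrite lt_min r10.
  rewrite lt_min => /andP[s1 s2]; apply: le_trans (cmod_ReIm _) _.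
  rewrite !ReB !ImB ReZ ImZ (mulrC _ (Re d)) (mulrC _ (Im d)).
  by rewrite (splitr e) mulrDl lerD ?H1 ?H2.
- split; apply/is_derive_normP => e e0; have [r r0 Hr] := H _ e0; exists r => // s sr.
  + apply: le_trans (Hr _ sr); apply: le_trans (Re_cmod _).
    by rewrite !ReB ReZ (mulrC _ (Re d)).
  + apply: le_trans (Hr _ sr); apply: le_trans (Im_cmod _).
    by rewrite !ImB ImZ (mulrC _ (Im d)).
Qed.

Lemma curve_derive_comp (h : C -> C) F t d e : curve_derive F t d ->
  is_derive (F t) 1 h e -> curve_derive (fun s => h (F s)) t (e * d).
Proof.
move=> dF dh; have /curve_derive_cmodP HF := dF.
have /is_derive_cmodP Hh := dh.
have cF := curve_derive_continuous dF.
apply/curve_derive_cmodP => eps eps0.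
have d1 : 0 < cmod d + 1 by rewrite ltr_wpDl// cmod_ge0.
have e1 : 0 < cmod e + 1 by rewrite ltr_wpDl// cmod_ge0.
have [r1 r10 H1] := HF _ (@ltr01 R).
have [|r2 r20 H2] := HF (eps / (2 * (cmod e + 1))).
  by rewrite divr_gt0// mulr_gt0.
have [|r3 r30 H3] := Hh (eps / (2 * (cmod d + 1))).
  by rewrite divr_gt0// mulr_gt0.
have [r4 /= r40 H4] : \forall s \near t, cmod (F s - F t) < r3.
  by move/cvg_cmodP: cF => /(_ _ r30).
exists (Num.min r1 (Num.min r2 r4)); first by rewrite !lt_min r10 r20.
move=> s; rewrite !lt_min => /andP[s1 /andP[s2 s4]].
rewrite (_ : _ - _ - _ = (h (F s) - h (F t) - e * (F s - F t))
  + e * (F s - F t - (s - t)%:C * d)); last by ring.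
apply: le_trans (cmodD _ _) _; rewrite (splitr eps) mulrDl lerD//.
- have s4' : cmod (F s - F t) < r3 by apply: H4; rewrite /= distrC.
  apply: le_trans (H3 _ s4') _.
  have H5 : cmod (F s - F t) <= (cmod d + 1) * `|s - t|.
    rewrite -(subrK ((s - t)%:C * d) (F s - F t)) (le_trans (cmodD _ _))//.
    by rewrite cmodM cmod_real mulrDl addrC mulrC lerD2l H1.
  apply: le_trans (ler_wpM2l _ H5) _.
    by rewrite divr_ge0// ltW// mulr_gt0.
  rewrite mulrA ler_wpM2r// le_eqVlt; apply/orP; left; apply/eqP.
  by field; rewrite gt_eqF.
- rewrite cmodM (le_trans (ler_wpM2l (cmod_ge0 _) (H2 _ s2)))//.
  rewrite mulrA ler_wpM2r//.
  rewrite [leRHS](_ : _ = (cmod e + 1) * (eps / (2 * (cmod e + 1)))).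
    by rewrite ler_wpM2r ?lerDl// divr_ge0// ltW// mulr_gt0.
  by field; rewrite gt_eqF.
Qed.

Lemma curve_derive_circle r t :
  curve_derive (circle_pt r) t ('i%C * circle_pt r t).
Proof.
split; rewrite /circle_pt /=.
- rewrite mul0r mul1r sub0r -mulrN; exact: is_deriveZ.
- rewrite mul0r mul1r add0r; exact: is_deriveZ.
Qed.

Lemma continuous_circle r : continuous (circle_pt r : R -> C).
Proof. by move=> t; exact: curve_derive_continuous (curve_derive_circle r t). Qed.

Lemma cmod_circle r t : cmod (circle_pt r t) = `|r|.
Proof.
apply/eqP; rewrite -(@eqrXn2 _ 2) ?cmod_ge0// sqr_cmod /circle_pt /= !exprMn.
by rewrite -mulrDr cos2Dsin2 mulr1 real_normK ?num_real.
Qed.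

Lemma circle_ptE r t : circle_pt r t = r%:C * circle_pt 1 t.
Proof.
by rewrite /circle_pt; apply/eqP; rewrite eq_complex /= !mul0r !mul1r subr0 addr0 !eqxx.
Qed.

End CurveIntegral.

(** * Goursat's theorem on a parameter rectangle *)

Section Goursat.
Context {R : realType}.
Local Notation C := R[i].

(* Goursat's bisection argument for an arbitrary rectangle function. *)
Lemma additive_rectangle_eq0 (I : R -> R -> R -> R -> C) (s0 s1 t0 t1 : R) :
  s0 <= s1 -> t0 <= t1 ->
  (forall s s' t t', s0 <= s -> s <= s' -> s' <= s1 ->
      t0 <= t -> t <= t' -> t' <= t1 ->
    I s s' t t' = I s ((s + s') / 2) t ((t + t') / 2)
                + I ((s + s') / 2) s' t ((t + t') / 2)
                + I s ((s + s') / 2) ((t + t') / 2) t'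
                + I ((s + s') / 2) s' ((t + t') / 2) t') ->
  (forall x y e, s0 <= x <= s1 -> t0 <= y <= t1 -> 0 < e ->
    exists2 d : R, 0 < d & forall s s' t t',
      s0 <= s -> s <= x <= s' -> s' <= s1 -> t0 <= t -> t <= y <= t' -> t' <= t1 ->
      s' - s < d -> t' - t < d ->
      cmod (I s s' t t') <= e * ((s' - s) + (t' - t)) ^+ 2) ->
  I s0 s1 t0 t1 = 0.
Proof.
move=> s01 t01 Isplit Iloc; apply/eqP/negP => /negP; rewrite -cmod_gt0 => I0.
pose J (q : (R * R) * (R * R)) := cmod (I q.1.1 q.1.2 q.2.1 q.2.2).
pose ok (q : (R * R) * (R * R)) := [/\ s0 <= q.1.1, q.1.1 <= q.1.2, q.1.2 <= s1 &
  [/\ t0 <= q.2.1, q.2.1 <= q.2.2 & q.2.2 <= t1]].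
(* One of the four quarters carries at least a quarter of |I|. *)
pose good (q q' : (R * R) * (R * R)) := [/\ ok q', q.1.1 <= q'.1.1, q'.1.2 <= q.1.2 &
  [/\ q.2.1 <= q'.2.1, q'.2.2 <= q.2.2, q'.1.2 - q'.1.1 = (q.1.2 - q.1.1) / 2,
      q'.2.2 - q'.2.1 = (q.2.2 - q.2.1) / 2 & J q <= 4 * J q']].
have stepE : forall q, exists q', ok q -> good q q'.
  move=> q; have [okq|nok] := pselect (ok q); last by exists q.
  case: q okq => -[s s'] [t t'] [/= h1 h2 h3 [h4 h5 h6]].
  pose ms := (s + s') / 2; pose mt := (t + t') / 2.
  have mid (x y : R) : x <= y -> [/\ x <= (x + y) / 2, (x + y) / 2 <= y,
      (x + y) / 2 - x = (y - x) / 2 & y - (x + y) / 2 = (y - x) / 2].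
    by clear => xy; split; lra.
  have [a1 a2 a3 a4] := mid _ _ h2; have [b1 b2 b3 b4] := mid _ _ h5.
  have [a5 a6] := (le_trans h1 a1, le_trans a2 h3).
  have [b5 b6] := (le_trans h4 b1, le_trans b2 h6).
  rewrite -/ms in a1 a2 a3 a4 a5 a6; rewrite -/mt in b1 b2 b3 b4 b5 b6.
  have : [\/ J ((s, s'), (t, t')) <= 4 * J ((s, ms), (t, mt)),
      J ((s, s'), (t, t')) <= 4 * J ((ms, s'), (t, mt)),
      J ((s, s'), (t, t')) <= 4 * J ((s, ms), (mt, t')) |
      J ((s, s'), (t, t')) <= 4 * J ((ms, s'), (mt, t'))].
    have H : J ((s, s'), (t, t')) <= J ((s, ms), (t, mt)) + J ((ms, s'), (t, mt)) +
       J ((s, ms), (mt, t')) + J ((ms, s'), (mt, t')).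
      rewrite /J /= Isplit// -/ms -/mt.
      by do 3 apply: le_trans (cmodD _ _) (lerD _ (lexx _)).
    have [?|l1] := leP (J ((s, s'), (t, t'))) (4 * J ((s, ms), (t, mt))).
      exact: Or41.
    have [?|l2] := leP (J ((s, s'), (t, t'))) (4 * J ((ms, s'), (t, mt))).
      exact: Or42.
    have [?|l3] := leP (J ((s, s'), (t, t'))) (4 * J ((s, ms), (mt, t'))).
      exact: Or43.
    by apply: Or44; move: H l1 l2 l3; clear; lra.
  by case=> HJ; eexists => _; (split; [| | |split; try exact: HJ]);
    rewrite /ok /=; repeat split; rewrite ?lexx//.
have [step stepP] := choice stepE.
pose q n := iter n step ((s0, s1), (t0, t1)).
have okq n : ok (q n).
  elim: n => [|n IH]; first by rewrite /q /ok /= !lexx.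
  by case: (stepP _ IH).
have goodq n : good (q n) (q n.+1) by apply: stepP.
have lenS n : (q n).1.2 - (q n).1.1 = (s1 - s0) / 2 ^+ n.
  elim: n => [|n IH]; first by rewrite expr0 divr1.
  by case: (goodq n) => _ _ _ [_ _ -> _ _]; rewrite IH exprSr invfM mulrA.
have lenT n : (q n).2.2 - (q n).2.1 = (t1 - t0) / 2 ^+ n.
  elim: n => [|n IH]; first by rewrite expr0 divr1.
  by case: (goodq n) => _ _ _ [_ _ _ -> _]; rewrite IH exprSr invfM mulrA.
have Jn n : J (q 0) <= 4 ^+ n * J (q n).
  elim: n => [|n IH]; first by rewrite expr0 mul1r.
  apply: le_trans IH _; rewrite exprSr -mulrA ler_wpM2l ?exprn_ge0//.
  by case: (goodq n) => _ _ _ [].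
have mono n m : (n <= m)%N -> [/\ (q n).1.1 <= (q m).1.1, (q m).1.2 <= (q n).1.2,
    (q n).2.1 <= (q m).2.1 & (q m).2.2 <= (q n).2.2].
  elim: m => [|m IH]; first by rewrite leqn0 => /eqP ->.
  rewrite leq_eqVlt => /predU1P[->//|]; rewrite ltnS => /IH[a1 a2 a3 a4].
  by case: (goodq m) => _ b1 b2 [b3 b4 _ _ _]; split;
    [exact: le_trans b1|exact: le_trans a2|exact: le_trans b3|exact: le_trans a4].
have lim (u v : nat -> R) : (forall n m, (n <= m)%N -> u n <= u m /\ v m <= v n) ->
    (forall n, u n <= v n) -> exists x, forall n, u n <= x <= v n.
  move=> uv uv'; exists (sup (range u)) => n; apply/andP; split.
    apply: ub_le_sup; last by exists n.
    exists (v 0%N) => _ [m _ <-]; apply: le_trans (uv' m) _.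
    by have [] := uv 0%N m (leq0n _).
  apply: ge_sup; first by exists (u 0%N), 0%N.
  move=> _ [m _ <-]; have [nm|/ltnW mn] := leqP n m.
    by apply: le_trans (uv' m) _; have [] := uv _ _ nm.
  by apply: le_trans (uv' n); have [] := uv _ _ mn.
have [x xq] : exists x, forall n, (q n).1.1 <= x <= (q n).1.2.
  by apply: lim => [n m /mono[]//|n]; case: (okq n).
have [y yq] : exists y, forall n, (q n).2.1 <= y <= (q n).2.2.
  by apply: lim => [n m /mono[]//|n]; case: (okq n) => _ _ _ [].
pose l := (s1 - s0) + (t1 - t0).
have l0 : 0 <= l by rewrite addr_ge0// subr_ge0.
(* With this e the local bound gives J (q 0) <= 4^n e (l / 2^n)^2 = e l^2 < J (q 0); the added 1
   covers l = 0. *)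
have e0 : 0 < J (q 0) / (2 * (l ^+ 2 + 1)).
  by rewrite divr_gt0// mulr_gt0// ltr_wpDl// sqr_ge0.
have lS : s1 - s0 <= l by rewrite /l lerDl subr_ge0.
have lT : t1 - t0 <= l by rewrite /l lerDr subr_ge0.
have [d d0 Hd] := Iloc x y _ (xq 0%N) (yq 0%N) e0.
have [n nd] : exists n : nat, l / 2 ^+ n < d.
  exists (Num.truncn (l / d)).+1.
  rewrite ltr_pdivrMr ?exprn_gt0// mulrC -ltr_pdivrMr//.
  apply: lt_le_trans (truncnS_gt _) _.
  by rewrite -natrX ler_nat ltnW// ltn_expl.
have p0 : 0 < (2 ^+ n)^-1 :> R by rewrite invr_gt0 exprn_gt0.
case: (okq n) => h1 h2 h3 [h4 h5 h6].
have := Hd _ _ _ _ h1 (xq n) h3 h4 (yq n) h6.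
rewrite lenS lenT -mulrDl -/l.
have -> : (s1 - s0) / 2 ^+ n < d.
  by apply: le_lt_trans nd; rewrite ler_wpM2r// ltW.
have -> : (t1 - t0) / 2 ^+ n < d.
  by apply: le_lt_trans nd; rewrite ler_wpM2r// ltW.
move=> /(_ isT isT) Hn; have := Jn n; rewrite {2}/J => /le_trans.
move=> /(_ _ (ler_wpM2l (exprn_ge0 _ (ler0n _ 4)) Hn)).
apply/negP; rewrite -ltNge exprMn exprVn.
have -> : 4 ^+ n = (2 ^+ n) ^+ 2 :> R by rewrite -exprM mulnC exprM expr2 -natrM.
set E := (X in X < _); have -> : E = J (q 0) * (l ^+ 2 / (2 * (l ^+ 2 + 1))).
  rewrite /E; field; rewrite expf_neq0 ?pnatr_eq0// andbT.
  by rewrite gt_eqF// ltr_wpDl// sqr_ge0.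
rewrite -[ltRHS]mulr1 ltr_pM2l// ltr_pdivrMr ?mul1r; last first.
  by rewrite mulr_gt0// ltr_wpDl// sqr_ge0.
have := sqr_ge0 l; lra.
Qed.

End Goursat.

Section ParametricGoursat.
Context {R : realType}.
Local Notation C := R[i].

Lemma within_continuous_comp (A : set R) (h : R -> C) (G : C -> C) :
  {within A, continuous h} -> (forall t, A t -> {for h t, continuous G}) ->
  {within A, continuous (fun t => G (h t))}.
Proof.
move=> ch cG; rewrite continuous_subspace_in => t; rewrite inE => At.
apply: (@continuous_comp _ _ _ (h : subspace A -> C) G); first exact: ch.
exact: cG.
Qed.

Lemma segment_continuous_derive (F dF : R -> C) a b :
  (forall t, curve_derive F t (dF t)) -> segment_continuous a b F.
Proof.
move=> dFF; apply: continuous_within => t.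
exact: curve_derive_continuous (dFF t).
Qed.

Lemma curve_integrand_continuous (F dF : R -> C) (G : C -> C) a b :
  (forall t, curve_derive F t (dF t)) -> continuous dF ->
  (forall t, a <= t <= b -> {for F t, continuous G}) ->
  segment_continuous a b (fun t => G (F t) * dF t).
Proof.
move=> dFF cdF cG; apply: within_continuousM.
- apply: within_continuous_comp; first exact: segment_continuous_derive dFF.
  by move=> t; rewrite /= in_itv /=; exact: cG.
- exact: continuous_within.
Qed.

Lemma curve_lipschitz (F dF : R -> C) (L a b x y : R) :
  (forall t, curve_derive F t (dF t)) -> continuous dF ->
  (forall t, a <= t <= b -> cmod (dF t) <= L) ->
  a <= x <= b -> a <= y <= b -> cmod (F y - F x) <= L * `|y - x|.
Proof.
move=> dFF cdF dFL; wlog xy : x y / x <= y.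
  move=> H xab yab; have [xy|/ltW yx] := leP x y; first exact: H.
  by rewrite cmod_distC distrC H.
move=> /andP[ax xb] /andP[ay yb].
have cdF' : segment_continuous x y dF by exact: continuous_within.
rewrite -(cint_FTC xy cdF' (fun t _ => dFF t)) ger0_norm ?subr_ge0//.
apply: cmod_cint_le xy cdF' _ => t /andP[xt ty].
by apply: dFL; rewrite (le_trans ax)// (le_trans ty).
Qed.

(** A + B w has the primitive A w + B / 2 w^2, so its integral depends on the end points only; the
    rest is at most eta times the length of the curve. Around a rectangle the end point terms
    cancel. *)
Lemma curve_integral_linear_approx (F dF : R -> C) (G : C -> C) (A B : C) (L eta a b : R) :
  a <= b -> (forall t, curve_derive F t (dF t)) -> continuous dF ->
  (forall t, a <= t <= b -> {for F t, continuous G}) ->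
  (forall t, a <= t <= b -> cmod (dF t) <= L) ->
  (forall t, a <= t <= b -> cmod (G (F t) - (A + B * F t)) <= eta) ->
  cmod (cint a b (fun t => G (F t) * dF t) -
    ((A * F b + B / 2 * (F b * F b)) - (A * F a + B / 2 * (F a * F a))))
    <= eta * L * (b - a).
Proof.
move=> ab dFF cdF cG dFL FE.
have dP t : curve_derive (fun t => A * F t + B / 2 * (F t * F t)) t
    ((A + B * F t) * dF t).
  have := curve_deriveD (curve_deriveM (curve_derive_cst A t) (dFF t))
    (curve_deriveM (curve_derive_cst (B / 2) t) (curve_deriveM (dFF t) (dFF t))).
  by congr (curve_derive _ _ _); field.
have cF : segment_continuous a b F by exact: segment_continuous_derive dFF.
have cdF' : segment_continuous a b dF by exact: continuous_within.
have cL : segment_continuous a b (fun t => (A + B * F t) * dF t).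
  apply: within_continuousM; last exact: cdF'.
  apply: within_continuousD; first exact: within_continuous_cst.
  by apply: within_continuousM; [exact: within_continuous_cst|exact: cF].
have cGF := curve_integrand_continuous dFF cdF cG.
rewrite -(cint_FTC ab cL (fun t _ => dP t)) -(cintB cGF cL).
apply: (cmod_cint_le ab (within_continuousB cGF cL)) => t tab.
by rewrite -mulrBl cmodM ler_pM ?cmod_ge0 ?FE ?dFL.
Qed.

(** Stating it for the image of a rectangle under an arbitrary map phi makes a homotopy between two
    circles a direct instance. *)
Theorem goursat (phi ds dt : R -> R -> C) (G : C -> C) (s0 s1 t0 t1 L : R) :
  s0 <= s1 -> t0 <= t1 -> 0 < L ->
  (forall s t, curve_derive (phi^~ t) s (ds s t)) ->
  (forall s t, curve_derive (phi s) t (dt s t)) ->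
  (forall t, continuous (ds^~ t)) -> (forall s, continuous (dt s)) ->
  (forall s t, s0 <= s <= s1 -> t0 <= t <= t1 -> cmod (ds s t) <= L) ->
  (forall s t, s0 <= s <= s1 -> t0 <= t <= t1 -> cmod (dt s t) <= L) ->
  (forall s t, s0 <= s <= s1 -> t0 <= t <= t1 -> derivable G (phi s t) 1) ->
  cint s0 s1 (fun s => G (phi s t0) * ds s t0)
  + cint t0 t1 (fun t => G (phi s1 t) * dt s1 t)
  - cint s0 s1 (fun s => G (phi s t1) * ds s t1)
  - cint t0 t1 (fun t => G (phi s0 t) * dt s0 t) = 0.
Proof.
move=> s01 t01 L0 dS dT cS cT bS bT dG.
have cG s t : s0 <= s <= s1 -> t0 <= t <= t1 -> {for phi s t, continuous G}.
  by move=> hs ht; apply: derive_continuous; exact: dG.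
pose H t a b := cint a b (fun s => G (phi s t) * ds s t).
pose V s a b := cint a b (fun t => G (phi s t) * dt s t).
apply: (@additive_rectangle_eq0 R
  (fun s s' t t' => H t s s' + V s' t t' - H t' s s' - V s t t') s0 s1 t0 t1) => //.
- move=> s s' t t' h1 h2 h3 h4 h5 h6.
  set ms := (s + s') / 2; set mt := (t + t') / 2.
  have m1 : s <= ms by rewrite /ms; lra.
  have m2 : ms <= s' by rewrite /ms; lra.
  have m3 : t <= mt by rewrite /mt; lra.
  have m4 : mt <= t' by rewrite /mt; lra.
  have HE y : t0 <= y <= t1 -> H y s s' = H y s ms + H y ms s'.
    move=> hy; apply: cint_split => //.
    apply: (curve_integrand_continuous (F := phi^~ y) (dF := ds^~ y)) => // x /andP[x1 x2].
    by apply: cG => //; rewrite (le_trans h1 x1) (le_trans x2 h3).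
  have VE x : s0 <= x <= s1 -> V x t t' = V x t mt + V x mt t'.
    move=> hx; apply: cint_split => //.
    apply: (curve_integrand_continuous (F := phi x) (dF := dt x)) => // y /andP[y1 y2].
    by apply: cG => //; rewrite (le_trans h4 y1) (le_trans y2 h6).
  have ht : t0 <= t <= t1 by rewrite h4 (le_trans h5 h6).
  have ht' : t0 <= t' <= t1 by rewrite h6 (le_trans h4 h5).
  have hs : s0 <= s <= s1 by rewrite h1 (le_trans h2 h3).
  have hs' : s0 <= s' <= s1 by rewrite h3 (le_trans h1 h2).
  by rewrite (HE t ht) (HE t' ht') (VE s hs) (VE s' hs'); ring.
- move=> x y e hx hy e0.
  pose p := phi x y; have /derivable_is_derive := dG _ _ hx hy.
  set B := derive1 G _ => /is_derive_cmodP Hd.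
  (* The four sides have total length at most 2 L times (s' - s) + (t' - t), and the distance to p
     contributes another factor L. The bound r / (2 L) on both side lengths keeps the whole image
     within r of p. *)
  have e'0 : 0 < e / (2 * L ^+ 2) by rewrite divr_gt0// mulr_gt0// exprn_gt0.
  have [r r0 Hr] := Hd _ e'0.
  exists (r / (2 * L)); first by rewrite divr_gt0// mulr_gt0.
  move=> s s' t t' h1 /andP[h2 h2'] h3 h4 /andP[h5 h5'] h6 sd td.
  pose A := G p - B * p; pose eta := e / (2 * L ^+ 2) * (L * ((s' - s) + (t' - t))).
  have near_p u v : s <= u <= s' -> t <= v <= t' ->
      cmod (G (phi u v) - (A + B * phi u v)) <= eta.
    move=> /andP[u1 u2] /andP[v1 v2].
    have hu : s0 <= u <= s1 by rewrite (le_trans h1 u1) (le_trans u2 h3).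
    have hv : t0 <= v <= t1 by rewrite (le_trans h4 v1) (le_trans v2 h6).
    have d1 : cmod (phi u v - phi u y) <= L * `|v - y|.
      apply: (curve_lipschitz (F := phi u) (dT u) (cT u) (a := t0) (b := t1)) => // w hw.
      exact: bT.
    have d2 : cmod (phi u y - phi x y) <= L * `|u - x|.
      apply: (curve_lipschitz (F := phi^~ y) (fun w => dS w y) (cS y) (a := s0) (b := s1)) => //.
      by move=> w hw; exact: bS.
    have d3 : cmod (phi u v - p) <= L * ((s' - s) + (t' - t)).
      rewrite -(subrKA (phi u y)) (le_trans (cmodD _ _))//.
      apply: le_trans (lerD d1 d2) _; rewrite -mulrDr ler_pM2l// addrC lerD//.
        by rewrite ler_norml; apply/andP; split; lra.
      by rewrite ler_norml; apply/andP; split; lra.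
    rewrite (_ : _ - _ = G (phi u v) - G p - B * (phi u v - p)); last first.
      by rewrite /A; ring.
    apply: le_trans (Hr _ _) _; last by rewrite ler_wpM2l// ltW.
    apply: le_lt_trans d3 _.
    move: sd td; rewrite !ltr_pdivlMr ?mulr_gt0//; lra.
  have sub1 u : s <= u <= s' -> s0 <= u <= s1.
    by move=> /andP[u1 u2]; rewrite (le_trans h1 u1) (le_trans u2 h3).
  have sub2 v : t <= v <= t' -> t0 <= v <= t1.
    by move=> /andP[v1 v2]; rewrite (le_trans h4 v1) (le_trans v2 h6).
  have ss' : s <= s' by exact: le_trans h2 h2'.
  have tt' : t <= t' by exact: le_trans h5 h5'.
  pose P w := A * w + B / 2 * (w * w).
  have EH v : t <= v <= t' ->
      cmod (H v s s' - (P (phi s' v) - P (phi s v))) <= eta * L * (s' - s).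
    move=> hv; have hv' := sub2 _ hv.
    apply: (curve_integral_linear_approx (F := phi^~ v) (dF := ds^~ v)) => // u hu.
    - by apply: cG => //; exact: sub1.
    - by apply: bS => //; exact: sub1.
    - exact: near_p.
  have EV u : s <= u <= s' ->
      cmod (V u t t' - (P (phi u t') - P (phi u t))) <= eta * L * (t' - t).
    move=> hu; have hu' := sub1 _ hu.
    apply: (curve_integral_linear_approx (F := phi u) (dF := dt u)) => // v hv.
    - by apply: cG => //; exact: sub2.
    - by apply: bT => //; exact: sub2.
    - exact: near_p.
  rewrite (_ : _ - _ - _ = (H t s s' - (P (phi s' t) - P (phi s t)))
    + (V s' t t' - (P (phi s' t') - P (phi s' t)))
    - (H t' s s' - (P (phi s' t') - P (phi s t')))
    - (V s t t' - (P (phi s t') - P (phi s t)))); last by ring.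
  have sI : s <= s <= s' by rewrite lexx.
  have sI' : s <= s' <= s' by rewrite lexx andbT.
  have tI : t <= t <= t' by rewrite lexx.
  have tI' : t <= t' <= t' by rewrite lexx andbT.
  apply: le_trans (cmodB _ _) _; apply: le_trans (lerD (cmodB _ _) (EV _ sI)) _.
  apply: le_trans (lerD (lerD (cmodD _ _) (EH _ tI')) (lexx _)) _.
  apply: le_trans (lerD (lerD (lerD (EH _ tI) (EV _ sI')) (lexx _)) (lexx _)) _.
  rewrite le_eqVlt; apply/orP; left; apply/eqP; rewrite /eta; field.
  by rewrite gt_eqF.
Qed.

End ParametricGoursat.

(** * Cauchy's integral formula *)

Section CauchyFormula.
Context {R : realType}.
Local Notation C := R[i].

Lemma eq_by_small_dist (z w : C) (K : R) : 0 < K ->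
  (forall e, 0 < e -> cmod (z - w) <= K * e) -> z = w.
Proof.
move=> K0 H; apply/eqP; rewrite -subr_eq0; apply/negP => /negP.
rewrite -cmod_gt0 => p; have := H (cmod (z - w) / (2 * K)).
rewrite divr_gt0 ?mulr_gt0// => /(_ isT); apply/negP; rewrite -ltNge.
rewrite (_ : K * _ = cmod (z - w) / 2); first lra.
by field; rewrite gt_eqF.
Qed.

Lemma cint_cst (a b : R) (d : C) : a <= b -> cint a b (fun=> d) = (b - a)%:C * d.
Proof.
move=> ab.
have dF t : curve_derive (fun s : R => s%:C * d) t d.
  have := curve_deriveM (curve_derive_id t) (curve_derive_cst d t).
  by rewrite mul1r mulr0 addr0.
have cd : segment_continuous a b (fun=> d) by exact: within_continuous_cst.
by rewrite (cint_FTC ab cd (fun t _ => dF t)) -mulrBl -rmorphB.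
Qed.

(** The integrand is holomorphic off a, so Goursat's theorem on a homotopy of circles moves the
    integral to a small circle about a, where f is within e of f a. *)
Lemma cauchy_formula_cint (f : C -> C) (r : R) (a : C) :
  (forall z, cmod z <= r -> derivable f z 1) -> cmod a < r ->
  cint 0 (2 * pi) (fun t => f (circle_pt r t) / (circle_pt r t - a) *
    ('i%C * circle_pt r t)) = (2 * pi)%:C * ('i%C * f a).
Proof.
move=> df ar; have r0 : 0 < r by apply: le_lt_trans ar; exact: cmod_ge0.
have pi20 : 0 < 2 * pi :> R by rewrite mulr_gt0// pi_gt0.
apply: (eq_by_small_dist pi20) => e e0.
have fa : {for a, continuous f} by apply/derive_continuous/df/ltW.
move/cvg_cmodP: (fa) => /(_ _ e0)/nbhs_cmodP[d d0 Hd].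
(* The bound r - |a| keeps the homotopy inside the closed disc of radius r and at distance at least
   ep from a. *)
pose ep := Num.min (d / 2) (r - cmod a).
have ep0 : 0 < ep by rewrite lt_min divr_gt0// subr_gt0.
have epd : ep < d by rewrite gt_min; apply/orP; left; lra.
have epr : ep <= r - cmod a by rewrite ge_min lexx orbT.
pose E := circle_pt (1 : R).
have cE t : cmod (E t) = 1 by rewrite cmod_circle normr1.
(* A homotopy from the circle of radius ep about a to the circle of radius r about 0. *)
pose phi (s t : R) : C := a + (ep * (1 - s) + s * r)%:C * E t - s%:C * a.
pose ds (s t : R) : C := (r - ep)%:C * E t - a.
pose dt (s t : R) : C := (ep * (1 - s) + s * r)%:C * ('i%C * E t).
have dE t : curve_derive E t ('i%C * E t) by exact: curve_derive_circle.
have phiE s t : phi s t = (a + ep%:C * E t) + s%:C * ds s t.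
  rewrite /phi /ds (_ : ep * (1 - s) + s * r = ep + s * (r - ep)); last by ring.
  by rewrite rmorphD rmorphM; ring.
have phia s t : phi s t - a = (ep * (1 - s) + s * r)%:C * E t - s%:C * a.
  by rewrite /phi; ring.
have ep' : 0 <= cmod a by exact: cmod_ge0.
have w0 s : 0 <= s <= 1 -> 0 <= ep * (1 - s) + s * r by move=> /andP[]; nra.
have phi_a s t : 0 <= s <= 1 -> ep <= cmod (phi s t - a).
  move=> hs; rewrite phia; apply: le_trans (lerB_cmod _ _).
  rewrite !cmodM !cmod_real cE mulr1 !ger0_norm ?w0//; last by case/andP: hs.
  move: hs => /andP[]; nra.
have phi_r s t : 0 <= s <= 1 -> cmod (phi s t) <= r.
  move=> hs; rewrite (_ : phi s t = (1 - s)%:C * a + (ep * (1 - s) + s * r)%:C * E t).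
    apply: le_trans (cmodD _ _) _; rewrite !cmodM !cmod_real cE mulr1 !ger0_norm ?w0//.
      by move: hs => /andP[]; nra.
    by case/andP: hs => _; rewrite subr_ge0.
  by rewrite /phi rmorphB; ring.
have dphi_s s t : curve_derive (phi^~ t) s (ds s t).
  have := curve_deriveD (curve_derive_cst (a + ep%:C * E t) s)
    (curve_deriveM (curve_derive_id s) (curve_derive_cst (ds s t) s)).
  rewrite add0r mul1r mulr0 addr0.
  by congr (curve_derive _ _ _); apply/funext => u; rewrite phiE.
have dphi_t s t : curve_derive (phi s) t (dt s t).
  have := curve_deriveD (curve_derive_cst (a - s%:C * a) t)
    (curve_deriveM (curve_derive_cst (ep * (1 - s) + s * r)%:C t) (dE t)).
  rewrite add0r mul0r add0r.
  by congr (curve_derive _ _ _); apply/funext => u; rewrite /phi; ring.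
have cds t : continuous (ds^~ t) by move=> u; exact: cst_continuous.
have cdt s : continuous (dt s).
  move=> t; exact: curve_derive_continuous
    (curve_deriveM (curve_derive_cst _ t) (curve_deriveM (curve_derive_cst _ t) (dE t))).
have ci : cmod ('i%C : C) = 1 by rewrite /cmod /= expr0n expr1n add0r sqrtr1.
have L0 : 0 < 3 * r by rewrite mulr_gt0.
have Bds s t : 0 <= s <= 1 -> 0 <= t <= 2 * pi -> cmod (ds s t) <= 3 * r.
  move=> _ _; rewrite /ds (le_trans (cmodB _ _))// cmodM cmod_real cE mulr1.
  by rewrite ger0_norm; lra.
have Bdt s t : 0 <= s <= 1 -> 0 <= t <= 2 * pi -> cmod (dt s t) <= 3 * r.
  move=> hs _; rewrite /dt !cmodM cmod_real ci cE !mulr1 ger0_norm ?w0//.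
  by move: hs => /andP[]; nra.
have dG s t : 0 <= s <= 1 -> 0 <= t <= 2 * pi ->
    derivable (fun w => f w / (w - a)) (phi s t) 1.
  move=> hs _; apply: cderivableM; first exact/df/phi_r.
  apply: cderivableV; last exact: entire_shift.
  by rewrite -cmod_gt0 (lt_le_trans ep0)// phi_a.
have := goursat ler01 (ltW pi20) L0 dphi_s dphi_t cds cdt Bds Bdt dG.
(* The sides t = 0 and t = 2 pi of the parameter rectangle have the same image, so their integrals
   cancel. *)
have E2 : E (2 * pi) = E 0.
  by rewrite /E /circle_pt (mulr_natl pi 2) cos2pi sin2pi cos0 sin0.
have -> : (fun s : R => f (phi s (2 * pi)) / (phi s (2 * pi) - a) * ds s (2 * pi)) =
    (fun s : R => f (phi s 0) / (phi s 0 - a) * ds s 0).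
  by apply/funext => s; rewrite /phi /ds E2.
rewrite (addrAC (cint 0 1 _)) subrr add0r => /eqP.
set I0 := cint 0 (2 * pi) (fun t => f (phi 0 t) / _ * _).
rewrite subr_eq0 => /eqP I1.
have phi1 t : phi 1 t = circle_pt r t.
  by rewrite /phi subrr mulr0 add0r mul1r rmorph1 mul1r addrAC subrr add0r [RHS]circle_ptE.
have phi0 t : phi 0 t = a + ep%:C * E t.
  by rewrite /phi subr0 mulr1 mul0r addr0 rmorph0 mul0r subr0.
rewrite (_ : cint 0 (2 * pi) _ = I0); last first.
  rewrite -I1; apply: eq_cint => t _; rewrite phi1 /dt.
  rewrite subrr mulr0 add0r mul1r; congr (_ * _).
  by rewrite [circle_pt r t]circle_ptE -/(E t) mulrCA.
have epE t : ep%:C * E t != 0.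
  by rewrite -cmod_gt0 cmodM cmod_real cE mulr1 gtr0_norm.
have cI0 : segment_continuous 0 (2 * pi) (fun t => 'i%C * f (phi 0 t)).
  apply: within_continuousM; first exact: within_continuous_cst.
  apply: within_continuous_comp.
    exact: segment_continuous_derive (dphi_t 0).
  by move=> t _; apply/derive_continuous/df/phi_r; rewrite lexx ler01.
have cst : segment_continuous 0 (2 * pi) (fun=> 'i%C * f a) by exact: within_continuous_cst.
have -> : I0 = cint 0 (2 * pi) (fun t => 'i%C * f (phi 0 t)).
  apply: eq_cint => t _; rewrite phi0 addrAC subrr add0r /dt subr0 mulr1 mul0r addr0.
  rewrite (mulrCA ep%:C 'i%C) mulrC -mulrA; congr (_ * _).
  by rewrite mulrCA mulfV ?mulr1// epE.
rewrite -[X in X%:C * _]subr0 -(cint_cst _ (ltW pi20)) -(cintB cI0 cst).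
rewrite [leRHS]mulrC -[X in _ <= _ * X]subr0; apply: (cmod_cint_le (ltW pi20)).
  exact: within_continuousB cI0 cst.
move=> t _; rewrite -mulrBr cmodM ci mul1r; apply/ltW/Hd.
by rewrite phi0 addrAC subrr add0r cmodM cmod_real cE mulr1 gtr0_norm.
Qed.

Definition circle_mean (psi : R -> C) : C :=
  ((2 * pi)^-1)%:C * cint 0 (2 * pi) psi.

Definition circle_continuous (psi : R -> C) := segment_continuous 0 (2 * pi) psi.

Lemma circle_meanD (psi chi : R -> C) :
  circle_continuous psi -> circle_continuous chi ->
  circle_mean (fun t => psi t + chi t) = circle_mean psi + circle_mean chi.
Proof. by move=> c1 c2; rewrite /circle_mean (cintD c1 c2) mulrDr. Qed.

Lemma circle_meanB (psi chi : R -> C) :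
  circle_continuous psi -> circle_continuous chi ->
  circle_mean (fun t => psi t - chi t) = circle_mean psi - circle_mean chi.
Proof. by move=> c1 c2; rewrite /circle_mean (cintB c1 c2) mulrBr. Qed.

Lemma circle_meanZ (d : C) (psi : R -> C) : circle_continuous psi ->
  circle_mean (fun t => d * psi t) = d * circle_mean psi.
Proof. by move=> c; rewrite /circle_mean (cintZ _ c) mulrCA. Qed.

Lemma eq_circle_mean (psi chi : R -> C) : psi =1 chi ->
  circle_mean psi = circle_mean chi.
Proof. by move=> /funext ->. Qed.

Lemma pi2_gt0 : 0 < 2 * pi :> R.
Proof. by rewrite mulr_gt0// pi_gt0. Qed.

Lemma cmod_circle_mean_le (psi : R -> C) (B : R) : circle_continuous psi ->
  (forall t, 0 <= t <= 2 * pi -> cmod (psi t) <= B) -> cmod (circle_mean psi) <= B.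
Proof.
move=> c H; rewrite cmodZ gtr0_norm ?invr_gt0 ?pi2_gt0//.
rewrite ler_pdivrMl ?pi2_gt0// [leRHS]mulrC -[X in _ <= _ * X]subr0.
exact: (cmod_cint_le (ltW pi2_gt0) c).
Qed.

Lemma le_cmod_circle_mean (psi : R -> C) : circle_continuous psi ->
  cmod (circle_mean psi) <=
  (2 * pi)^-1 * \int[@lebesgue_measure R]_(t in `[0, 2 * pi]) cmod (psi t).
Proof.
move=> c; rewrite cmodZ gtr0_norm ?invr_gt0 ?pi2_gt0//.
by rewrite ler_pM2l ?invr_gt0 ?pi2_gt0// le_cmod_cint.
Qed.

(** Since dz = i z dt on the circle, dz / (2 pi i) becomes z times the normalised measure dt / (2
    pi); this is the extra factor [circle_pt r t]. *)
Theorem cauchy_formula (f : C -> C) (r : R) (a : C) :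
  (forall z, cmod z <= r -> derivable f z 1) -> cmod a < r ->
  f a = circle_mean (fun t => f (circle_pt r t) * circle_pt r t / (circle_pt r t - a)).
Proof.
move=> df ar; have H := cauchy_formula_cint df ar.
have r0 : 0 <= r by apply: ltW; apply: le_lt_trans ar; exact: cmod_ge0.
have cz t : circle_pt r t - a != 0.
  rewrite -cmod_gt0; apply: lt_le_trans (lerB_cmod _ _).
  by rewrite cmod_circle ger0_norm// subr_gt0.
have cf : circle_continuous (fun t => f (circle_pt r t) * circle_pt r t / (circle_pt r t - a)).
  have cc : circle_continuous (circle_pt r) by apply: continuous_within; exact: continuous_circle.
  apply: within_continuousM.
    apply: within_continuousM; last exact: cc.
    apply: within_continuous_comp; first exact: cc.
    by move=> t _; apply/derive_continuous/df; rewrite cmod_circle ger0_norm.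
  apply: within_continuousV => [t _|]; first exact: cz.
  by apply: within_continuousB; [exact: cc|exact: within_continuous_cst].
have i0 : 'i%C != 0 :> C by rewrite eq_complex /= oner_eq0 andbF.
apply: (mulfI i0); rewrite -(circle_meanZ _ cf) /circle_mean.
have p0 : (2 * pi)%:C != 0 :> C.
  by rewrite -(rmorph0 (real_complex R)) (inj_eq (@complexI R)) gt_eqF// pi2_gt0.
apply: (mulfI p0); rewrite -H mulrA -rmorphM mulfV ?gt_eqF ?pi2_gt0// rmorph1 mul1r.
by apply: eq_cint => t _; field; exact: cz.
Qed.

End CauchyFormula.

(** * Derivatives and estimates from Cauchy's formula *)

Section CauchyConsequences.
Context {R : realType}.
Local Notation C := R[i].
Implicit Types (f g : C -> C) (psi : R -> C) (r : R).

Lemma eq_near_derive f g z d (e : R) : 0 < e ->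
  (forall w, cmod (w - z) < e -> f w = g w) -> is_derive z 1 f d -> is_derive z 1 g d.
Proof.
move=> e0 fg /is_derive_cmodP H; apply/is_derive_cmodP => eps eps0.
have [r r0 Hr] := H _ eps0; exists (Num.min r e); first by rewrite lt_min r0.
move=> w; rewrite lt_min => /andP[wr we].
by rewrite -!fg ?Hr// subrr cmod0.
Qed.

(** A remainder that is quadratic in w - z uniformly in t stays quadratic after integration, so no
    limit theorem for integrals is involved. *)
Lemma derive_cint (K K' : C -> R -> C) (z : C) (a b eta B : R) : a <= b -> 0 < eta ->
  (forall w, cmod (w - z) < eta -> segment_continuous a b (K w)) ->
  segment_continuous a b (K' z) ->
  (forall w t, cmod (w - z) < eta -> a <= t <= b ->
    cmod (K w t - K z t - (w - z) * K' z t) <= B * cmod (w - z) ^+ 2) ->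
  is_derive z 1 (fun w => cint a b (K w)) (cint a b (K' z)).
Proof.
move=> ab eta0 cK cK' HK; apply/is_derive_cmodP => e e0.
pose D := `|B| * (b - a) + 1.
have D0 : 0 < D by rewrite ltr_wpDl// mulr_ge0// subr_ge0.
exists (Num.min eta (e / D)); first by rewrite lt_min eta0 divr_gt0.
move=> w; rewrite lt_min => /andP[w1 w2].
have cz : segment_continuous a b (K z) by apply: cK; rewrite subrr cmod0.
have cw := cK _ w1.
have cZ : segment_continuous a b (fun t => (w - z) * K' z t).
  by apply: within_continuousM; [exact: within_continuous_cst|exact: cK'].
rewrite mulrC -(cintZ _ cK') -(cintB cw cz) -(cintB (within_continuousB cw cz) cZ).
apply: le_trans (cmod_cint_le ab (within_continuousB (within_continuousB cw cz) cZ) (HK w ^~ w1)) _.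
have c0 := cmod_ge0 (w - z).
move: w2; rewrite ltr_pdivlMr// => w2.
rewrite expr2 mulrA mulrAC; apply: ler_wpM2r => //.
have ba : 0 <= b - a by rewrite subr_ge0.
have := ler_wpM2r ba (ler_norm B); have := normr_ge0 B.
move: w2; rewrite /D; set c := cmod _ in c0 *; nra.
Qed.

Lemma derive_circle_mean (K K' : C -> R -> C) (z : C) (eta B : R) : 0 < eta ->
  (forall w, cmod (w - z) < eta -> circle_continuous (K w)) ->
  circle_continuous (K' z) ->
  (forall w t, cmod (w - z) < eta -> 0 <= t <= 2 * pi ->
    cmod (K w t - K z t - (w - z) * K' z t) <= B * cmod (w - z) ^+ 2) ->
  is_derive z 1 (fun w => circle_mean (K w)) (circle_mean (K' z)).
Proof.
move=> eta0 cK cK' HK; have dI := derive_cint (ltW (@pi2_gt0 R)) eta0 cK cK' HK.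
have := cderiveM (cderive_cst ((2 * pi)^-1)%:C z) dI.
by rewrite mul0r add0r.
Qed.

Lemma segment_bounded (a b : R) psi : a <= b -> segment_continuous a b psi ->
  exists2 S : R, 0 <= S & forall t, a <= t <= b -> cmod (psi t) <= S.
Proof.
move=> ab c; have [t _ H] := EVT_max ab (within_continuous_cmod c).
exists (cmod (psi t)); first exact: cmod_ge0.
by move=> u uab; apply: H; rewrite in_itv.
Qed.

Lemma circle_pt_continuous r : circle_continuous (circle_pt r).
Proof. by apply: continuous_within; exact: continuous_circle. Qed.

Lemma circle_dist_ge r (z : C) t : 0 <= r -> r - cmod z <= cmod (circle_pt r t - z).
Proof.
by move=> r0; apply: le_trans (lerB_cmod _ _); rewrite cmod_circle ger0_norm.
Qed.

Lemma circle_sub_neq0 r (z : C) t : cmod z < r -> circle_pt r t - z != 0.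
Proof.
move=> zr; rewrite -cmod_gt0; apply: lt_le_trans (circle_dist_ge _ _ _).
  by rewrite subr_gt0.
by apply/ltW/le_lt_trans/zr/cmod_ge0.
Qed.

Lemma cauchy_kernel_continuous r (z : C) n psi : cmod z < r -> circle_continuous psi ->
  circle_continuous (fun t => psi t / (circle_pt r t - z) ^+ n).
Proof.
move=> zr cpsi; apply: within_continuousM; first exact: cpsi.
apply: within_continuousV => [t _|]; first by rewrite expf_neq0// circle_sub_neq0.
elim: n => [|n IH]; first exact: within_continuous_cst.
have -> : (fun t => (circle_pt r t - z) ^+ n.+1) =
    (fun t => (circle_pt r t - z) * (circle_pt r t - z) ^+ n).
  by apply/funext => t; rewrite exprS.
apply: within_continuousM; last exact: IH.
by apply: within_continuousB; [exact: circle_pt_continuous|exact: within_continuous_cst].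
Qed.

Lemma cmod_exprVn_le (u : C) (d : R) n : 0 < d -> d <= cmod u ->
  cmod (u ^- n) <= d ^- n.
Proof.
move=> d0 du; have u0 := lt_le_trans d0 du.
rewrite cmodV cmodX lef_pV2 ?posrE ?exprn_gt0//.
by apply: lerXn2r => //; rewrite nnegrE ?cmod_ge0// ltW.
Qed.

(** The remainder is exactly h^2 / (u^2 (u - h)). For Cauchy kernels, u is the vector from z to the
    circle and h = w - z. *)
Lemma inv_second_order (u h : C) (d : R) : 0 < d -> d <= cmod u -> d <= cmod (u - h) ->
  cmod (1 / (u - h) - 1 / u - h * (1 / u ^+ 2)) <= d ^- 3 * cmod h ^+ 2.
Proof.
move=> d0 du duh.
have u0 : u != 0 by rewrite -cmod_gt0 (lt_le_trans d0).
have uh0 : u - h != 0 by rewrite -cmod_gt0 (lt_le_trans d0).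
rewrite (_ : _ - _ = (u ^- 2 * (u - h)^-1) * h ^+ 2); last by field; rewrite u0 uh0.
rewrite cmodM cmodX ler_wpM2r ?exprn_ge0 ?cmod_ge0// cmodM.
have -> : d ^- 3 = d ^- 2 * d ^- 1 by rewrite -invfM -exprD.
by rewrite ler_pM ?cmod_ge0// ?(cmod_exprVn_le 2 d0 du)// (cmod_exprVn_le 1 d0 duh).
Qed.

(** The remainder divided by h^2 is u^-2 (u - h)^-2 + 2 u^-3 (u - h)^-1, three terms of modulus at
    most d^-4 each. *)
Lemma inv2_second_order (u h : C) (d : R) : 0 < d -> d <= cmod u -> d <= cmod (u - h) ->
  cmod (1 / (u - h) ^+ 2 - 1 / u ^+ 2 - h * (2 / u ^+ 3)) <= 3 * d ^- 4 * cmod h ^+ 2.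
Proof.
move=> d0 du duh.
have u0 : u != 0 by rewrite -cmod_gt0 (lt_le_trans d0).
have uh0 : u - h != 0 by rewrite -cmod_gt0 (lt_le_trans d0).
rewrite (_ : _ - _ = (u ^- 2 * (u - h) ^- 2 + 2 * (u ^- 3 * (u - h)^-1)) * h ^+ 2);
  last by field; rewrite u0 uh0.
rewrite cmodM cmodX ler_wpM2r ?exprn_ge0 ?cmod_ge0//.
have Vu n := cmod_exprVn_le n d0 du.
have Vuh n := cmod_exprVn_le n d0 duh.
apply: le_trans (cmodD _ _) _; rewrite !cmodM cmod_nat.
have d4 k : (k <= 4)%N -> d ^- k * d ^- (4 - k)%N = d ^- 4.
  by move=> k4; rewrite -invfM -exprD subnKC.
have A1 : cmod (u ^- 2) * cmod ((u - h) ^- 2) <= d ^- 4.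
  by rewrite -(d4 2%N isT) ler_pM ?cmod_ge0.
have A2 : cmod (u ^- 3) * cmod ((u - h)^-1) <= d ^- 4.
  by rewrite -(d4 3%N isT) ler_pM ?cmod_ge0// -[(u - h)^-1]/((u - h) ^- 1) Vuh.
lra.
Qed.

Lemma derive_cauchy_integral r psi (z : C) : cmod z < r -> circle_continuous psi ->
  is_derive z 1 (fun w => circle_mean (fun t => psi t / (circle_pt r t - w)))
    (circle_mean (fun t => psi t / (circle_pt r t - z) ^+ 2)).
Proof.
move=> zr cpsi; have r0 : 0 <= r by apply/ltW/le_lt_trans/zr/cmod_ge0.
have [S S0 HS] := segment_bounded (ltW (@pi2_gt0 R)) cpsi.
pose d := (r - cmod z) / 2; have d0 : 0 < d by rewrite divr_gt0// subr_gt0.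
have wr w : cmod (w - z) < d -> cmod w <= r - d.
  move=> wz; rewrite -(subrK z w) (le_trans (cmodD _ _))//; rewrite /d in wz *; lra.
apply: (derive_circle_mean (B := S * d ^- 3)
  (K := fun w t => psi t / (circle_pt r t - w))
  (K' := fun w t => psi t / (circle_pt r t - w) ^+ 2) d0).
- move=> w /wr wr'; have wr2 : cmod w < r by apply: le_lt_trans wr' _; lra.
  exact: (@cauchy_kernel_continuous r w 1 _ wr2 cpsi).
- exact: cauchy_kernel_continuous zr cpsi.
- move=> w t wz tp; pose u := circle_pt r t - z.
  rewrite (_ : _ - _ = psi t * (1 / (u - (w - z)) - 1 / u - (w - z) * (1 / u ^+ 2))).
    rewrite cmodM -mulrA ler_pM ?cmod_ge0 ?HS//; apply: inv_second_order => //.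
      by apply: le_trans (circle_dist_ge _ _ r0); rewrite /d; lra.
    rewrite /u opprB addrA subrK; apply: le_trans (circle_dist_ge _ _ r0).
    by have := wr _ wz; lra.
  have -> : circle_pt r t - w = u - (w - z) by rewrite /u; ring.
  by rewrite -/u !mul1r; ring.
Qed.

Lemma derive_cauchy_integral2 r psi (z : C) : cmod z < r -> circle_continuous psi ->
  is_derive z 1 (fun w => circle_mean (fun t => psi t / (circle_pt r t - w) ^+ 2))
    (circle_mean (fun t => psi t * 2 / (circle_pt r t - z) ^+ 3)).
Proof.
move=> zr cpsi; have r0 : 0 <= r by apply/ltW/le_lt_trans/zr/cmod_ge0.
have [S S0 HS] := segment_bounded (ltW (@pi2_gt0 R)) cpsi.
pose d := (r - cmod z) / 2; have d0 : 0 < d by rewrite divr_gt0// subr_gt0.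
have wr w : cmod (w - z) < d -> cmod w <= r - d.
  move=> wz; rewrite -(subrK z w) (le_trans (cmodD _ _))//; rewrite /d in wz *; lra.
apply: (derive_circle_mean (B := S * (3 * d ^- 4))
  (K := fun w t => psi t / (circle_pt r t - w) ^+ 2)
  (K' := fun w t => psi t * 2 / (circle_pt r t - w) ^+ 3) d0).
- move=> w /wr wr'; have wr2 : cmod w < r by apply: le_lt_trans wr' _; lra.
  exact: cauchy_kernel_continuous wr2 cpsi.
- have cpsi2 : circle_continuous (fun t => psi t * 2).
    by apply: within_continuousM; [exact: cpsi|exact: within_continuous_cst].
  exact: cauchy_kernel_continuous zr cpsi2.
- move=> w t wz tp; pose u := circle_pt r t - z.
  rewrite (_ : _ - _ = psi t * (1 / (u - (w - z)) ^+ 2 - 1 / u ^+ 2 - (w - z) * (2 / u ^+ 3))).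
    rewrite cmodM -mulrA ler_pM ?cmod_ge0 ?HS//; apply: inv2_second_order => //.
      by apply: le_trans (circle_dist_ge _ _ r0); rewrite /d; lra.
    rewrite /u opprB addrA subrK; apply: le_trans (circle_dist_ge _ _ r0).
    by have := wr _ wz; lra.
  have -> : circle_pt r t - w = u - (w - z) by rewrite /u; ring.
  by rewrite -/u !mul1r; ring.
Qed.

Section Disc.
Variables (f : C -> C) (r : R).
Hypothesis df : forall z, cmod z <= r -> derivable f z 1.
Let psi t := f (circle_pt r t) * circle_pt r t.

Lemma holomorphic_circle_continuous : 0 <= r ->
  circle_continuous (fun t => f (circle_pt r t)).
Proof.
move=> r0; apply: within_continuous_comp; first exact: circle_pt_continuous.
by move=> t _; apply/derive_continuous/df; rewrite cmod_circle ger0_norm.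
Qed.

Lemma cauchy_density_continuous : 0 <= r -> circle_continuous psi.
Proof.
move=> r0; apply: within_continuousM; first exact: holomorphic_circle_continuous.
exact: circle_pt_continuous.
Qed.

Lemma is_derive_cauchy_formula (z : C) : cmod z < r ->
  is_derive z 1 f (circle_mean (fun t => psi t / (circle_pt r t - z) ^+ 2)).
Proof.
move=> zr; have r0 : 0 <= r by apply/ltW/le_lt_trans/zr/cmod_ge0.
have e0 : 0 < r - cmod z by rewrite subr_gt0.
apply: (eq_near_derive e0 _ (derive_cauchy_integral zr (cauchy_density_continuous r0))).
move=> w wz; rewrite [RHS](cauchy_formula df)//.
by rewrite -(subrK z w) (le_lt_trans (cmodD _ _))// -ltrBrDr.
Qed.

Lemma derive_cauchy_formula (z : C) : cmod z < r ->
  derive1 f z = circle_mean (fun t => psi t / (circle_pt r t - z) ^+ 2).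
Proof. by move=> zr; apply: is_derive_derive1; exact: is_derive_cauchy_formula. Qed.

Lemma derivable_derive1 (z : C) : cmod z < r -> derivable (derive1 f) z 1.
Proof.
move=> zr; have r0 : 0 <= r by apply/ltW/le_lt_trans/zr/cmod_ge0.
have e0 : 0 < r - cmod z by rewrite subr_gt0.
have dI := derive_cauchy_integral2 zr (cauchy_density_continuous r0).
suff H : is_derive z 1 (derive1 f)
    (circle_mean (fun t => psi t * 2 / (circle_pt r t - z) ^+ 3)) by case: H.
apply: (eq_near_derive e0 _ dI) => w wz.
rewrite derive_cauchy_formula//.
by rewrite -(subrK z w) (le_lt_trans (cmodD _ _))// -ltrBrDr.
Qed.

(** The bound is uniform in both points, as is needed to differentiate the integral along rays in
    [disc_primitive]. It comes from expanding the kernel under Cauchy's formula. *)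
Lemma holomorphic_second_order (rho : R) : rho < r ->
  exists B, forall z w, cmod z <= rho -> cmod w <= rho ->
    cmod (f w - f z - (w - z) * derive1 f z) <= B * cmod (w - z) ^+ 2.
Proof.
move=> rr; have [r0|r0] := ltP r 0.
  by exists 0 => z w /le_lt_trans/(_ rr)/lt_trans/(_ r0); rewrite ltNge cmod_ge0.
have d0 : 0 < r - rho by rewrite subr_gt0.
have cpsi := cauchy_density_continuous r0.
have [S S0 HS] := segment_bounded (ltW (@pi2_gt0 R)) cpsi.
exists (S * (r - rho) ^- 3) => z w zr wr.
have zr' := le_lt_trans zr rr; have wr' := le_lt_trans wr rr.
rewrite (cauchy_formula df wr') (cauchy_formula df zr') (derive_cauchy_formula zr').
have cK v : cmod v < r -> circle_continuous (fun t => psi t / (circle_pt r t - v)).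
  by move=> vr; exact: (@cauchy_kernel_continuous r v 1 _ vr cpsi).
have cK2 : circle_continuous (fun t => (w - z) * (psi t / (circle_pt r t - z) ^+ 2)).
  apply: within_continuousM; first exact: within_continuous_cst.
  exact: cauchy_kernel_continuous zr' cpsi.
rewrite -(circle_meanZ _ (cauchy_kernel_continuous (n := 2) zr' cpsi)).
rewrite -(circle_meanB (cK _ wr') (cK _ zr')).
rewrite -(circle_meanB (within_continuousB (cK _ wr') (cK _ zr')) cK2).
apply: cmod_circle_mean_le.
  exact: within_continuousB (within_continuousB (cK _ wr') (cK _ zr')) cK2.
move=> t tp; pose u := circle_pt r t - z.
rewrite (_ : _ - _ = psi t * (1 / (u - (w - z)) - 1 / u - (w - z) * (1 / u ^+ 2))).
  rewrite cmodM -mulrA ler_pM ?cmod_ge0 ?HS//; apply: inv_second_order => //.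
    by apply: le_trans (circle_dist_ge _ _ r0); lra.
  rewrite /u opprB addrA subrK; apply: le_trans (circle_dist_ge _ _ r0).
  by lra.
have -> : circle_pt r t - w = u - (w - z) by rewrite /u; ring.
by rewrite -/u !mul1r; ring.
Qed.

Lemma holomorphic_mean_value : 0 < r -> f 0 = circle_mean (fun t => f (circle_pt r t)).
Proof.
move=> r0; rewrite (cauchy_formula df (a := 0)) ?cmod0//; apply: eq_circle_mean => t.
by rewrite subr0 mulfK// -cmod_gt0 cmod_circle gtr0_norm.
Qed.

(** A crude maximum principle: for |a| <= r / 2 the Cauchy kernel r / |zeta - a| is at most 2. *)
Lemma holomorphic_bound (B : R) (a : C) : 0 < r -> cmod a <= r / 2 ->
  (forall t, 0 <= t <= 2 * pi -> cmod (f (circle_pt r t)) <= B) -> cmod (f a) <= 2 * B.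
Proof.
move=> r0 ar fB; have ar' : cmod a < r by lra.
have cpsi := cauchy_density_continuous (ltW r0).
rewrite (cauchy_formula df ar'); apply: cmod_circle_mean_le => [|t tp].
  exact: (@cauchy_kernel_continuous r a 1 _ ar' cpsi).
have zr : cmod (circle_pt r t) = r by rewrite cmod_circle gtr0_norm.
have d := circle_dist_ge a t (ltW r0).
rewrite !cmodM cmodV zr ler_pdivrMr; last by lra.
have H := fB t tp; have := cmod_ge0 (f (circle_pt r t)).
nra.
Qed.

Lemma cauchy_estimate (B : R) : 0 < r ->
  (forall t, 0 <= t <= 2 * pi -> cmod (f (circle_pt r t)) <= B) -> cmod (derive1 f 0) <= B / r.
Proof.
move=> r0 fB; have ar' : cmod (0 : C) < r by rewrite cmod0.
have cpsi := cauchy_density_continuous (ltW r0).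
rewrite (derive_cauchy_formula ar'); apply: cmod_circle_mean_le => [|t tp].
  exact: cauchy_kernel_continuous ar' cpsi.
have zr : cmod (circle_pt r t) = r by rewrite cmod_circle gtr0_norm.
rewrite !cmodM cmodV cmodX subr0 zr ler_pdivrMr ?exprn_gt0//.
by rewrite expr2 mulrA divfK ?gt_eqF// ler_pM2r// fB.
Qed.

End Disc.

End CauchyConsequences.

(** * Entire functions and their zeros *)

Section EntireFunctions.
Context {R : realType}.
Local Notation C := R[i].
Implicit Types (f g : C -> C) (r : R).

Lemma entire_on_disc f r : entire f -> forall z, cmod z <= r -> derivable f z 1.
Proof. by move=> ef z _. Qed.

Lemma entire_translate f b : entire f -> entire (fun z => f (z + b)).
Proof. by move=> ef; exact: entire_comp (entire_shift b) ef. Qed.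

Lemma derive1_translate f b z : entire f ->
  derive1 (fun w => f (w + b)) z = derive1 f (z + b).
Proof.
move=> ef; apply: is_derive_derive1; rewrite -[X in is_derive _ _ _ X]mulr1.
exact: (@is_derive_comp _ (fun w => w + b) f z _ _ (cderive_shift b z)
  (derivable_is_derive (ef (z + b)))).
Qed.

Lemma entire_derive1 f : entire f -> entire (derive1 f).
Proof.
move=> ef z; apply: (derivable_derive1 (r := cmod z + 1)).
  exact: entire_on_disc.
by rewrite ltrDl.
Qed.

Lemma entire_cderiv f k : entire f -> entire (cderiv k f).
Proof.
move=> ef; elim: k => [|k IH]; first by rewrite /cderiv derive1n0.
by rewrite /cderiv derive1nS; exact: entire_derive1.
Qed.

(** Each derivative takes one Cauchy estimate on a circle of radius 1, which costs one unit of
    radius and no constant. *)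
Lemma cderiv_bound f k (z : C) (B : R) : entire f ->
  (forall w, cmod (w - z) <= k%:R -> cmod (f w) <= B) -> cmod (cderiv k f z) <= B.
Proof.
move=> ef; elim: k z => [|k IH] z fB.
  by rewrite /cderiv derive1n0; apply: fB; rewrite subrr cmod0.
rewrite /cderiv derive1nS -[z]add0r -(derive1_translate _ _ (@entire_cderiv _ k ef)).
rewrite -[B]divr1; apply: cauchy_estimate => // [|t _].
  by apply: entire_on_disc; exact/entire_translate/entire_cderiv.
apply: IH => w wz; apply: fB; rewrite -(subrKA (circle_pt 1 t + z)).
apply: le_trans (cmodD _ _) _; rewrite -natr1 lerD//.
by rewrite addrK cmod_circle normr1.
Qed.

Lemma entire_circle_bounded f r : entire f -> 0 <= r ->
  exists2 B : R, 0 <= B & forall t, 0 <= t <= 2 * pi -> cmod (f (circle_pt r t)) <= B.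
Proof.
move=> ef r0; apply: segment_bounded; first exact/ltW/pi2_gt0.
exact: (holomorphic_circle_continuous (entire_on_disc (r := r) ef) r0).
Qed.

Lemma entire_disc_bounded f r : entire f ->
  exists2 B : R, 0 < B & forall z, cmod z <= r -> cmod (f z) <= B.
Proof.
move=> ef; pose r' := `|r| + 1; have r'0 : 0 < r' by rewrite ltr_wpDl.
have [B B0 HB] := entire_circle_bounded ef (mulr_ge0 (ler0n R 2) (ltW r'0)).
exists (2 * B + 1) => [|z zr]; first by rewrite ltr_wpDl// mulr_ge0.
suff : cmod (f z) <= 2 * B by lra.
have r20 : 0 < 2 * r' by rewrite mulr_gt0.
apply: (holomorphic_bound (entire_on_disc (r := 2 * r') ef) r20).
  rewrite [leRHS](_ : _ = r'); last by field.
  apply: le_trans zr _.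
  by rewrite (le_trans (ler_norm _))// lerDl.
exact: HB.
Qed.

(** Near any point the quotient is the Cauchy integral of f(zeta) / (zeta - a) over a circle
    enclosing a and that point; this is derivable, and its value at a is f'(a). *)
Lemma entire_divide f a : entire f -> f a = 0 ->
  exists2 g, entire g & forall z, f z = (z - a) * g z.
Proof.
move=> ef fa.
exists (fun z => if z == a then derive1 f a else f z / (z - a)) => [z0|z]; last first.
  have [->|za] := eqVneq z a; first by rewrite subrr mul0r.
  by rewrite mulrC divfK// subr_eq0.
pose r := cmod a + cmod z0 + 1.
have ar : cmod a < r by rewrite /r; have := cmod_ge0 z0; lra.
have zr : cmod z0 < r by rewrite /r; have := cmod_ge0 a; lra.
have r0 : 0 <= r by apply: ltW; apply: le_lt_trans ar; exact: cmod_ge0.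
have df := entire_on_disc (r := r) ef.
have cpsi := cauchy_density_continuous df r0.
pose psi t := f (circle_pt r t) * circle_pt r t / (circle_pt r t - a).
have cpsi' : circle_continuous psi by exact: (@cauchy_kernel_continuous _ r a 1 _ ar cpsi).
have e0 : 0 < r - cmod z0 by rewrite subr_gt0.
have dI := derive_cauchy_integral zr cpsi'.
suff H : is_derive z0 1 (fun z => if z == a then derive1 f a else f z / (z - a))
  (circle_mean (fun t => psi t / (circle_pt r t - z0) ^+ 2)) by case: H.
apply: (eq_near_derive e0 _ dI) => w wz.
have wr : cmod w < r.
  by rewrite -(subrK z0 w) (le_lt_trans (cmodD _ _))// -ltrBrDr.
have [wa|wa] := eqVneq w a.
  rewrite (derive_cauchy_formula df ar); apply: eq_circle_mean => t.
  by rewrite /psi wa expr2 invfM mulrA.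
have wa0 : w - a != 0 by rewrite subr_eq0.
rewrite -[f w]subr0 -fa.
rewrite (cauchy_formula df wr) (cauchy_formula df ar).
have cw := @cauchy_kernel_continuous _ r w 1 _ wr cpsi.
have ca := @cauchy_kernel_continuous _ r a 1 _ ar cpsi.
rewrite -(circle_meanB cw ca) mulrC -(circle_meanZ _ (within_continuousB cw ca)).
apply: eq_circle_mean => t; rewrite /psi; field.
by rewrite wa0 !circle_sub_neq0.
Qed.

(** Zeros are divided out one at a time, with repetition for multiplicities. The process stops
    because n divisions force |f b| 2^n <= 2 B with B independent of n. *)
Lemma entire_zeros f r b : entire f -> 0 <= r -> f b != 0 ->
  exists (s : seq C) (F : C -> C), [/\ entire F,
    forall z, f z = \prod_(a <- s) (z - a) * F z,
    forall a, a \in s -> cmod a <= r &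
    forall z, cmod z <= r -> F z != 0].
Proof.
move=> ef r0 fb.
pose P n := exists (s : seq C) (F : C -> C), [/\ size s = n, entire F,
    forall z, f z = \prod_(a <- s) (z - a) * F z &
    forall a, a \in s -> cmod a <= r].
have P0 : P 0%N by exists [::], f; split => // z; rewrite big_nil mul1r.
have [n Pn nPn] : exists2 n, P n & ~ P n.+1.
  apply: contrapT => H.
  have allP n : P n.
    by elim: n => // n IH; apply: contrapT => nP; apply: H; exists n.
  (* Each |b - a| is at most q, while |z - a| >= 2 q on the circle |z| = rho: a gain of 2 for each
     zero. Also |b| <= rho / 2, as [holomorphic_bound] requires. *)
  pose q := r + cmod b + 1; have q0 : 0 < q by rewrite ltr_wpDl// addr_ge0// cmod_ge0.
  pose rho := 2 * q + r; have rho0 : 0 < rho by rewrite /rho; lra.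
  have [B B0 HB] := entire_disc_bounded rho ef.
  have fb0 : 0 < cmod (f b) by rewrite cmod_gt0.
  pose n := (Num.truncn (2 * B / cmod (f b))).+1.
  have [s [F [sn eF fF sr]]] := allP n.
  have prod_le (g : C -> R) (m : R) : 0 <= m -> (forall a, a \in s -> 0 <= g a <= m) ->
      \prod_(a <- s) g a <= m ^+ n.
    move=> m0; rewrite -sn; elim: (s) => [|a s' IH] Hg; first by rewrite big_nil.
    have /andP[g0 gm] := Hg _ (mem_head a s').
    rewrite big_cons exprS ler_pM//.
      by rewrite big_seq prodr_ge0// => c cs; case/andP: (Hg c (mem_behead (s := a :: s') cs)).
    by apply: IH => c cs; exact: (Hg c (mem_behead (s := a :: s') cs)).
  have prod_ge (g : C -> R) (m : R) : 0 <= m -> (forall a, a \in s -> m <= g a) ->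
      m ^+ n <= \prod_(a <- s) g a.
    move=> m0; rewrite -sn; elim: (s) => [|a s' IH] Hg; first by rewrite big_nil.
    rewrite big_cons exprS ler_pM ?exprn_ge0//.
      exact: Hg (mem_head a s').
    by apply: IH => c cs; exact: (Hg c (mem_behead (s := a :: s') cs)).
  have q2n : 0 < (2 * q) ^+ n by rewrite exprn_gt0// mulr_gt0.
  have Fcirc t : cmod (F (circle_pt rho t)) <= B / (2 * q) ^+ n.
    set z := circle_pt rho t; have zrho : cmod z = rho by rewrite cmod_circle gtr0_norm.
    rewrite ler_pdivlMr// mulrC.
    apply: le_trans (HB z _); last by rewrite zrho.
    rewrite fF cmodM cmod_prod ler_wpM2r ?cmod_ge0//; apply: prod_ge; first lra.
    move=> a /sr ar; apply: le_trans (lerB_cmod _ _); rewrite zrho /rho; lra.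
  have br : cmod b <= rho / 2 by rewrite /rho /q; lra.
  have := holomorphic_bound (entire_on_disc (r := rho) eF) rho0 br (fun t _ => Fcirc t).
  have fbF : cmod (f b) <= q ^+ n * cmod (F b).
    rewrite fF cmodM ler_wpM2r ?cmod_ge0// cmod_prod; apply: prod_le; first exact: ltW.
    move=> a /sr ar; rewrite cmod_ge0/=; apply: le_trans (cmodB _ _) _; rewrite /q; lra.
  move=> Fb; have : cmod (f b) * 2 ^+ n <= 2 * B.
    have : q ^+ n * cmod (F b) <= q ^+ n * (2 * (B / (2 * q) ^+ n)).
      by rewrite ler_wpM2l// exprn_ge0// ltW.
    move=> /(le_trans fbF) H1; rewrite -ler_pdivlMr ?exprn_gt0//.
    apply: le_trans H1 _; rewrite exprMn le_eqVlt; apply/orP; left; apply/eqP.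
    by field; rewrite !expf_neq0// gt_eqF.
  apply/negP; rewrite -ltNge [ltRHS]mulrC -ltr_pdivrMr//.
  apply: lt_le_trans (truncnS_gt _) _.
  have : n%:R <= 2 ^+ n :> R by rewrite -natrX ler_nat ltnW// ltn_expl.
  exact.
have [s [F [sn eF fF sr]]] := Pn.
exists s, F; split => // z zr; apply/eqP => Fz.
have [g eg Fg] := entire_divide eF Fz; apply: nPn.
exists (z :: s), g; split => //=; first by rewrite sn.
  by move=> w; rewrite fF Fg big_cons mulrCA mulrA.
by move=> a; rewrite inE => /predU1P[->//|]; exact: sr.
Qed.

End EntireFunctions.

(** * Primitives and logarithms on discs *)

Section Logarithm.
Context {R : realType}.
Local Notation C := R[i].
Implicit Types (f g q : C -> C) (r : R).

Lemma curve_derive_ray (z : C) t : curve_derive (fun s : R => s%:C * z) t z.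
Proof.
have := curve_deriveM (curve_derive_id t) (curve_derive_cst z t).
by rewrite mul1r mulr0 addr0.
Qed.

Lemma cmod_ray (z : C) (t : R) : 0 <= t <= 1 -> cmod (t%:C * z) <= cmod z.
Proof.
move=> /andP[t0 t1]; rewrite cmodM cmod_real ger0_norm//.
by rewrite -[leRHS]mul1r ler_wpM2r ?cmod_ge0.
Qed.

Lemma ray_continuous g r (z : C) : (forall w, cmod w < r -> derivable g w 1) ->
  cmod z < r -> segment_continuous 0 1 (fun t => g (t%:C * z)).
Proof.
move=> dg zr; apply: within_continuous_comp.
  exact: segment_continuous_derive (curve_derive_ray z).
move=> t; rewrite /= in_itv /= => t01; apply/derive_continuous/dg.
exact: le_lt_trans (cmod_ray z t01) zr.
Qed.

Lemma derive_eq0_cst g r : (forall z, cmod z < r -> is_derive z 1 g 0) ->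
  forall z, cmod z < r -> g z = g 0.
Proof.
move=> dg z zr; apply/eqP; rewrite -subr_eq0; apply/eqP.
have c0 : segment_continuous 0 1 (fun=> 0 : C) by exact: within_continuous_cst.
have := cint_FTC ler01 c0 (F := fun t => g (t%:C * z)).
rewrite rmorph1 mul1r rmorph0 mul0r => <-.
  by rewrite cint_cst// mulr0.
move=> t t01; rewrite -(mul0r z).
apply: (curve_derive_comp (F := fun s : R => s%:C * z)); first exact: curve_derive_ray.
by apply: dg; exact: le_lt_trans (cmod_ray z t01) zr.
Qed.

(** q z is the integral of g along the segment from 0 to z. Differentiating under the integral gives
    g(t z) + t z g'(t z), which is the t-derivative of t g(t z) and so integrates to g(z). *)
Lemma disc_primitive g r : (forall z, cmod z <= r -> derivable g z 1) ->
  exists2 q, q 0 = 0 & forall z, cmod z < r -> is_derive z 1 q (g z).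
Proof.
move=> dg; pose q z := cint 0 1 (fun t => z * g (t%:C * z)).
have dg' w : cmod w < r -> derivable g w 1 by move/ltW; exact: dg.
exists q => [|z zr].
  rewrite /q (_ : (fun t => _) = fun=> 0) ?cint_cst ?mulr0//.
  by apply/funext => t; rewrite mul0r.
pose rho := (cmod z + r) / 2.
have zrho : cmod z < rho by rewrite /rho; lra.
have rhor : rho < r by rewrite /rho; lra.
have [B HB] := holomorphic_second_order dg rhor.
have ddg w : cmod w < r -> derivable (derive1 g) w 1 by exact: derivable_derive1 dg _.
have cdg : segment_continuous 0 1 (fun t => derive1 g (t%:C * z)).
  exact: ray_continuous ddg zr.
have [S S0 HS] := segment_bounded ler01 cdg.
pose K (w : C) (t : R) := w * g (t%:C * w).
pose K' (w : C) (t : R) := g (t%:C * w) + (t%:C * w) * derive1 g (t%:C * w).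
have cid (w : C) : segment_continuous 0 1 (fun t => t%:C * w).
  exact: segment_continuous_derive (curve_derive_ray w).
have cK w : cmod w < r -> segment_continuous 0 1 (K w).
  move=> wr; apply: within_continuousM; first exact: within_continuous_cst.
  exact: ray_continuous dg' wr.
have cK' : segment_continuous 0 1 (K' z).
  apply: within_continuousD; first exact: ray_continuous dg' zr.
  by apply: within_continuousM; [exact: cid|exact: cdg].
have eta0 : 0 < rho - cmod z by rewrite subr_gt0.
have wrho w : cmod (w - z) < rho - cmod z -> cmod w < rho.
  by move=> wz; rewrite -(subrK z w) (le_lt_trans (cmodD _ _))// -ltrBrDr.
have -> : g z = cint 0 1 (K' z).
  have := cint_FTC ler01 cK' (F := fun t : R => t%:C * g (t%:C * z)).
  rewrite rmorph1 !mul1r rmorph0 !mul0r subr0 => <- // t t01.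
  have dgt := dg' _ (le_lt_trans (cmod_ray z t01) zr).
  have := curve_deriveM (curve_derive_id t)
    (curve_derive_comp (curve_derive_ray z t) (derivable_is_derive dgt)).
  by congr (curve_derive _ _ _); rewrite /K'; ring.
apply: (derive_cint (K := K) (K' := K') (B := rho * `|B| + S) ler01 eta0 _ cK').
  by move=> w /wrho wr; apply: cK; exact: lt_trans wr rhor.
move=> w t wz t01; have wr := wrho _ wz.
have tw := cmod_ray w t01; have tz := cmod_ray z t01.
rewrite (_ : _ - _ = w * (g (t%:C * w) - g (t%:C * z) - (t%:C * w - t%:C * z) * derive1 g (t%:C * z))
  + t%:C * derive1 g (t%:C * z) * (w - z) ^+ 2); last by rewrite /K /K'; ring.
apply: le_trans (cmodD _ _) _; rewrite [leRHS]mulrDl lerD//.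
- rewrite cmodM -mulrA ler_pM ?cmod_ge0//; first exact: ltW.
  apply: le_trans (HB _ _ (le_trans tz (ltW zrho)) (le_trans tw (ltW wr))) _.
  apply: le_trans (ler_wpM2r (sqr_ge0 _) (ler_norm B)) _.
  rewrite ler_wpM2l// -mulrBr lerXn2r ?nnegrE ?cmod_ge0//.
  exact: cmod_ray.
- rewrite 2!cmodM cmodX ler_wpM2r ?sqr_ge0// cmod_real.
  case/andP: (t01) => t0 t1; rewrite ger0_norm//.
  by apply: le_trans (ler_wpM2r (cmod_ge0 _) t1) _; rewrite mul1r HS.
Qed.

(** Take for q the primitive of f' / f that vanishes at 0; then f exp(-q) has derivative 0. *)
Lemma zero_free_log f r : entire f -> 0 < r -> (forall z, cmod z <= r -> f z != 0) ->
  exists q, [/\ q 0 = 0, forall z, cmod z < r -> derivable q z 1 &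
    forall z, cmod z < r -> f z = f 0 * cexp (q z)].
Proof.
move=> ef r0 f0.
have [|q q0 dq] := @disc_primitive (fun z => derive1 f z / f z) r.
  move=> z zr; apply: cderivableM; first exact: entire_derive1.
  by apply: cderivableV; [exact: f0|exact: ef].
exists q; split => // z zr; first by case: (dq z zr).
have H : f z * cexp (-1 * q z) = f 0 * cexp (-1 * q 0).
  apply: (derive_eq0_cst (g := fun z => f z * cexp (-1 * q z))) zr => w wr.
  have dm : is_derive w 1 (fun z => -1 * q z) (-1 * (derive1 f w / f w)).
    have := cderiveM (cderive_cst (-1) w) (dq w wr).
    by rewrite mul0r add0r.
  have := cderiveM (derivable_is_derive (ef w)) (is_derive_comp dm (is_derive_cexp _)).
  have fw := f0 w (ltW wr).
  by congr (is_derive _ _ _ _); field.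
move: H; rewrite q0 mulr0 cexp0 mulr1 => <-.
by rewrite mulN1r -mulrA -cexpD addNr cexp0 mulr1.
Qed.

End Logarithm.

(** * The Schwarz and Poisson-Jensen formulas *)

Section Schwarz.
Context {R : realType}.
Local Notation C := R[i].
Local Notation Re := (@complex.Re R).
Local Notation Im := (@complex.Im R).
Local Notation mu := (@lebesgue_measure R).
Implicit Types (f q : C -> C) (psi : R -> C) (r : R) (u v : R -> R).

Lemma conjcM (z w : C) : conjc (z * w) = conjc z * conjc w.
Proof. exact: (rmorphM (@conjc R)). Qed.

Lemma conjcB (z w : C) : conjc (z - w) = conjc z - conjc w.
Proof. exact: (rmorphB (@conjc R)). Qed.

Definition circle_rmean u : R := (2 * pi)^-1 * \int[mu]_(t in `[0, 2 * pi]) u t.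

Lemma Re_circle_mean psi : Re (circle_mean psi) = circle_rmean (fun t => Re (psi t)).
Proof. by rewrite /circle_mean ReZ. Qed.

Lemma le_circle_rmean u v : {within `[0, 2 * pi], continuous u} ->
  {within `[0, 2 * pi], continuous v} ->
  (forall t, 0 <= t <= 2 * pi -> u t <= v t) -> circle_rmean u <= circle_rmean v.
Proof.
move=> cu cv uv; rewrite /circle_rmean ler_pM2l ?invr_gt0 ?pi2_gt0//.
have iu := within_continuous_integrable cu; have iv := within_continuous_integrable cv.
apply: (le_Rintegral _ iu iv) => [|t]; first exact: measurable_itv.
by rewrite /= in_itv /=; exact: uv.
Qed.

Lemma circle_rmeanD u v : {within `[0, 2 * pi], continuous u} ->
  {within `[0, 2 * pi], continuous v} ->
  circle_rmean (fun t => u t + v t) = circle_rmean u + circle_rmean v.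
Proof.
move=> cu cv; rewrite /circle_rmean -mulrDr.
have iu := within_continuous_integrable cu; have iv := within_continuous_integrable cv.
by rewrite (RintegralD _ iu iv).
Qed.

Lemma circle_rmeanZ (k : R) u : {within `[0, 2 * pi], continuous u} ->
  circle_rmean (fun t => k * u t) = k * circle_rmean u.
Proof.
move=> cu; rewrite /circle_rmean mulrCA.
have iu := within_continuous_integrable cu.
by rewrite (RintegralZl _ _ iu).
Qed.

Lemma circle_rmean_cst (k : R) : circle_rmean (fun=> k) = k.
Proof.
rewrite /circle_rmean Rintegral_cst//= lebesgue_measure_itv/= lte_fin pi2_gt0/= subr0.
by rewrite mulrC mulfK// gt_eqF// pi2_gt0.
Qed.

Lemma cmod_circle_mean_density psi u (k : R) : circle_continuous psi ->
  {within `[0, 2 * pi], continuous u} ->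
  (forall t, 0 <= t <= 2 * pi -> cmod (psi t) <= k * u t) ->
  cmod (circle_mean psi) <= k * circle_rmean u.
Proof.
move=> cpsi cu H; apply: le_trans (le_cmod_circle_mean cpsi) _.
rewrite -(circle_rmeanZ _ cu) -/(circle_rmean (fun t => cmod (psi t))).
apply: le_circle_rmean H; first exact: within_continuous_cmod.
have cr : {within `[0, 2 * pi], continuous (fun t => Re (k%:C * (u t)%:C))}.
  apply: within_continuous_Re; apply: within_continuousM.
    exact: within_continuous_cst.
  apply: (within_continuous_complex cu).
  by move=> x; exact: cst_continuous.
rewrite (_ : (fun t => k * u t) = (fun t => Re (k%:C * (u t)%:C))); first exact: cr.
by apply/funext => t; rewrite ReZ.
Qed.

Lemma conj_circle_mean psi : circle_continuous psi ->
  circle_mean (fun t => conjc (psi t)) = conjc (circle_mean psi).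
Proof.
move=> cpsi; rewrite /circle_mean conjcM conjc_real; congr (_ * _).
have iIm := within_continuous_integrable (within_continuous_Im cpsi).
rewrite /cint; apply/eqP; rewrite eq_complex /=; apply/andP; split; apply/eqP.
  by apply: eq_Rintegral => t _; case: (psi t).
rewrite -mulN1r -(RintegralZl _ _ iIm); last exact: measurable_itv.
by apply: eq_Rintegral => t _; rewrite mulN1r; case: (psi t).
Qed.

Lemma continuous_conj (A : set R) (h : R -> C) : {within A, continuous h} ->
  {within A, continuous (fun t => conjc (h t))}.
Proof.
move=> ch; have -> : (fun t => conjc (h t)) = (fun t => Re (h t) +i* (Im ((-1) * h t))).
  by apply/funext => t; rewrite mulN1r; case: (h t).
apply: within_continuous_complex; first exact: within_continuous_Re.
apply: within_continuous_Im; apply: within_continuousM; last exact: ch.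
exact: within_continuous_cst.
Qed.

Section Density.
Variables (q : C -> C) (r : R).
Hypotheses (r0 : 0 < r) (q0 : q 0 = 0).
Hypothesis dq : forall z, cmod z <= r -> derivable q z 1.
Let v t := Re (q (circle_pt r t)).

Lemma density_continuous : {within `[0, 2 * pi], continuous v}.
Proof. exact: within_continuous_Re (holomorphic_circle_continuous dq (ltW r0)). Qed.

Lemma schwarz_continuous (z : C) : cmod z < r ->
  circle_continuous (fun t => (2 * v t)%:C * circle_pt r t / (circle_pt r t - z)).
Proof.
move=> zr; apply: (@cauchy_kernel_continuous _ r z 1
  (fun t => (2 * v t)%:C * circle_pt r t) zr).
apply: within_continuousM; last exact: circle_pt_continuous.
have -> : (fun t => (2 * v t)%:C) = (fun t => 2%:C * (v t +i* 0)).
  by apply/funext => t; rewrite rmorphM.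
apply: within_continuousM; first exact: within_continuous_cst.
apply: within_continuous_complex; first exact: density_continuous.
by move=> t; exact: cst_continuous.
Qed.

(** Add to Cauchy's formula a mean that vanishes. The function g(w) = q(w) r^2 / (r^2 - w conj(z))
    is holomorphic on the closed disc with g(0) = 0; as r^2 = zeta conj(zeta) on the circle, the
    conjugate of its mean is the mean of conj(q) zeta / (zeta - z). Finally q + conj(q) = 2 Re q. *)
Lemma schwarz_formula (z : C) : cmod z < r ->
  q z = circle_mean (fun t => (2 * v t)%:C * circle_pt r t / (circle_pt r t - z)).
Proof.
move=> zr; pose g w := q w * (r%:C ^+ 2 / (r%:C ^+ 2 - w * conjc z)).
have den w : cmod w <= r -> r%:C ^+ 2 - w * conjc z != 0.
  move=> wr; rewrite -cmod_gt0; apply: lt_le_trans (lerB_cmod _ _).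
  rewrite cmodX cmodM cmod_real cmodJ gtr0_norm// subr_gt0 expr2.
  apply: le_lt_trans (ler_wpM2r (cmod_ge0 _) wr) _; by rewrite ltr_pM2l.
have dg w : cmod w <= r -> derivable g w 1.
  move=> wr; apply: cderivableM; first exact: dq.
  apply: cderivableM; first exact: entire_cst.
  apply: cderivableV; first exact: den.
  apply: cderivableB; first exact: entire_cst.
  by apply: cderivableM; [exact: entire_id|exact: entire_cst].
have cq := holomorphic_circle_continuous dq (ltW r0).
have cg := holomorphic_circle_continuous dg (ltW r0).
have zt t : circle_pt r t - z != 0 by exact: circle_sub_neq0.
have E : (fun t => conjc (g (circle_pt r t))) =
    (fun t => conjc (q (circle_pt r t)) * circle_pt r t / (circle_pt r t - z)).
  have [N NE NJ] : exists2 N : C, N = r%:C ^+ 2 & conjc N = N.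
    by exists (r%:C ^+ 2) => //; rewrite expr2 conjcM conjc_real.
  apply/funext => t; rewrite /g -mulrA conjcM -NE; congr (_ * _).
  rewrite conjcM conjc_inv conjcB conjcM conjcK NJ NE.
  have ct : circle_pt r t != 0 by rewrite -cmod_gt0 cmod_circle gtr0_norm.
  have ctJ : conjc (circle_pt r t) != 0 by rewrite conjc_eq0.
  have -> : r%:C ^+ 2 = circle_pt r t * conjc (circle_pt r t).
    by rewrite mulcJ cmod_circle real_normK ?num_real// rmorphXn.
  rewrite (mulrC (circle_pt r t)) -mulrBr; field.
  by rewrite zt ctJ.
have B0 : circle_mean (fun t => conjc (q (circle_pt r t)) * circle_pt r t / (circle_pt r t - z)) = 0.
  rewrite -E conj_circle_mean// -(holomorphic_mean_value dg r0) /g q0 mul0r.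
  exact: conjc0.
have cpsi := @cauchy_kernel_continuous _ r z 1 _ zr (cauchy_density_continuous dq (ltW r0)).
rewrite (cauchy_formula dq zr) -[LHS]addr0 -B0.
have cJ := continuous_conj cg; rewrite E in cJ.
rewrite -circle_meanD; [|exact: cpsi|exact: cJ].
apply: eq_circle_mean => t; rewrite -!mulrA -mulrDl; congr (_ * _).
rewrite /v; case: (q _) => x y; apply/eqP; rewrite eq_complex /= subrr eqxx andbT.
by apply/eqP; ring.
Qed.

Lemma density_mean0 : circle_rmean v = 0.
Proof. by rewrite -Re_circle_mean -(holomorphic_mean_value dq r0) q0. Qed.

(** Expand zeta / (zeta - z) = 1 + z / zeta + z^2 / (zeta (zeta - z)) in Schwarz's formula. The
    first term has mean 0 because q(0) = 0, the second gives c z, and |zeta - z| >= r / 2 bounds the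
    third. *)
Lemma schwarz_bound : exists c : C,
  cmod c <= 2 / r * circle_rmean (fun t => `|v t|) /\
  forall z, cmod z <= r / 2 ->
    cmod (q z - c * z) <= 4 / r ^+ 2 * circle_rmean (fun t => `|v t|) * cmod z ^+ 2.
Proof.
have cv := density_continuous.
have cav : {within `[0, 2 * pi], continuous (fun t => `|v t|)}.
  by move=> t; apply: continuous_comp; [exact: cv|exact: norm_continuous].
have cV : circle_continuous (fun t => (2 * v t)%:C).
  have -> : (fun t => (2 * v t)%:C) = (fun t => 2%:C * (v t +i* 0)).
    by apply/funext => t; rewrite rmorphM.
  apply: within_continuousM; first exact: within_continuous_cst.
  apply: (within_continuous_complex cv).
  by move=> t; exact: cst_continuous.
have ct t : circle_pt r t != 0 by rewrite -cmod_gt0 cmod_circle gtr0_norm.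
have zr0 : cmod (0 : C) < r by rewrite cmod0.
pose psi1 t := (2 * v t)%:C / circle_pt r t.
have cpsi1 : circle_continuous psi1.
  apply: within_continuousM; first exact: cV.
  by apply: within_continuousV; [move=> t _; exact: ct|exact: circle_pt_continuous].
exists (circle_mean psi1); split.
  apply: (cmod_circle_mean_density cpsi1 cav) => t _.
  rewrite cmodM cmodV cmod_real cmod_circle (gtr0_norm r0) normrM ger0_norm//.
  by rewrite mulrAC.
move=> z zr2; have zr : cmod z < r by move: zr2 (r0); lra.
pose psi2 t := psi1 t / (circle_pt r t - z).
have cpsi2 : circle_continuous psi2 by exact: (@cauchy_kernel_continuous _ r z 1 _ zr cpsi1).
have V0 : circle_mean (fun t => (2 * v t)%:C) = 0.
  rewrite -q0 (schwarz_formula zr0); apply: eq_circle_mean => t.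
  by rewrite subr0 mulfK.
have -> : q z - circle_mean psi1 * z = z ^+ 2 * circle_mean psi2.
  have cZ1 : circle_continuous (fun t => z * psi1 t).
    by apply: within_continuousM; [exact: within_continuous_cst|exact: cpsi1].
  rewrite mulrC -(circle_meanZ _ cpsi1) -(circle_meanZ _ cpsi2) (schwarz_formula zr).
  rewrite -(circle_meanB (schwarz_continuous zr) cZ1) -[LHS]subr0 -V0.
  rewrite -(circle_meanB (within_continuousB (schwarz_continuous zr) cZ1) cV).
  apply: eq_circle_mean => t; rewrite /psi2 /psi1; field.
  by rewrite ct circle_sub_neq0.
rewrite cmodM cmodX mulrC ler_wpM2r ?sqr_ge0//.
apply: (cmod_circle_mean_density cpsi2 cav) => t _.
rewrite !cmodM !cmodV cmod_real cmod_circle (gtr0_norm r0) normrM ger0_norm//.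
have d := circle_dist_ge z t (ltW r0).
have d0 : 0 < cmod (circle_pt r t - z) by rewrite (lt_le_trans _ d)// subr_gt0.
have : (cmod (circle_pt r t - z))^-1 <= 2 / r.
  rewrite ler_pdivlMr// mulrC ler_pdivrMr//; lra.
move=> H; apply: le_trans (ler_wpM2l _ H) _; first by rewrite !mulr_ge0// invr_ge0 ltW.
by rewrite le_eqVlt; apply/orP; left; apply/eqP; field; rewrite gt_eqF.
Qed.

End Density.

End Schwarz.

(** * Growth of entire functions after removal of their zeros *)

Section GrowthBound.
Context {R : realType}.
Local Notation C := R[i].
Local Notation Re := (@complex.Re R).
Implicit Types (f F q : C -> C) (r : R).

Lemma logpE (x : R) : logp x = ln (Num.max 1 x).
Proof.
rewrite /logp; have [x0|x0] := leP x 0.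
  by rewrite (ln0 x0) maxxx max_l ?ln1// (le_trans x0).
have [x1|x1] := leP x 1.
  by rewrite ln1; apply/max_l; exact: ln_le0.
by apply/max_r; rewrite ln_ge0// ltW.
Qed.

Lemma logp_ge0 (x : R) : 0 <= logp x.
Proof. by rewrite /logp le_max lexx. Qed.

Lemma ln_le_logp (x : R) : ln x <= logp x.
Proof. by rewrite /logp le_max lexx orbT. Qed.

Lemma ler_logp (x y : R) : x <= y -> logp x <= logp y.
Proof.
move=> xy; rewrite !logpE ler_ln ?posrE ?lt_max ?ltr01//.
by rewrite ge_max !le_max lexx xy orbT.
Qed.

Lemma rwithin_continuous_cst (A : set R) (k : R) : {within A, continuous (fun=> k)}.
Proof. by move=> t; exact: cst_continuous. Qed.

Lemma rwithin_continuousD (A : set R) (u v : R -> R) : {within A, continuous u} ->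
  {within A, continuous v} -> {within A, continuous (fun t => u t + v t)}.
Proof. by move=> cu cv t; apply: continuousD; [exact: cu|exact: cv]. Qed.

Lemma rwithin_continuousB (A : set R) (u v : R -> R) : {within A, continuous u} ->
  {within A, continuous v} -> {within A, continuous (fun t => u t - v t)}.
Proof. by move=> cu cv t; apply: continuousB; [exact: cu|exact: cv]. Qed.

Lemma rwithin_continuousM (A : set R) (u v : R -> R) : {within A, continuous u} ->
  {within A, continuous v} -> {within A, continuous (fun t => u t * v t)}.
Proof. by move=> cu cv t; apply: continuousM; [exact: cu|exact: cv]. Qed.

Lemma rwithin_continuous_norm (A : set R) (u : R -> R) : {within A, continuous u} ->
  {within A, continuous (fun t => `|u t|)}.
Proof. by move=> cu t; apply: continuous_comp; [exact: cu|exact: norm_continuous]. Qed.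

(** Writing max(1, x) as (1 + x + |1 - x|) / 2 keeps the argument of ln positive and continuous. *)
Lemma within_continuous_logp (A : set R) (h : R -> C) : {within A, continuous h} ->
  {within A, continuous (fun t => logp (cmod (h t)))}.
Proof.
move=> ch; have -> : (fun t => logp (cmod (h t))) =
    (fun t => ln ((1 + cmod (h t) + `|1 - cmod (h t)|) / 2)).
  apply/funext => t; rewrite logpE; congr ln.
  by have [h1|h1] := leP 1 (cmod (h t)); [rewrite ler0_norm|rewrite gtr0_norm]; lra.
pose k x := (1 + cmod (h x) + `|1 - cmod (h x)|) / 2 : R.
have k0 t : 0 < k t.
  by rewrite /k; have := cmod_ge0 (h t); have := normr_ge0 (1 - cmod (h t)); lra.
have cc := within_continuous_cmod ch.
have ck : {within A, continuous k}.
  have c1 := rwithin_continuousB (@rwithin_continuous_cst A 1) cc.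
  have c2 := rwithin_continuousD (@rwithin_continuous_cst A 1) cc.
  exact: rwithin_continuousM (rwithin_continuousD c2 (rwithin_continuous_norm c1))
    (@rwithin_continuous_cst A _).
move=> t; exact: (continuous_comp (ck t) (continuous_ln (k0 t))).
Qed.

Lemma nevanlinna_m_circle f r :
  nevanlinna_m f r = circle_rmean (fun t => logp (cmod (f (circle_pt r t)))).
Proof. by []. Qed.

(** Let v = ln |F| - ln |F(0)|, the real part of a logarithm, which has mean 0 on the circle.
    Pointwise |v| <= 2 (log+ |F| + max(0, - ln |F(0)|)) - v, so S bounds the mean of |v|, and
    [schwarz_bound] applies. *)
Lemma zero_free_growth F r r' : entire F -> 0 < r -> r < r' ->
  (forall z, cmod z <= r' -> F z != 0) ->
  let S := 2 * (nevanlinna_m F r + Num.max 0 (- ln (cmod (F 0)))) in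
  ln (cmod (F 0)) <= nevanlinna_m F r /\
  exists2 c : C, cmod c <= 2 / r * S &
    forall z, cmod z <= r / 2 -> cmod (F z) <=
      expR (ln (cmod (F 0)) + Re (c * z) + 4 / r ^+ 2 * S * cmod z ^+ 2).
Proof.
move=> eF r0 rr' F0 S; have r'0 := lt_trans r0 rr'.
have [q [q0 dq' Fq]] := zero_free_log eF r'0 F0.
have dq z : cmod z <= r -> derivable q z 1.
  by move=> zr; apply: dq'; exact: le_lt_trans zr rr'.
have F00 : 0 < cmod (F 0) by rewrite cmod_gt0 F0// cmod0 ltW.
have lnF z : cmod z <= r -> ln (cmod (F z)) = ln (cmod (F 0)) + Re (q z).
  move=> zr; rewrite (Fq z (le_lt_trans zr rr')) cmodM cmod_cexp.
  by rewrite lnM ?posrE ?expR_gt0// expRK.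
have cF := holomorphic_circle_continuous (entire_on_disc (r := r) eF) (ltW r0).
have cl := within_continuous_logp cF.
have cv := density_continuous r0 dq.
have cav : {within `[0, 2 * pi], continuous (fun t => `|Re (q (circle_pt r t))|)}.
  exact: rwithin_continuous_norm cv.
have v0 := density_mean0 r0 q0 dq.
have ccst (k : R) : {within `[0, 2 * pi], continuous (fun _ : R => k)}.
  exact: (@rwithin_continuous_cst _ k).
have zr t : cmod (circle_pt r t) <= r by rewrite cmod_circle gtr0_norm.
have Fm : ln (cmod (F 0)) <= nevanlinna_m F r.
  rewrite nevanlinna_m_circle -[X in X <= _]addr0 -v0.
  rewrite -[X in X + _](circle_rmean_cst) -circle_rmeanD; [|exact: ccst|exact: cv].
  apply: le_circle_rmean; [|exact: cl|].
    exact: rwithin_continuousD (ccst _) cv.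
  by move=> t _; rewrite -lnF// ln_le_logp.
split=> //.
have vS : circle_rmean (fun t => `|Re (q (circle_pt r t))|) <= S.
  set L := Num.max _ _ in S *.
  have c1 : {within `[0, 2 * pi], continuous (fun t => 2 * logp (cmod (F (circle_pt r t))))}.
    exact: rwithin_continuousM (ccst _) cl.
  have c2 : {within `[0, 2 * pi], continuous (fun t => -1 * Re (q (circle_pt r t)))}.
    exact: rwithin_continuousM (ccst _) cv.
  have c3 : {within `[0, 2 * pi], continuous (fun t => 2 * L + -1 * Re (q (circle_pt r t)))}.
    exact: rwithin_continuousD (ccst _) c2.
  have -> : S = circle_rmean (fun t => 2 * logp (cmod (F (circle_pt r t))) +
      (2 * L + -1 * Re (q (circle_pt r t)))).
    rewrite (circle_rmeanD c1 c3) (circle_rmeanD (ccst _) c2) (circle_rmeanZ _ cl).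
    by rewrite (circle_rmeanZ _ cv) v0 mulr0 addr0 circle_rmean_cst -mulrDr.
  apply: le_circle_rmean; [exact: cav| |].
    exact: rwithin_continuousD c1 c3.
  move=> t _; have := lnF _ (zr t); have := ln_le_logp (cmod (F (circle_pt r t))).
  have := logp_ge0 (cmod (F (circle_pt r t))).
  have : - ln (cmod (F 0)) <= L by rewrite /L le_max lexx orbT.
  have : 0 <= L by rewrite /L le_max lexx.
  set v := Re _; set l := logp _; set l1 := ln _; set l2 := ln _.
  by have [v0'|v0'] := ltP v 0; [rewrite ltr0_norm|rewrite ger0_norm]; lra.
have [c [cr Hc]] := schwarz_bound r0 q0 dq.
exists c.
  by apply: le_trans cr _; rewrite ler_wpM2l// divr_ge0// ltW.
move=> z zr2; have zr1 : cmod z <= r by lra.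
have Fz0 : 0 < cmod (F z) by rewrite cmod_gt0 F0// (le_trans zr1)// ltW.
have <- : expR (ln (cmod (F z))) = cmod (F z) by rewrite lnK ?posrE.
rewrite ler_expR (lnF _ zr1) -addrA lerD2l.
rewrite -lerBlDl -ReB; apply: le_trans (ler_norm _) _; apply: le_trans (Re_cmod _) _.
apply: le_trans (Hc _ zr2) _; rewrite ler_wpM2r ?sqr_ge0// ler_wpM2l//.
by rewrite divr_ge0// sqr_ge0.
Qed.

(* Zeros inside the disc are reflected to the outside, with unchanged modulus on
   the circle |z| = r; the other ones are kept. *)
Definition blaschke_factor r (a z : C) : C :=
  if cmod a < r then (r%:C ^+ 2 - conjc a * z) / r%:C else z - a.

Lemma entire_blaschke_factor r a : entire (blaschke_factor r a).
Proof.
rewrite /blaschke_factor; case: (cmod a < r) => z; last exact: entire_shift.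
apply: cderivableM; last exact: entire_cst.
by apply: cderivableB; [exact: entire_cst|exact: entireZ].
Qed.

(** The right side vanishes for |z| = r and is nonnegative for |a|, |z| <= r; these two facts are
    the modulus comparisons that follow. *)
Lemma blaschke_identity r (a z : C) :
  cmod (r%:C ^+ 2 - conjc a * z) ^+ 2 - (r * cmod (z - a)) ^+ 2 =
  (r ^+ 2 - cmod a ^+ 2) * (r ^+ 2 - cmod z ^+ 2).
Proof.
rewrite exprMn -rmorphXn !sqr_cmod; case: a z => a1 a2 [z1 z2] /=.
by ring.
Qed.

Lemma cmod_blaschke_circle r (a z : C) : 0 < r -> cmod z = r ->
  cmod (blaschke_factor r a z) = cmod (z - a).
Proof.
move=> r0 zr; rewrite /blaschke_factor; case: ifP => // _.
have := blaschke_identity r a z; rewrite zr subrr mulr0 => /eqP.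
rewrite subr_eq0 eqrXn2 ?cmod_ge0 ?mulr_ge0 ?cmod_ge0 ?ltW// => /eqP H.
by rewrite cmodM cmodV cmod_real gtr0_norm// H mulrC mulKf// gt_eqF.
Qed.

Lemma cmod_blaschke_disc r (a z : C) : 0 < r -> cmod z <= r ->
  cmod (z - a) <= cmod (blaschke_factor r a z).
Proof.
move=> r0 zr; rewrite /blaschke_factor; case: ifP => // ar.
rewrite cmodM cmodV cmod_real gtr0_norm// ler_pdivlMr//.
have : (r * cmod (z - a)) ^+ 2 <= cmod (r%:C ^+ 2 - conjc a * z) ^+ 2.
  rewrite -subr_ge0 blaschke_identity; apply: mulr_ge0; rewrite subr_ge0.
    by apply: lerXn2r; rewrite ?nnegrE ?cmod_ge0// ltW.
  by apply: lerXn2r; rewrite ?nnegrE ?cmod_ge0// ltW.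
have rz : 0 <= r * cmod (z - a) by rewrite mulr_ge0 ?cmod_ge0// ltW.
by rewrite ler_sqr ?nnegrE ?cmod_ge0// mulrC.
Qed.

Lemma cmod_blaschke0 r a : 0 < r ->
  cmod (blaschke_factor r a 0) = if cmod a < r then r else cmod a.
Proof.
move=> r0; rewrite /blaschke_factor; case: ifP => _; last by rewrite sub0r cmodN.
by rewrite mulr0 subr0 cmodM cmodX cmodV cmod_real gtr0_norm// expr2 mulfK// gt_eqF.
Qed.

(** The zero of the factor is the reflected point r^2 / conj(a) or the kept point a, and both lie
    strictly outside the closed disc; for a = 0 the factor is the constant r. *)
Lemma blaschke_zero_free r a : 0 < r -> cmod a != r ->
  exists2 r', r < r' & forall z, cmod z < r' -> blaschke_factor r a z != 0.
Proof.
move=> r0 ar; rewrite /blaschke_factor; case: (boolP (cmod a < r)) => a_r.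
  have [->|a0] := eqVneq a 0.
    exists (r + 1) => [|z _]; first by rewrite ltrDl.
    rewrite conjc0 mul0r subr0 expr2 mulfK -?cmod_gt0 ?cmod_real ?normr_gt0 ?gt_eqF//.
  have a0' : 0 < cmod a by rewrite cmod_gt0.
  exists (r ^+ 2 / cmod a) => [|z]; first by rewrite ltr_pdivlMr// expr2 ltr_pM2l.
  rewrite ltr_pdivlMr// => za.
  rewrite mulf_neq0 ?invr_eq0 -?cmod_gt0 ?cmod_real ?normr_gt0 ?gt_eqF//.
  apply: lt_le_trans (lerB_cmod _ _).
  by rewrite cmodX cmodM cmodJ cmod_real gtr0_norm// subr_gt0 mulrC.
exists (cmod a) => [|z za]; first by rewrite lt_neqAle eq_sym ar leNgt.
by rewrite subr_eq0; apply/eqP => zE; move: za; rewrite zE ltxx.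
Qed.

Lemma blaschke_seq_zero_free r (s : seq C) : 0 < r -> (forall a, a \in s -> cmod a != r) ->
  exists2 r', r < r' & forall z, cmod z < r' -> \prod_(a <- s) blaschke_factor r a z != 0.
Proof.
move=> r0; elim: s => [|a s IH] sr.
  by exists (r + 1) => [|z _]; rewrite ?ltrDl// big_nil oner_eq0.
have [r1 rr1 H1] := blaschke_zero_free r0 (sr _ (mem_head a s)).
have [r2 rr2 H2] := IH (fun c cs => sr c (mem_behead (s := a :: s) cs)).
exists (Num.min r1 r2) => [|z]; first by rewrite lt_min rr1.
by rewrite lt_min => /andP[z1 z2]; rewrite big_cons mulf_neq0 ?H1 ?H2.
Qed.

(** F is f with its linear factors replaced by Blaschke factors: |F| = |f| on the circle, so the
    proximity function is unchanged, |f| <= |F| inside, and ln |F(0)| = kappa. The excess of kappa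
    over ln |f(0)| is Jensen's sum over the zeros, so few zeros cost little. *)
Theorem entire_growth f (r r1 : R) (s : seq C) (F0 : C -> C) :
  f 0 != 0 -> 0 < r -> r < r1 -> entire F0 ->
  (forall z, f z = \prod_(a <- s) (z - a) * F0 z) ->
  (forall z, cmod z <= r1 -> F0 z != 0) ->
  (forall a, a \in s -> cmod a != r) ->
  let kappa := ln (cmod (f 0)) + \sum_(a <- s | cmod a < r) ln (r / cmod a) in
  let S := 2 * (nevanlinna_m f r + Num.max 0 (- ln (cmod (f 0)))) in
  kappa <= nevanlinna_m f r /\
  exists2 c : C, cmod c <= 2 / r * S &
    forall z, cmod z <= r / 2 -> cmod (f z) <=
      expR (kappa + Re (c * z) + 4 / r ^+ 2 * S * cmod z ^+ 2).
Proof.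
move=> f0 r0 rr1 eF0 fE F0n0 sr kappa S.
pose B z := \prod_(a <- s) blaschke_factor r a z.
pose F z := B z * F0 z.
have eB : entire B by apply: entire_prod => a; exact: entire_blaschke_factor.
have eF : entire F by exact: entireM.
have [r2 rr2 B0] := blaschke_seq_zero_free r0 sr.
(* B is known to be zero-free only for |z| < r2; the midpoint yields a closed disc without zeros. *)
pose r' := Num.min r1 ((r + r2) / 2).
have rr' : r < r' by rewrite lt_min rr1/=; lra.
have Fn0 z : cmod z <= r' -> F z != 0.
  rewrite le_min => /andP[z1 z2]; rewrite mulf_neq0 ?F0n0// B0//.
  by apply: le_lt_trans z2 _; lra.
have fF z : cmod z = r -> cmod (F z) = cmod (f z).
  move=> zr; rewrite fE !cmodM !cmod_prod; congr (_ * _); apply: eq_bigr => a _.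
  exact: cmod_blaschke_circle.
have fleF z : cmod z <= r -> cmod (f z) <= cmod (F z).
  move=> zr; rewrite fE !cmodM ler_wpM2r ?cmod_ge0// !cmod_prod.
  by apply: ler_prod => a _; rewrite cmod_ge0 cmod_blaschke_disc.
have mF : nevanlinna_m F r = nevanlinna_m f r.
  rewrite !nevanlinna_m_circle; congr circle_rmean; apply/funext => t.
  by rewrite fF// cmod_circle gtr0_norm.
have s0 a : a \in s -> 0 < cmod a.
  move=> as_; rewrite cmod_gt0; apply/eqP => a0; move: f0; rewrite fE.
  by rewrite (big_rem _ as_)/= a0 subrr !mul0r eqxx.
have f00 : 0 < cmod (f 0) by rewrite cmod_gt0.
have lnF0 : ln (cmod (F 0)) = kappa.
  have f0E : cmod (f 0) = (\prod_(a <- s) cmod a) * cmod (F0 0).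
    rewrite fE cmodM cmod_prod; congr (_ * _); apply: eq_bigr => a _.
    by rewrite sub0r cmodN.
  have lnprod (u : C -> R) : (forall a, a \in s -> 0 < u a) ->
      ln (\prod_(a <- s) u a) = \sum_(a <- s) ln (u a) /\ 0 < \prod_(a <- s) u a.
    elim: (s) => [|a l IH] Hu; first by rewrite !big_nil ln1.
    have ua := Hu _ (mem_head a l).
    have [IH1 IH2] := IH (fun c cs => Hu c (mem_behead (s := a :: l) cs)).
    by rewrite !big_cons lnM ?posrE// IH1 mulr_gt0.
  have F00 : 0 < cmod (F0 0) by rewrite cmod_gt0 F0n0// cmod0 ltW// (lt_trans r0).
  rewrite /kappa f0E /F cmodM cmod_prod.
  have [l1 p1] := lnprod cmod s0.
  have [|l2 p2] := lnprod (fun a => cmod (blaschke_factor r a 0)).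
    by move=> a as_; apply: lt_le_trans (cmod_blaschke_disc _ _ _) => //;
      rewrite ?cmod0 ?ltW// sub0r cmodN s0.
  rewrite !lnM ?posrE// l1 l2 addrAC; congr (_ + _).
  rewrite [X in _ + X]big_mkcond -big_split/=; apply: eq_big_seq => a as_.
  rewrite cmod_blaschke0//.
  case: ifP => _; last by rewrite addr0.
  by rewrite ln_div ?posrE ?s0// addrC subrK.
have lnf : ln (cmod (f 0)) <= kappa.
  rewrite -lnF0 ler_ln ?posrE//; first by apply: fleF; rewrite cmod0 ltW.
  by rewrite (lt_le_trans f00)// fleF// cmod0 ltW.
have [] := zero_free_growth eF r0 rr' Fn0.
rewrite mF lnF0 => Km [c cS Hc]; split=> //.
(* [zero_free_growth] yields [S']. As kappa >= ln |f(0)|, it is at most [S], in which the zeros do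
   not appear. *)
pose S' := 2 * (nevanlinna_m f r + Num.max 0 (- kappa)).
have SS' : S' <= S.
  rewrite /S' /S ler_pM2l// lerD2l ge_max !le_max lexx/=.
  by rewrite lerN2 lnf orbT.
exists c.
  by apply: le_trans cS _; rewrite ler_wpM2l// divr_ge0// ltW.
move=> z zr; have zr' : cmod z <= r by lra.
apply: le_trans (fleF _ zr') _; apply: le_trans (Hc _ zr) _.
rewrite ler_expR lerD2l ler_wpM2r ?sqr_ge0// ler_wpM2l//.
by rewrite divr_ge0// sqr_ge0.
Qed.

End GrowthBound.

(** * Nevanlinna functions of entire functions *)

Section CountingFunction.
Context {R : realType}.
Local Notation C := R[i].
Local Notation mu := (@lebesgue_measure R).
Implicit Types (f g F : C -> C) (r : R).

Lemma has_pole_order_cmodP g (z : C) n : has_pole_order g z n <->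
  exists2 l : C, l != 0 & forall e : R, 0 < e -> exists2 d : R, 0 < d &
    forall w, cmod (w - z) < d -> w != z -> cmod ((w - z) ^+ n * g w - l) < e.
Proof.
split=> [[l l0 H]|[l l0 H]]; exists l => //.
- move=> e e0; move/cvg_cmodP: H => /(_ e e0).
  rewrite /= /nbhs /= /dnbhs /within /= => /nbhs_cmodP[d d0 Hd].
  by exists d.
- apply/cvg_cmodP => e e0; rewrite /= /nbhs /= /dnbhs /within /=.
  by apply/nbhs_cmodP; have [d d0 Hd] := H e e0; exists d.
Qed.

Lemma punctured_point (z : C) (d : R) : 0 < d ->
  exists w, [/\ w != z, cmod (w - z) < d & cmod (w - z) < 1].
Proof.
move=> d0; pose m := Num.min d 1 / 2.
have m0 : 0 < m by rewrite divr_gt0// lt_min d0 ltr01.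
have md : m < Num.min d 1 by rewrite ltr_pdivrMr// ltr_pMr ?lt_min ?d0 ?ltr01// ltr1n.
exists (m%:C + z); rewrite addrK -subr_eq0 addrK cmod_real gtr0_norm//.
by move: md; rewrite lt_min -cmod_gt0 cmod_real gtr0_norm// m0 => /andP[-> ->].
Qed.

(** If (w - z)^n g is bounded near z, then (w - z)^m g tends to 0 for m > n. This gives both the
    uniqueness of the pole order and its vanishing for entire functions. *)
Lemma bounded_no_pole_order g (z : C) n m (K d : R) : (n < m)%N -> 0 < K -> 0 < d ->
  (forall w, cmod (w - z) < d -> w != z -> cmod ((w - z) ^+ n * g w) < K) ->
  ~ has_pole_order g z m.
Proof.
move=> nm K0 d20 H2 /has_pole_order_cmodP[k k0 Hk].
have kp : 0 < cmod k / 2 by rewrite divr_gt0// cmod_gt0.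
have [d1 d10 H1] := Hk _ kp.
have [|w [wz w1 w2]] := @punctured_point z (Num.min (Num.min d1 d) (cmod k / 2 / K)).
  by rewrite !lt_min d10 d20 divr_gt0.
move: w1; rewrite !lt_min => /andP[/andP[wd1 wd2] w3].
have a1 := H1 w wd1 wz; have b2 := H2 w wd2 wz.
have b1 : cmod k / 2 < cmod ((w - z) ^+ m * g w).
  have := lerB_cmod k (k - (w - z) ^+ m * g w); rewrite opprB addrCA subrr addr0.
  by rewrite cmod_distC in a1; lra.
move: b1; rewrite -(subnKC nm) addSnnS exprD -mulrA mulrCA cmodM cmodX.
move=> b1; have c1 : cmod (w - z) ^+ (m - n.+1).+1 <= cmod (w - z).
  by rewrite exprS -[leRHS]mulr1 ler_wpM2l ?cmod_ge0// exprn_ile1 ?cmod_ge0// ltW.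
have : cmod k / 2 < cmod (w - z) * K.
  apply: lt_le_trans b1 _; apply: ler_pM; rewrite ?cmod_ge0 ?exprn_ge0 ?cmod_ge0//.
  exact: ltW.
by move: w3; rewrite ltr_pdivlMr// => /lt_trans h /h; rewrite ltxx.
Qed.

Lemma has_pole_order_ltF g (z : C) n m : (n < m)%N ->
  has_pole_order g z n -> ~ has_pole_order g z m.
Proof.
move=> nm /has_pole_order_cmodP[l l0 Hl]; have [d d0 Hd] := Hl _ ltr01.
have lp : 0 < cmod l + 1 by rewrite ltr_wpDl// cmod_ge0.
apply: (bounded_no_pole_order nm lp d0) => w wd wz.
by rewrite -(subrK l (_ * _)) (le_lt_trans (cmodD _ _))// addrC ltrD2l Hd.
Qed.

Lemma pole_orderE g (z : C) n : has_pole_order g z n -> pole_order g z = n.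
Proof.
move=> gn; apply: xget_unique => // m gm; have [mn|nm|//] := ltngtP m n.
  by case: (has_pole_order_ltF mn gm).
by case: (has_pole_order_ltF nm gn).
Qed.

Lemma pole_order_entire f (z : C) : entire f -> pole_order f z = 0%N.
Proof.
move=> ef; rewrite /pole_order; case: xgetP => // -[//|n] _ /= fn; exfalso.
have cf : {for z, continuous f} by apply: derive_continuous; exact: ef.
move/cvg_cmodP: cf => /(_ _ ltr01)/nbhs_cmodP[d d0 Hd].
have fp : 0 < cmod (f z) + 1 by rewrite ltr_wpDl// cmod_ge0.
apply: (bounded_no_pole_order (n := 0) (m := n.+1) _ fp d0 _ fn) => // w wd _.
by rewrite mul1r -(subrK (f z) (f w)) (le_lt_trans (cmodD _ _))// addrC ltrD2l Hd.
Qed.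

Lemma nevanlinna_n_entire f t : entire f -> nevanlinna_n f t = 0.
Proof. by move=> ef; rewrite /nevanlinna_n fsbig1// => z _; rewrite pole_order_entire. Qed.

Lemma nevanlinna_N_entire f r : entire f -> nevanlinna_N f r = 0.
Proof.
move=> ef; rewrite /nevanlinna_N nevanlinna_n_entire// mul0r addr0.
under eq_Rintegral do rewrite nevanlinna_n_entire// subrr mul0r.
by rewrite Rintegral_cst ?mul0r//; exact: measurable_itv.
Qed.

Lemma nevanlinna_T_entire f r : entire f -> nevanlinna_T f r = nevanlinna_m f r.
Proof. by move=> ef; rewrite /nevanlinna_T nevanlinna_N_entire// addr0. Qed.

Section Zeros.
Variables (f F : C -> C) (r : R) (s : seq C).
Hypothesis eF : entire F.
Hypothesis fE : forall z, f z = \prod_(a <- s) (z - a) * F z.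
Hypothesis F0 : forall z, cmod z <= r -> F z != 0.

Lemma prod_count_mem (z w : C) :
  \prod_(a <- s) (w - a) = (w - z) ^+ count_mem z s * \prod_(a <- s | a != z) (w - a).
Proof.
elim: s => [|a l IH]; first by rewrite !big_nil mulr1.
rewrite !big_cons IH /=; have [->|az] := eqVneq a z.
  by rewrite add1n exprS mulrA.
by rewrite add0n mulrCA.
Qed.

(** Splitting off the factors at z leaves H with H(z) <> 0, so 1/H is continuous at z and supplies
    the nonzero limit. Points outside s are the case of exponent 0. *)
Lemma pole_order_inv_zeros (z : C) : cmod z <= r ->
  pole_order (fun w => (f w)^-1) z = count_mem z s.
Proof.
move=> zr; apply: pole_orderE; apply/has_pole_order_cmodP.
pose H w := \prod_(a <- s | a != z) (w - a) * F w.
have H0 : H z != 0.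
  rewrite mulf_neq0 ?F0// prodf_seq_neq0; apply/allP => a _; apply/implyP => az.
  by rewrite subr_eq0 eq_sym.
have eH : entire H.
  apply: entireM; last exact: eF.
  rewrite (_ : (fun w => _) = (fun w : C => \prod_(a <- s) (if a != z then w - a else 1))).
    apply: entire_prod => a; case: (a != z); first exact: entire_shift.
    exact: entire_cst.
  by apply/funext => w; rewrite big_mkcond.
exists (H z)^-1; first by rewrite invr_eq0.
move=> e e0; have cH : {for z, continuous (fun w => (H w)^-1)}.
  by apply: derive_continuous; apply: cderivableV; [exact: H0|exact: eH].
move/cvg_cmodP: cH => /(_ _ e0)/nbhs_cmodP[d d0 Hd]; exists d => // w wd wz.
rewrite fE (prod_count_mem z) -mulrA -/(H w) invfM mulrA mulfV ?mul1r; first exact: Hd.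
by rewrite expf_neq0// subr_eq0.
Qed.

Lemma nevanlinna_n_zeros t : t <= r ->
  nevanlinna_n (fun w => (f w)^-1) t = \sum_(a <- s | cmod a <= t) 1.
Proof.
move=> tr; rewrite /nevanlinna_n.
pose A := [set z : C | cmod z <= t].
have -> : \sum_(z \in A) ((pole_order (fun w => (f w)^-1) z)%:R : R) =
    \sum_(z \in A) ((count_mem z s)%:R : R).
  by apply: eq_fsbigr => z; rewrite inE /A /= => zt; rewrite pole_order_inv_zeros// (le_trans zt).
pose u := [seq z <- undup s | cmod z <= t].
rewrite (@fsbigE _ _ _ _ A u).
- rewrite big_filter_cond.
  rewrite (eq_bigl (fun z => cmod z <= t)); last first.
    by move=> z; case: (boolP (cmod z <= t)) => //= zt; rewrite mem_set.
  by rewrite -[RHS](@big_undup_iterop_count R 0 +%R).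
- by rewrite filter_uniq// undup_uniq.
- by move=> z /=; rewrite mem_filter => /andP[].
- move=> z zt; rewrite mem_filter mem_undup negb_and => /orP[|/count_memPn -> //].
  by rewrite zt.
Qed.

(** Each nonzero a adds to n(t) the indicator of t >= |a|, and the integral of 1/t from |a| to rho
    is ln (rho / |a|). Zeros at the origin make up n(0) and contribute ln rho each. *)
Lemma nevanlinna_N_zeros (rho : R) : 0 < rho -> rho <= r ->
  nevanlinna_N (fun w => (f w)^-1) rho =
  \sum_(a <- s | cmod a <= rho) (if a == 0 then ln rho else ln (rho / cmod a)).
Proof.
move=> rho0 rr; rewrite /nevanlinna_N.
have n0 := nevanlinna_n_zeros (le_trans (ltW rho0) rr).
pose h (a : C) (t : R) : R := ((fun t => t^-1) \_ `[cmod a, +oo[) t.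
have nE t : t \in `]0, rho] ->
    (nevanlinna_n (fun w => (f w)^-1) t - nevanlinna_n (fun w => (f w)^-1) 0) / t =
    \sum_(a <- s | a != 0) h a t.
  rewrite in_itv/= => /andP[t0 tr].
  rewrite n0 (nevanlinna_n_zeros (le_trans tr rr)) [X in X - _]big_mkcond.
  rewrite [X in _ - X]big_mkcond -sumrB mulr_suml.
  rewrite [RHS]big_mkcond; apply: eq_bigr => a _.
  rewrite /h patchE -cmod_eq0 eq_le cmod_ge0 andbT mem_setE in_itv/= andbT.
  have [a0|a0] := leP (cmod a) 0; first by rewrite (le_trans a0 (ltW t0)) subrr mul0r.
  by case: (cmod a <= t); rewrite subr0 ?mul0r ?mul1r.
have int_h a : a != 0 -> mu.-integrable `]0, rho] (EFin \o h a) /\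
    \int[mu]_(t in `]0, rho]) h a t = if cmod a <= rho then ln (rho / cmod a) else 0.
  move=> a0; have ap : 0 < cmod a by rewrite cmod_gt0.
  have dom : `]0, rho]%classic `&` `[cmod a, +oo[%classic = `[cmod a, rho]%classic :> set R.
    apply/seteqP; split => t /=; rewrite !in_itv/= andbT.
      by move=> [/andP[_ ->] ->].
    by move=> /andP[at_ ->]; rewrite (lt_le_trans ap at_).
  have ch : {within `[cmod a, rho], continuous (fun t : R => t^-1)}.
    rewrite continuous_subspace_in => t; rewrite inE /= in_itv/= => /andP[at_ _].
    apply: (@continuousV _ (subspace `[cmod a, rho]) (fun t => t) t).
      by rewrite gt_eqF// (lt_le_trans ap).
    exact: continuous_subspaceT (fun t => cvg_id) t.
  have ih := within_continuous_integrable ch.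
  split.
    have mD : measurable (`[cmod a, +oo[%classic : set R) by exact: measurable_itv.
    have mE : measurable (`]0, rho]%classic : set R) by exact: measurable_itv.
    rewrite (_ : EFin \o h a = (EFin \o (fun t => t^-1)) \_ `[cmod a, +oo[); last first.
      by apply/funext => t; rewrite /h /= !patchE; case: ifP.
    apply/integrable_restrict; [exact: mD|exact: mE|].
    by rewrite dom.
  rewrite -Rintegral_mkcondr dom; have [ar|ra] := leP (cmod a) rho.
    have dln t : cmod a <= t <= rho -> is_derive t 1 (@ln R) t^-1.
      by move=> /andP[at_ _]; apply: is_derive1_ln; exact: lt_le_trans ap at_.
    by rewrite (Rintegral_FTC ar ch dln) ln_div ?posrE// (lt_le_trans ap).
  by rewrite set_itv_ge ?Rintegral_set0// bnd_simp -ltNge.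
rewrite (_ : \int[mu]_(t in _) _ =
    \int[mu]_(t in `]0, rho]) \sum_(a <- s | a != 0) h a t); last first.
  by apply: eq_Rintegral => t; rewrite inE /= => /nE.
have [_ ->] : mu.-integrable `]0, rho] (EFin \o (fun t => \sum_(a <- s | a != 0) h a t)) /\
    \int[mu]_(t in `]0, rho]) \sum_(a <- s | a != 0) h a t =
    \sum_(a <- s | a != 0) (if cmod a <= rho then ln (rho / cmod a) else 0).
  elim: (s) => [|a l [IH1 IH2]].
    have -> : (fun t => \sum_(a <- [::] | a != 0) h a t) = fun=> 0.
      by apply/funext => t; rewrite big_nil.
    split; first exact: integrable0.
    by rewrite big_nil Rintegral_cst ?mul0r//; exact: measurable_itv.
  have [a0|a0] := eqVneq a 0.
    have -> : (fun t => \sum_(a <- a :: l | a != 0) h a t) = (fun t => \sum_(a <- l | a != 0) h a t).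
      by apply/funext => t; rewrite big_cons a0 eqxx.
    by rewrite big_cons a0 eqxx.
  have [ih hE] := int_h _ a0.
  have -> : (fun t => \sum_(a <- a :: l | a != 0) h a t) =
      (fun t => h a t + \sum_(a <- l | a != 0) h a t).
    by apply/funext => t; rewrite big_cons a0.
  split; last by rewrite big_cons a0 -hE -IH2 (RintegralD _ ih IH1).
  exact: (integrableD _ ih IH1).
rewrite n0 mulr_suml [X in X + _]big_mkcond [X in _ + X]big_mkcond -big_split/=.
rewrite [RHS]big_mkcond; apply: eq_bigr => a _.
rewrite -cmod_eq0 eq_le cmod_ge0 andbT.
have [a0|a0] := leP (cmod a) 0; first by rewrite mul1r add0r (le_trans a0 (ltW rho0)).
by rewrite addr0.
Qed.

End Zeros.
End CountingFunction.

(** * Solutions have exponential type *)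

Section ExponentialType.
Context {R : realType}.
Local Notation C := R[i].
Local Notation Re := (@complex.Re R).
Implicit Types (f g F : C -> C) (r : R).

(** The case of radius 0 of [entire_zeros]: every zero divided out is 0. *)
Lemma entire_order0 f b : entire f -> f b != 0 ->
  exists n (g : C -> C), [/\ entire g, g 0 != 0 & forall z, f z = z ^+ n * g z].
Proof.
move=> ef fb; have [s [F [eF fE sr F0]]] := entire_zeros ef (lexx 0) fb.
exists (size s), F; split => //; first by apply: F0; rewrite cmod0.
move=> z; rewrite fE; congr (_ * _).
elim: s sr {fE} => [|a s IH] sr; first by rewrite big_nil.
rewrite big_cons exprS IH; last by move=> c cs; exact: (sr c (mem_behead (s := a :: s) cs)).
by have := sr _ (mem_head a s); rewrite le_eqVlt ltNge cmod_ge0 orbF cmod_eq0 => /eqP ->;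
  rewrite subr0.
Qed.

(** Supplies radii that differ from the moduli of all listed zeros, as [entire_growth] requires.
    Each listed value is avoided by passing to a half of the interval. *)
Lemma avoid_seq (l : seq R) (a b : R) : a < b -> exists2 x : R, a < x < b & x \notin l.
Proof.
elim: l a b => [|y l IH] a b ab.
  by exists ((a + b) / 2) => //; rewrite midf_lt// midf_lt.
have [ym|my] := ltP y ((a + b) / 2).
  have [|x /andP[x1 x2] xl] := IH ((a + b) / 2) b; first by rewrite midf_lt.
  exists x; first by rewrite x2 (lt_trans _ x1)// midf_lt.
  by rewrite inE negb_or xl gt_eqF// (lt_trans ym).
have [|x /andP[x1 x2] xl] := IH a ((a + b) / 2); first by rewrite midf_lt.
exists x; first by rewrite x1 (lt_trans x2)// midf_lt.
by rewrite inE negb_or xl lt_eqF// (lt_le_trans x2).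
Qed.

Lemma nevanlinna_m_ge0 f r : 0 <= nevanlinna_m f r.
Proof.
apply: mulr_ge0; first by rewrite invr_ge0 ltW// pi2_gt0.
by apply: Rintegral_ge0 => t _; exact: logp_ge0.
Qed.

Lemma le_nevanlinna_m f g r : entire f -> entire g -> 0 <= r ->
  (forall z, cmod z = r -> cmod (f z) <= cmod (g z)) ->
  nevanlinna_m f r <= nevanlinna_m g r.
Proof.
move=> ef eg r0 fg; rewrite !nevanlinna_m_circle.
have cf := within_continuous_logp (holomorphic_circle_continuous (entire_on_disc (r := r) ef) r0).
have cg := within_continuous_logp (holomorphic_circle_continuous (entire_on_disc (r := r) eg) r0).
apply: (le_circle_rmean cf cg) => t _; apply/ler_logp/fg.
by rewrite cmod_circle ger0_norm.
Qed.

Lemma nevanlinna_m_le f r (B : R) : entire f -> 0 <= r -> 0 <= B ->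
  (forall z, cmod z = r -> cmod (f z) <= expR B) -> nevanlinna_m f r <= B.
Proof.
move=> ef r0 B0 fB; rewrite nevanlinna_m_circle -[leRHS](circle_rmean_cst B).
have cf := within_continuous_logp (holomorphic_circle_continuous (entire_on_disc (r := r) ef) r0).
have cB : {within `[0, 2 * pi], continuous (fun _ : R => B)} by exact: (@rwithin_continuous_cst R _ B).
apply: (le_circle_rmean cf cB) => t _.
apply: le_trans (ler_logp (fB _ _)) _; first by rewrite cmod_circle ger0_norm.
by rewrite /logp expRK ge_max B0 lexx.
Qed.

Lemma nevanlinna_m_quotient f g n r : entire f -> entire g ->
  (forall z, f z = z ^+ n * g z) -> 1 <= r -> nevanlinna_m g r <= nevanlinna_m f r.
Proof.
move=> ef eg fE r1; apply: (le_nevanlinna_m eg ef); first by rewrite (le_trans ler01).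
move=> z zr; rewrite fE cmodM cmodX zr ler_peMl ?cmod_ge0//.
by rewrite exprn_ege1.
Qed.

(** In [entire_growth] at rho > 2 r, kappa is at most T and the linear and quadratic terms are at
    most S = 2 (m + L0) each: together 5 T + 4 L0. The factor r^n accounts for the zero at the
    origin. *)
Lemma le_cmod_nevanlinna_T f b : entire f -> f b != 0 ->
  exists n (L : R), forall r, 1 <= r -> exists2 rho : R, 2 * r < rho < 4 * r &
    forall z, cmod z <= r -> cmod (f z) <= r ^+ n * expR (5 * nevanlinna_T f rho + L).
Proof.
move=> ef fb; have [n [g [eg g0 fE]]] := entire_order0 ef fb.
pose L0 := Num.max 0 (- ln (cmod (g 0))).
exists n, (4 * L0) => r r1; have r0 : 0 < r by exact: lt_le_trans r1.
have r40 : 0 <= 4 * r by rewrite mulr_ge0// ltW.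
have [s [F [eF gE sr F0]]] := entire_zeros eg r40 g0.
have [|rho /andP[rho1 rho2] rhos] := @avoid_seq [seq cmod a | a <- s] (2 * r) (4 * r).
  by rewrite ltr_pM2r//; lra.
exists rho; first by rewrite rho1.
have rho0 : 0 < rho by lra.
have srho a : a \in s -> cmod a != rho.
  by move=> as_; apply/eqP => E; move/negP: rhos; apply; rewrite -E map_f.
have := entire_growth g0 rho0 rho2 eF gE F0 srho; cbv zeta.
set kappa := (X in X <= _); set S := 2 * (_ + _) => -[km [c cS Hc]] z zr.
have mT : nevanlinna_m g rho <= nevanlinna_T f rho.
  rewrite (nevanlinna_T_entire _ ef); apply: nevanlinna_m_quotient eg fE _ => //.
  by apply: le_trans r1 _; lra.
have S0 : 0 <= S.
  by rewrite /S mulr_ge0// addr_ge0 ?nevanlinna_m_ge0// le_max lexx.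
have SE : S = 2 * (nevanlinna_m g rho + L0) by [].
rewrite fE cmodM cmodX ler_pM ?exprn_ge0 ?cmod_ge0//.
  by rewrite lerXn2r ?nnegrE ?cmod_ge0// ltW.
apply: le_trans (Hc _ _) _; first by lra.
rewrite ler_expR.
have A1 : Re (c * z) <= S.
  apply: le_trans (ler_norm _) _; apply: le_trans (Re_cmod _) _; rewrite cmodM.
  apply: le_trans (ler_wpM2r (cmod_ge0 _) cS) _.
  rewrite mulrAC -[leRHS]mul1r ler_wpM2r// mulrAC ler_pdivrMr//; lra.
have A2 : 4 / rho ^+ 2 * S * cmod z ^+ 2 <= S.
  rewrite mulrAC -[leRHS]mul1r ler_wpM2r// mulrAC ler_pdivrMr ?exprn_gt0// mul1r.
  rewrite (_ : 4 * _ = (2 * cmod z) ^+ 2); last by ring.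
  have zrho : 2 * cmod z <= rho.
    by rewrite (le_trans _ (ltW rho1))// ler_pM2l.
  by apply: lerXn2r zrho; rewrite nnegrE ?mulr_ge0 ?cmod_ge0// ltW.
move: A1 A2; set X := complex.Re _; set Y := 4 / _ * _ * _ => A1 A2.
rewrite -/kappa; apply: le_trans (lerD (lerD km A1) A2) _.
by rewrite SE; lra.
Qed.

Lemma le_expR_logp (x : R) : x <= expR (logp x).
Proof.
have [x0|x0] := leP x 0; first exact: le_trans x0 (expR_ge0 _).
by rewrite -{1}(lnK (x := x))// ler_expR ln_le_logp.
Qed.

Lemma hyper_order_lt1 f : (hyper_order f < 1)%E ->
  exists sigma M : R, [/\ sigma < 1, 1 <= M & forall r, M < r ->
    nevanlinna_T f r <= expR (expR (sigma * ln r))].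
Proof.
rewrite /hyper_order /limf_esup => /ereal_inf_lt[_ [V [M0 [_ MV]] <-] supV].
have [sigma s1 Hs] : exists2 sigma : R, sigma < 1 & forall r, V r ->
    logp (logp (nevanlinna_T f r)) / ln r <= sigma.
  have ub r : V r -> ((logp (logp (nevanlinna_T f r)) / ln r)%:E <=
      ereal_sup [set (logp (logp (nevanlinna_T f r)) / ln r)%:E | r in V])%E.
    by move=> Vr; apply: ereal_sup_ubound; exists r.
  move: supV ub; case: (ereal_sup _) => [s|//|] sl ub.
    by exists s => [|r /ub]; rewrite -?lte_fin// lee_fin.
  (* A supremum equal to -oo bounds no real value, so V is empty here. *)
  by exists 0 => // r /ub; rewrite leeNy_eq.
exists sigma, (Num.max M0 1); split => //; first by rewrite le_max lexx orbT.
move=> r; rewrite gt_max => /andP[Mr r1].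
have lr : 0 < ln r by rewrite ln_gt0.
have := Hs r (MV r Mr); rewrite ler_pdivrMr// => H.
apply: le_trans (le_expR_logp _) _; rewrite ler_expR.
by apply: le_trans (le_expR_logp _) _; rewrite ler_expR.
Qed.

(** Each Horner step uses the induction hypothesis at rate d / 2 and spends the other half on x <=
    (2 / d) exp(d x / 2). *)
Lemma poly_le_exp (p : {poly C}) (d : R) : 0 < d ->
  exists2 D : R, 0 < D & forall z, cmod p.[z] <= D * expR (d * cmod z).
Proof.
elim/poly_ind: p d => [|p c IH] d d0.
  by exists 1 => // z; rewrite horner0 cmod0 mul1r expR_ge0.
have d20 : 0 < d / 2 by rewrite divr_gt0.
have [D D0 HD] := IH _ d20.
exists (D * (2 / d) + cmod c + 1) => [|z].
  by rewrite ltr_wpDl// addr_ge0 ?cmod_ge0// mulr_ge0 ?ltW// divr_gt0.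
rewrite hornerMXaddC; apply: le_trans (cmodD _ _) _; rewrite cmodM.
set x := cmod z; have x0 : 0 <= x by exact: cmod_ge0.
have E1 : 1 <= expR (d * x) by rewrite -expR0 ler_expR mulr_ge0// ltW.
have xE : x <= 2 / d * expR (d / 2 * x).
  rewrite -ler_pdivrMl ?divr_gt0// invf_div.
  by apply: le_trans _ (expR_ge1Dx _); rewrite lerDr.
have EE : expR (d * x) = expR (d / 2 * x) * expR (d / 2 * x).
  by rewrite -expRD -mulrDl -splitr.
have A : cmod p.[z] * x <= D * (2 / d) * expR (d * x).
  apply: le_trans (ler_pM (cmod_ge0 _) x0 (HD z) xE) _.
  by rewrite EE le_eqVlt; apply/orP; left; apply/eqP; rewrite -/x; ring.
have B := ler_wpM2l (cmod_ge0 c) E1.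
rewrite mulr1 in B; set E := expR (d * x) in A B E1 *.
rewrite [leRHS](_ : _ = (D * (2 / d) * E + cmod c * E) + E); last by ring.
apply: le_trans (lerD A B) _; rewrite lerDl; exact: le_trans ler01 E1.
Qed.

Lemma rhs_le_exp (p1 p2 a1 a2 : C) : exists A c : R, [/\ 0 <= A, 0 <= c &
  forall z, cmod (p1 * cexp (a1 * z) + p2 * cexp (a2 * z)) <= A * expR (c * cmod z)].
Proof.
exists (cmod p1 + cmod p2), (cmod a1 + cmod a2); split.
- by rewrite addr_ge0 ?cmod_ge0.
- by rewrite addr_ge0 ?cmod_ge0.
move=> z; apply: le_trans (cmodD _ _) _; rewrite !cmodM !cmod_cexp mulrDl.
have H (b : C) (x : R) : cmod b <= x -> Re (b * z) <= x * cmod z.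
  move=> bx; apply: le_trans (ler_norm _) _; apply: le_trans (Re_cmod _) _.
  by rewrite cmodM ler_wpM2r ?cmod_ge0.
by rewrite lerD// ler_wpM2l ?cmod_ge0// ler_expR H// ?lerDl ?lerDr cmod_ge0.
Qed.

(** With E = exp(n / 4), the left side is at most a constant times E, while 2^n >= E^2 because ln 2
    >= 1/2. The hypothesis on n makes E exceed that constant divided by v. *)
Lemma exp_beats_linear (K L v : R) (N n : nat) : 0 <= K -> 0 < v ->
  (4 * N%:R * K + `|L| + 5) / v < n%:R / 4 ->
  N%:R * (K * n%:R) + `|L| + 5 * expR (n%:R / 4) < 2 ^+ n * v.
Proof.
move=> K0 v0; set E := expR (n%:R / 4).
have nE : n%:R / 4 <= E - 1 by rewrite lerBrDl expR_ge1Dx.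
have E1 : 1 <= E by rewrite /E -expR0 ler_expR divr_ge0.
have E2n : E * E <= 2 ^+ n.
  rewrite /E -expRD -mulrDr (_ : 4^-1 + 4^-1 = 2^-1 :> R); last by field.
  rewrite -(@lnK _ (2 ^+ n)) ?posrE ?exprn_gt0// ler_expR lnXn// -[ln 2 *+ n]mulr_natl.
  rewrite ler_wpM2l//; have := @le_ln1Dx R (- (1 / 2)).
  by rewrite (_ : 1 + - (1 / 2) = 2^-1) ?lnV ?posrE//; [lra|field].
move=> nv.
have ZE : (4 * N%:R * K + `|L| + 5) / v < E by apply: lt_le_trans nv _; lra.
move: ZE; rewrite ltr_pdivrMr// => ZE.
have E0 : 0 < E by lra.
have vE : E * v * E <= 2 ^+ n * v.
  by rewrite mulrAC; apply: ler_wpM2r; [exact: ltW|exact: E2n].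
apply: lt_le_trans vE.
apply: le_lt_trans (_ : (4 * N%:R * K + `|L| + 5) * E < _); last by rewrite ltr_pM2r.
have LE : `|L| <= `|L| * E by rewrite ler_peMr.
have NK : 0 <= N%:R * K by rewrite mulr_ge0.
have xE : n%:R <= 4 * E by lra.
have := ler_wpM2l NK xE; lra.
Qed.

Theorem exponential_type (p1 p2 a1 a2 beta : C) (a : {poly C}) k f :
  entire f -> (exists b, f b != 0) -> (hyper_order f < 1)%E ->
  (forall z, f z ^+ 2 + a.[z] * cderiv k f (z + beta) =
    p1 * cexp (a1 * z) + p2 * cexp (a2 * z)) ->
  exists c e : R, [/\ 0 <= c, 0 <= e & forall z, cmod (f z) <= expR (c * cmod z + e)].
Proof.
move=> ef [b0 fb0] hf f_eq.
have [A1 [c1 [A10 c10 H1]]] := rhs_le_exp p1 p2 a1 a2.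
have [A2 A20 H2] := poly_le_exp a ltr01.
pose A := A1 + A2 + 1; pose c := c1 + 1; have A0 : 0 < A by rewrite /A; lra.
pose b := cmod beta + k%:R + 1.
have b0' : 0 < b by rewrite ltr_wpDl// addr_ge0 ?cmod_ge0.
have c0 : 0 <= c by rewrite /c; lra.
(* As exp(d) = 4 A, V(z) > 0 makes the right side of the equation at most |f(z)|^2 / 4; the
   derivative term has the same bound if |f| <= exp(2 ln |f(z)| - c |z| - d) near z + beta, which is
   absurd. The choice e = d + c b makes all losses of a step cancel in 2 V(z) <= V(w). The 1 in c =
   c1 + 1 absorbs the polynomial. *)
pose d := ln (4 * A); have d0 : 0 <= d by rewrite /d ln_ge0// /A; lra.
have Ed : expR d = 4 * A by rewrite /d lnK// posrE mulr_gt0.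
pose e := d + c * b; have cb0 : 0 <= c * b by rewrite mulr_ge0// ltW.
have e0 : 0 <= e by rewrite addr_ge0.
pose V z := ln (cmod (f z)) - (c * cmod z + e).
exists c, e; split => // z0; rewrite leNgt; apply/negP => fz0.
have V0 : 0 < V z0.
  by rewrite subr_gt0 -ltr_expR lnK// posrE (lt_trans _ fz0) ?expR_gt0.
have Vlt z : 0 < V z -> f z != 0.
  rewrite subr_gt0 -cmod_gt0 => Vz; rewrite lt_neqAle cmod_ge0 andbT.
  apply/eqP => fz; move: Vz; rewrite -fz ln0// ltNge addr_ge0// mulr_ge0//.
  exact: cmod_ge0.
(* Otherwise f is small on the disc of radius k about z + beta, and Cauchy's
   estimates bound the derivative term of the equation at z. *)
have double z : 0 < V z -> exists2 w : C, cmod w <= cmod z + b & 2 * V z <= V w.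
  move=> Vz; have fz := Vlt _ Vz; have fzp : 0 < cmod (f z) by rewrite cmod_gt0.
  set x := cmod z; have x0 : 0 <= x by exact: cmod_ge0.
  pose y := ln (cmod (f z)); have fy : cmod (f z) = expR y by rewrite /y lnK.
  have yV : c * x + e < y by move: Vz; rewrite /V -/x -/y subr_gt0.
  pose B := expR (2 * y - c * x - d).
  have [w wk fw] : exists2 w : C, cmod (w - (z + beta)) <= k%:R & B < cmod (f w).
    apply: contrapT => H.
    have Hk : cmod (cderiv k f (z + beta)) <= B.
      apply: (cderiv_bound ef) => w wk; rewrite leNgt; apply/negP => Bw.
      by apply: H; exists w.
    have fsq : cmod (f z) ^+ 2 <= A1 * expR (c1 * x) + A2 * expR (1 * x) * B.
      rewrite -cmodX (_ : f z ^+ 2 = (p1 * cexp (a1 * z) + p2 * cexp (a2 * z))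
        - a.[z] * cderiv k f (z + beta)); last by rewrite -f_eq addrK.
      apply: le_trans (cmodB _ _) _; rewrite lerD ?H1// cmodM.
      by rewrite ler_pM ?cmod_ge0 ?H2.
    have E1 : expR (c1 * x) <= expR (c * x) by rewrite ler_expR ler_wpM2r// /c; lra.
    have E2 : expR (1 * x) <= expR (c * x) by rewrite ler_expR ler_wpM2r// /c; lra.
    have yE : expR (c * x) * (4 * A) <= expR (2 * y).
      by rewrite -Ed -expRD ler_expR; move: yV; rewrite /e; nra.
    have BE : expR (c * x) * (4 * A) * B = expR (2 * y).
      by rewrite /B -Ed -!expRD; congr expR; ring.
    have y2 : cmod (f z) ^+ 2 = expR (2 * y) by rewrite fy expr2 -expRD mulr_natl mulr2n.
    have B0 : 0 < B by exact: expR_gt0.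
    have yp : 0 < expR (2 * y) by exact: expR_gt0.
    have xp : 0 < expR (c * x) by exact: expR_gt0.
    have F1 : A1 * expR (c1 * x) <= A * expR (c * x).
      apply: ler_pM; [exact: A10|exact: expR_ge0| |exact: E1].
      by rewrite /A; lra.
    have F2 : A2 * expR (1 * x) * B <= A * expR (c * x) * B.
      apply: ler_wpM2r; first exact: ltW.
      apply: ler_pM; [exact: ltW|exact: expR_ge0| |exact: E2].
      by rewrite /A; lra.
    move: fsq; rewrite y2; lra.
  have wx : cmod w <= x + b.
    have -> : w = (w - (z + beta)) + z + beta by ring.
    apply: le_trans (cmodD _ _) _; apply: le_trans (lerD (cmodD _ _) (lexx _)) _.
    by rewrite -/x /b; lra.
  exists w => //.
  have lw : 2 * y - c * x - d < ln (cmod (f w)).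
    by rewrite -ltr_expR lnK// posrE (lt_trans _ fw) ?expR_gt0.
  have cw := ler_wpM2l c0 wx.
  by rewrite /V -/x -/y; move: lw cw; rewrite /e mulrDr; lra.
have [zs zsP] : exists zs : nat -> C, forall n, cmod (zs n) <= cmod z0 + n%:R * b /\
    2 ^+ n * V z0 <= V (zs n).
  have stepE z : exists w, 0 < V z -> cmod w <= cmod z + b /\ 2 * V z <= V w.
    have [Vz|nV] := ltP 0 (V z); last by exists z.
    by have [w w1 w2] := double _ Vz; exists w.
  have [step stepP] := choice stepE.
  exists (fun n => iter n step z0); elim=> [|n [IH1 IH2]].
    by rewrite /= mul0r addr0 expr0 mul1r.
  have Vn : 0 < V (iter n step z0) by apply: lt_le_trans IH2; rewrite mulr_gt0// exprn_gt0.
  have [s1 s2] := stepP _ Vn; split.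
    have -> : n.+1%:R * b = n%:R * b + b by rewrite -natr1 mulrDl mul1r.
    by apply: le_trans s1 _; lra.
  by apply: le_trans s2; rewrite exprS -mulrA ler_pM2l.
have [N [L HL]] := le_cmod_nevanlinna_T ef fb0.
have [sigma [M [s1 M1 HM]]] := hyper_order_lt1 hf.
pose v := V z0; pose K := 4 * (cmod z0 + 1 + b).
have z00 : 0 <= cmod z0 by exact: cmod_ge0.
have K0 : 0 < K by rewrite /K; lra.
(* Here 2 r < rho < 4 r <= K n. The first lower bound on 2 r makes the hyper-order estimate
   available at rho, the second absorbs the factor K. *)
have bound n : (0 < n)%N -> M < 2 * (cmod z0 + n%:R * b + 1) ->
    ln (4 * K) / (1 - sigma) <= ln (2 * (cmod z0 + n%:R * b + 1)) ->
    2 ^+ n * v <= N%:R * (K * n%:R) + `|L| + 5 * expR (n%:R / 4).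
  move=> n0 Mn sn; set r := cmod z0 + n%:R * b + 1 in Mn sn.
  have n1 : 1 <= n%:R :> R by rewrite ler1n.
  have nb : 0 <= n%:R * b by rewrite mulr_ge0// ltW.
  have r1 : 1 <= r by rewrite /r; lra.
  have rK : 4 * r <= K * n%:R by rewrite /r /K; nra.
  have [rho /andP[rho1 rho2] Hr] := HL r r1.
  have [z1 z2] := zsP n.
  have fzn : 0 < V (zs n) by apply: lt_le_trans z2; rewrite mulr_gt0// exprn_gt0.
  have fn0 : 0 < cmod (f (zs n)) by rewrite cmod_gt0 Vlt.
  have zr : cmod (zs n) <= r by rewrite /r; lra.
  have := Hr _ zr; rewrite -ler_ln ?posrE ?mulr_gt0 ?expR_gt0 ?exprn_gt0//; last by lra.
  rewrite lnM ?posrE ?expR_gt0 ?exprn_gt0//; last by lra.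
  rewrite lnXn; last by lra.
  rewrite expRK => H.
  have rho0 : 0 < rho by lra.
  have Trho := HM rho (lt_trans Mn rho1).
  have lrho : ln rho <= ln (K * n%:R).
    have Kn : 0 < K * n%:R by rewrite mulr_gt0// ltr0n.
    by rewrite ler_ln ?posrE//; exact: le_trans (ltW rho2) rK.
  (* Subtract (1 - sigma) ln rho >= ln (4 K) from ln rho <= ln (K n). Then T(rho) <= exp(n / 4),
     which 2^n outgrows. *)
  have srho : sigma * ln rho <= ln (n%:R / 4).
    have l1 : ln (4 * K) / (1 - sigma) <= ln rho.
      by apply: le_trans sn _; rewrite ler_ln ?posrE ?ltW// mulr_gt0// (lt_le_trans ltr01).
    move: l1; rewrite ler_pdivrMr ?subr_gt0// => l1.
    have n0' : 0 < n%:R :> R by rewrite ltr0n.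
    move: lrho l1; rewrite ln_div ?posrE// [ln (K * _)]lnM ?posrE//.
    by rewrite [ln (4 * K)]lnM ?posrE//; clear; lra.
  have ET : expR (expR (sigma * ln rho)) <= expR (n%:R / 4).
    rewrite ler_expR -[leRHS]lnK ?ler_expR// posrE divr_gt0// ltr0n//.
  have lr : ln r <= K * n%:R.
    have r1' : -1 < r - 1 by lra.
    by have := le_ln1Dx r1'; rewrite addrC subrK; lra.
  have lrn : ln r *+ N <= N%:R * (K * n%:R) by rewrite -[ln r *+ N]mulr_natl ler_wpM2l.
  have cz : 0 <= c * cmod (zs n) + e by rewrite addr_ge0// mulr_ge0// cmod_ge0.
  have := ler_norm L.
  have z2' : 2 ^+ n * v <= ln (cmod (f (zs n))) - (c * cmod (zs n) + e) by exact: z2.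
  move: z2' H lrn (le_trans Trho ET) cz.
  set x1 := 2 ^+ n * v; set x2 := ln (cmod _); set x3 := _ *+ N; set x4 := N%:R * _.
  set x5 := nevanlinna_T _ _; set x6 := expR _; set x7 := _ + e; lra.
have [n0 Hn0] : exists n0 : nat, forall n, (n0 <= n)%N ->
    M < 2 * (cmod z0 + n%:R * b + 1) /\
    ln (4 * K) / (1 - sigma) <= ln (2 * (cmod z0 + n%:R * b + 1)).
  pose Q := Num.max M (expR (ln (4 * K) / (1 - sigma))).
  have Q0 : 0 < Q by rewrite lt_max expR_gt0 orbT.
  exists (Num.truncn (Q / b)).+1 => n nn.
  have nQ : Q < n%:R * b.
    rewrite -ltr_pdivrMr//; apply: lt_le_trans (truncnS_gt _) _; by rewrite ler_nat.
  move: nQ; rewrite /Q gt_max => /andP[q1 q2]; split; first by lra.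
  rewrite -ler_expR lnK; first lra.
  by rewrite posrE; have := expR_gt0 (ln (4 * K) / (1 - sigma)); lra.
have [n [nn0 np nv]] : exists n, [/\ (n0 <= n)%N, (0 < n)%N &
    (4 * N%:R * K + `|L| + 5) / v < n%:R / 4].
  set Z := _ / v; exists (maxn n0.+1 (4 * (Num.truncn `|Z|).+1)%N); split.
  - by rewrite leq_max leqnSn.
  - by rewrite leq_max.
  - apply: le_lt_trans (ler_norm _) _; apply: lt_le_trans (truncnS_gt _) _.
    by rewrite ler_pdivlMr// mulrC -natrM ler_nat leq_max leqnn orbT.
have [h1 h2] := Hn0 _ nn0.
have := bound n np h1 h2; apply/negP; rewrite -ltNge.
exact: exp_beats_linear (ltW K0) V0 nv.
Qed.

End ExponentialType.

(** * Solutions are close to a single exponential *)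

Section SingleExponent.
Context {R : realType}.
Local Notation C := R[i].
Local Notation Re := (@complex.Re R).
Local Notation Im := (@complex.Im R).
Local Notation mu := (@lebesgue_measure R).
Implicit Types (f g F : C -> C) (r : R).

Lemma unbounded_outside (E : set R) (M : R) : measurable E -> (mu E < +oo)%E ->
  exists2 r : R, M < r & ~ E r.
Proof.
move=> mE Efin; apply: contrapT => H.
have sub : `]M, +oo[%classic `<=` E.
  move=> r /=; rewrite in_itv/= andbT => Mr; apply: contrapT => nE.
  by apply: H; exists r.
have mI : mu `]M, +oo[%classic = +oo%E by rewrite lebesgue_measure_itv/= ltry.
have := @le_measure _ _ _ mu `]M, +oo[%classic E.
rewrite !inE => /(_ (measurable_itv _) mE sub) ME.
have ME' : (+oo <= mu E)%E by rewrite -mI; exact: ME.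
by have := le_lt_trans ME' Efin; rewrite ltxx.
Qed.

(** Linear growth of T turns o(T) into o(r), and an exceptional set of finite measure contains no
    half-line, so good radii exist beyond any bound. *)
Lemma is_S_linear (phi : R -> R) f (c e : R) : 0 <= c -> 0 <= e ->
  (forall r, 1 <= r -> nevanlinna_T f r <= c * r + e) -> is_S phi f ->
  forall eps M : R, 0 < eps -> exists r : R, [/\ M <= r, 1 <= r & phi r <= eps * r].
Proof.
move=> c0 e0 Tf [E [mE Efin HE]] eps M eps0.
have ce : 0 < c + e + 1 by lra.
have [M1 [_ HM1]] := HE _ (divr_gt0 eps0 ce).
have [r rM nE] := unbounded_outside (Num.max (Num.max M 1) M1) mE Efin.
move: rM; rewrite !gt_max => /andP[/andP[Mr r1] M1r].
exists r; split; [exact: ltW|exact: ltW|].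
apply: le_trans (ler_norm _) _; apply: le_trans (HM1 r M1r nE) _.
have Tr : nevanlinna_T f r <= (c + e + 1) * r.
  by apply: le_trans (Tf r (ltW r1)) _; nra.
apply: le_trans (ler_wpM2l _ Tr) _; first by rewrite ltW// divr_gt0.
by rewrite mulrA divfK// gt_eqF.
Qed.

(** Each summand, and the set of zeros counted, increases with the radius; the n zeros at the origin
    add n ln r to N, which is nonnegative since r >= 1. *)
Lemma counting_sum_le f g F (s : seq C) n (rho r : R) : entire F -> g 0 != 0 ->
  (forall z, f z = z ^+ n * g z) -> (forall z, g z = \prod_(a <- s) (z - a) * F z) ->
  (forall z, cmod z <= r -> F z != 0) -> (forall a, a \in s -> cmod a <= r) ->
  1 <= r -> 0 < rho -> rho <= r ->
  \sum_(a <- s | cmod a < rho) ln (rho / cmod a) <= nevanlinna_N (fun z => (f z)^-1) r.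
Proof.
move=> eF g0 fE gE F0 sr r1 rho0 rr; have r0 : 0 < r by exact: lt_le_trans r1.
have fE' z : f z = \prod_(a <- nseq n 0 ++ s) (z - a) * F z.
  rewrite fE gE mulrA; congr (_ * _); rewrite big_cat/=; congr (_ * _).
  elim: n {fE} => [|n IH]; first by rewrite big_nil.
  by rewrite exprS IH big_cons subr0.
rewrite (nevanlinna_N_zeros eF fE' F0 r0 (lexx r)) big_cat/=.
have s0 a : a \in s -> 0 < cmod a.
  move=> as_; rewrite cmod_gt0; apply/eqP => a0; move: g0; rewrite gE.
  by rewrite (big_rem _ as_)/= a0 subrr !mul0r eqxx.
rewrite -[leLHS]add0r; apply: lerD.
  rewrite big_seq_cond; apply: sumr_ge0 => a /andP[].
  by rewrite mem_nseq => /andP[_ /eqP ->] _; rewrite eqxx ln_ge0.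
rewrite big_mkcond [leRHS]big_mkcond big_seq [leRHS]big_seq; apply: ler_sum => a as_.
have a0 := s0 a as_; rewrite (sr a as_) -cmod_eq0 gt_eqF//.
case: ifP => ar; last by rewrite ln_ge0// ler_pdivlMr// mul1r sr.
by rewrite ler_ln ?posrE ?divr_gt0// ler_pM2r// invr_gt0.
Qed.

(** The exponent a still depends on the scale r, but D does not: |a| <= 2 S / rho and S = O(rho).
    This boundedness allows a limit of the exponents afterwards. *)
Lemma exponent_at_scale f (c e : R) : entire f -> (exists b, f b != 0) ->
  0 <= c -> 0 <= e -> (forall z, cmod (f z) <= expR (c * cmod z + e)) ->
  is_S (nevanlinna_N (fun z => (f z)^-1)) f ->
  exists D : R, forall eps r0 : R, 0 < eps -> exists (r : R) (a : C),
    [/\ r0 <= r, 1 <= r, cmod a <= D &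
      forall z, cmod z <= r -> cmod (f z) <= expR (Re (a * z) + eps * r)].
Proof.
move=> ef [b fb] c0 e0 fce fS.
have Tf r : 1 <= r -> nevanlinna_T f r <= c * r + e.
  move=> r1; have r0 : 0 <= r by exact: le_trans r1.
  rewrite (nevanlinna_T_entire _ ef); apply: nevanlinna_m_le => //.
    by rewrite addr_ge0// mulr_ge0.
  by move=> z <-.
have NS := is_S_linear c0 e0 Tf fS.
have [n [g [eg g0 fE]]] := entire_order0 ef fb.
pose l0 := ln (cmod (g 0)); pose L0 := Num.max 0 (- l0).
have L00 : 0 <= L0 by rewrite /L0 le_max lexx.
pose K0 := 2 * (c + e + L0); have K00 : 0 <= K0 by rewrite mulr_ge0// !addr_ge0.
exists (2 * K0) => eps r0 eps0.
(* Evaluating at radius r = rho / K makes the quadratic error term of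
   entire_growth, of size S r^2 / rho^2 with S = O(rho), at most eps r / 4. *)
pose K := 16 * K0 / eps + 2.
(* K >= 2 keeps r <= rho / 2, the range of the bound in [entire_growth]. *)
have K2 : 2 <= K.
  by rewrite /K lerDr; apply: divr_ge0; [exact: mulr_ge0|exact: ltW].
have Kp : 0 < K by lra.
have KK : 16 * K0 <= eps * K.
  rewrite (_ : eps * K = 16 * K0 + 2 * eps); last by rewrite /K; field; rewrite gt_eqF.
  by rewrite lerDl mulr_ge0// ltW.
have eps8 : 0 < eps / 8 by rewrite divr_gt0.
have [D D0 HD] := poly_le_exp 'X^n eps8.
(* As R1 < 2 rho = 2 K r, this rate gives N(R1, 1/f) <= eps r / 4. *)
have eps1 : 0 < eps / (8 * K) by rewrite divr_gt0// mulr_gt0.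
(* Four error terms get eps r / 4 each: z^n, ln |g(0)|, the sum over the zeros and the quadratic
   term. For r >= r0' the constants l0 and ln D fit in. *)
pose r0' := Num.max (Num.max r0 1) (Num.max (`|l0| / (eps / 4)) (`|ln D| / (eps / 8))).
have [R1 [R1M R11 NR]] := NS _ (2 * K * r0') eps1.
have R10 : 0 < R1 by exact: lt_le_trans R11.
have [s [F [eF gE sr F0]]] := entire_zeros eg (ltW R10) g0.
have [|rho /andP[rho1 rho2] rhos] := @avoid_seq R [seq cmod a | a <- s] (R1 / 2) R1.
  by rewrite ltr_pdivrMr//; lra.
have rho0 : 0 < rho by apply: le_lt_trans rho1; rewrite divr_ge0// ltW.
have srho a : a \in s -> cmod a != rho.
  by move=> as_; apply/eqP => E; move/negP: rhos; apply; rewrite -E map_f.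
have := entire_growth g0 rho0 rho2 eF gE F0 srho; cbv zeta.
rewrite -/l0 -/L0; set sig := \sum_(a <- s | _) _; set S := 2 * (_ + _) => -[km [a aS Ha]].
have sigN : sig <= nevanlinna_N (fun z => (f z)^-1) R1.
  exact: counting_sum_le eF g0 fE gE F0 sr R11 rho0 (ltW rho2).
pose r := rho / K; have rho_r : rho = r * K by rewrite /r divfK// gt_eqF.
have rr0 : r0' <= r.
  rewrite /r ler_pdivlMr//; apply: le_trans (ltW rho1).
  rewrite ler_pdivlMr//; apply: le_trans R1M.
  by rewrite le_eqVlt; apply/orP; left; apply/eqP; ring.
move: (rr0); rewrite /r0' !ge_max => /andP[/andP[r0r r1] /andP[rl rD]].
rewrite ler_pdivrMr ?divr_gt0// in rl; rewrite ler_pdivrMr ?divr_gt0// in rD.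
have rp : 0 < r by exact: lt_le_trans r1.
have rho1' : 1 <= rho by rewrite rho_r -[1]mulr1 ler_pM//; lra.
have SK : S <= K0 * rho.
  have mg : nevanlinna_m g rho <= c * rho + e.
    rewrite (le_trans (nevanlinna_m_quotient ef eg fE rho1'))//.
    by rewrite -(nevanlinna_T_entire _ ef) Tf.
  rewrite /S /K0; have := ler_wpM2l e0 rho1'; have := ler_wpM2l L00 rho1'; nra.
exists r, a; split => //.
  apply: le_trans aS _; rewrite mulrAC ler_pdivrMr// -mulrA.
  by rewrite ler_pM2l.
move=> z zr; have z0 := cmod_ge0 z.
have zrho : cmod z <= rho / 2.
  by apply: le_trans zr _; rewrite ler_pdivlMr// rho_r ler_pM2l.
rewrite fE cmodM.
have zn : cmod (z ^+ n) <= expR (eps / 4 * r).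
  have := HD z; rewrite hornerXn => /le_trans; apply.
  rewrite -{1}(lnK (x := D)) ?posrE// -expRD ler_expR.
  have := ler_norm (ln D); have : eps / 8 * cmod z <= eps / 8 * r by rewrite ler_pM2l.
  lra.
apply: le_trans (ler_pM (cmod_ge0 _) (cmod_ge0 _) zn (Ha z zrho)) _.
rewrite -expRD ler_expR.
have A1 : 4 / rho ^+ 2 * S * cmod z ^+ 2 <= eps / 4 * r.
  have S1 : 4 / rho ^+ 2 * S <= 4 / rho ^+ 2 * (K0 * rho).
    by rewrite ler_wpM2l// divr_ge0// sqr_ge0.
  apply: le_trans (ler_wpM2r (sqr_ge0 _) S1) _.
  have z2 : cmod z ^+ 2 <= r ^+ 2.
    by apply: lerXn2r zr; rewrite nnegrE// ltW.
  have S2 : 0 <= 4 / rho ^+ 2 * (K0 * rho).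
    apply: mulr_ge0; first by rewrite divr_ge0// sqr_ge0.
    by apply: mulr_ge0 => //; exact: ltW.
  apply: le_trans (ler_wpM2l S2 z2) _.
  rewrite (_ : _ * r ^+ 2 = 4 * K0 / K * r); last first.
    by rewrite rho_r; field; rewrite !gt_eqF.
  rewrite ler_pM2r// ler_pdivrMr//; lra.
have A2 : nevanlinna_N (fun z => (f z)^-1) R1 <= eps / 4 * r.
  apply: le_trans NR _.
  have R2 : R1 <= 2 * (r * K) by rewrite -rho_r; lra.
  apply: le_trans (ler_wpM2l (ltW eps1) R2) _.
  by rewrite le_eqVlt; apply/orP; left; apply/eqP; field; rewrite gt_eqF.
have A3 : l0 <= eps / 4 * r by apply: le_trans (ler_norm _) _; rewrite mulrC.
move: A1 A2 A3 sigN; set x1 := 4 / _ * _ * _; set x2 := nevanlinna_N _ _.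
set x3 := complex.Re _; rewrite (_ : eps / 4 * r = eps * r / 4); last by ring.
lra.
Qed.

Lemma complex_bolzano_weierstrass (u : nat -> C) (D : R) : (forall n, cmod (u n) <= D) ->
  exists c, forall (eps : R) (N : nat), 0 < eps -> exists2 n, (N <= n)%N & cmod (u n - c) < eps.
Proof.
move=> uD.
have bnd (v : nat -> R) : (forall n, `|v n| <= D) -> bounded_fun v.
  move=> vD; exists D; split; first exact: num_real.
  by move=> x Dx n _; exact: le_trans (vD n) (ltW Dx).
have [|p1 p1i /cvg_ex[x1 cx1]] := @bolzano_weierstrass R (fun n => Re (u n)).
  by apply: bnd => n; exact: le_trans (Re_cmod _) (uD n).
have [|p2 p2i /cvg_ex[x2 cx2]] := @bolzano_weierstrass R (fun n => Im (u (p1 n))).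
  by apply: bnd => n; exact: le_trans (Im_cmod _) (uD _).
exists (x1 +i* x2) => eps N eps0.
have e2 : 0 < eps / 2 by rewrite divr_gt0.
have incr (p : nat -> nat) : increasing_seq p -> forall n, (n <= p n)%N.
  move=> pi; elim=> // n IH; apply: leq_ltn_trans IH _.
  by have := pi n.+1 n; rewrite !leEnat => H; rewrite ltnNge H -ltnNge.
move/cvgrPdist_lt: cx1 => /(_ _ e2)[N1 _ HN1].
move/cvgrPdist_lt: cx2 => /(_ _ e2)[N2 _ HN2].
pose n := maxn (maxn N1 N2) N.
have n1 : (N1 <= p2 n)%N by apply: leq_trans (incr p2 p2i n); rewrite !leq_max leqnn.
have n2 : (N2 <= n)%N by rewrite !leq_max leqnn orbT.
have n3 : (N <= p1 (p2 n))%N.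
  by apply: leq_trans (incr p1 p1i _); apply: leq_trans (incr p2 p2i n); rewrite leq_max leqnn orbT.
exists (p1 (p2 n)) => //; apply: le_lt_trans (cmod_ReIm _) _.
rewrite ReB ImB /= (splitr eps) ltrD// distrC.
  exact: (HN1 _ n1).
exact: (HN2 _ n2).
Qed.

(** Replacing the exponent a_n of scale r by a cluster point a of the sequence costs at most |a_n -
    a| r on the disc of radius r. *)
Theorem single_exponent f (c e : R) : entire f -> (exists b, f b != 0) ->
  0 <= c -> 0 <= e -> (forall z, cmod (f z) <= expR (c * cmod z + e)) ->
  is_S (nevanlinna_N (fun z => (f z)^-1)) f ->
  exists a : C, forall eps r0 : R, 0 < eps -> exists r : R,
    [/\ r0 <= r, 1 <= r &
      forall z, cmod z <= r -> cmod (f z) <= expR (Re (a * z) + eps * r)].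
Proof.
move=> ef fb c0 e0 fce fS.
have [D HD] := exponent_at_scale ef fb c0 e0 fce fS.
have H n : exists q : R * C, [/\ n%:R <= q.1, 1 <= q.1, cmod q.2 <= D &
    forall z, cmod z <= q.1 -> cmod (f z) <= expR (Re (q.2 * z) + n.+1%:R^-1 * q.1)].
  have [|r [a Hra]] := HD n.+1%:R^-1 n%:R; first by rewrite invr_gt0 ltr0Sn.
  by exists (r, a).
have [q Hq] := choice H.
have [|a Ha] := @complex_bolzano_weierstrass (fun n => (q n).2) D.
  by move=> n; case: (Hq n).
exists a => eps r0 eps0.
have e2 : 0 < eps / 2 by rewrite divr_gt0.
pose N := maxn (Num.truncn `|r0|).+1 (Num.truncn (eps / 2)^-1).+1.
have [n Nn na] := Ha _ N e2.
have [n1 r1 _ Hz] := Hq n.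
have nr0 : r0 <= n%:R.
  apply: le_trans (ler_norm _) _; apply: le_trans (ltW (truncnS_gt _)) _.
  by rewrite ler_nat (leq_trans _ Nn)// leq_max leqnn.
have ne : n.+1%:R^-1 <= eps / 2.
  rewrite -[leRHS]invrK lef_pV2 ?posrE ?invr_gt0 ?ltr0Sn//.
  apply: le_trans (ltW (truncnS_gt _)) _.
  by rewrite ler_nat (leq_trans _ (leqnSn n))// (leq_trans _ Nn)// leq_max leqnn orbT.
exists (q n).1; split => //; first exact: le_trans n1.
move=> z zr; apply: le_trans (Hz z zr) _; rewrite ler_expR.
have r0' : 0 <= (q n).1 by exact: le_trans r1.
have A : Re ((q n).2 * z) - Re (a * z) <= eps / 2 * (q n).1.
  rewrite -ReB -mulrBl; apply: le_trans (ler_norm _) _; apply: le_trans (Re_cmod _) _.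
  by rewrite cmodM ler_pM ?cmod_ge0// ltW.
have B := ler_wpM2r r0' ne.
move: A B; set x1 := complex.Re _; set x2 := complex.Re _; set x3 := _^-1 * _; lra.
Qed.

End SingleExponent.

(** * Comparison of exponents *)

Section ExponentAnalysis.
Context {R : realType}.
Local Notation C := R[i].
Local Notation Re := (@complex.Re R).
Local Notation Im := (@complex.Im R).
Implicit Types (f g h : C -> C) (r : R).

Lemma exp_decay (K eta y : R) : 0 < eta -> 0 < y ->
  exists T : R, forall t, T <= t -> K * expR (- (eta * t)) < y.
Proof.
move=> eta0 y0; exists (`|K| / (eta * y)) => t Tt.
rewrite expRN; apply: le_lt_trans (_ : `|K| / expR (eta * t) < _).
  by rewrite ler_wpM2r ?invr_ge0 ?expR_ge0// ler_norm.
rewrite ltr_pdivrMr ?expR_gt0//.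
have e1 := expR_ge1Dx (eta * t).
move: Tt; rewrite ler_pdivrMr ?mulr_gt0// => Tt.
have := ler_wpM2l (ltW y0) e1; nra.
Qed.

Lemma Re_mul_le (a z : C) : Re (a * z) <= cmod a * cmod z.
Proof. by rewrite -cmodM (le_trans (ler_norm _))// Re_cmod. Qed.

(** With b = |beta| + k, the bound for f on radius r' = r + b controls the derivative term on radius
    r. The shift costs |gamma| b and the polynomial ln D + eps |z| / 8; r >= b makes eps r' / 4 at
    most eps r / 2. *)
Lemma shifted_cderiv_at_scale f (a : {poly C}) (gamma beta : C) k : entire f ->
  (forall eps r0 : R, 0 < eps -> exists r : R, [/\ r0 <= r, 1 <= r &
    forall z, cmod z <= r -> cmod (f z) <= expR (Re (gamma * z) + eps * r)]) ->
  forall eps r0 : R, 0 < eps -> exists r : R, [/\ r0 <= r, 1 <= r &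
    forall z, cmod z <= r -> cmod (f z) <= expR (Re (gamma * z) + eps * r) /\
      cmod (a.[z] * cderiv k f (z + beta)) <= expR (Re (gamma * z) + eps * r)].
Proof.
move=> ef Hf eps r0 eps0; pose b := cmod beta + k%:R.
have b0 : 0 <= b by rewrite addr_ge0 ?cmod_ge0.
have e8 : 0 < eps / 8 by rewrite divr_gt0.
have [D D0 HD] := poly_le_exp a e8.
pose Q : R := `|ln D| + cmod gamma * b.
have e4 : 0 < eps / 4 by rewrite divr_gt0.
have Q0 : 0 <= Q by rewrite addr_ge0// mulr_ge0// cmod_ge0.
pose r1 := Num.max (Num.max r0 1) (Num.max b (Q / (eps / 8))).
have [r' [r'r _ Hr']] := Hf (eps / 4) (r1 + b) e4.
exists (r' - b); have rr1 : r1 <= r' - b by rewrite lerBrDr.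
move: (rr1); rewrite /r1 !ge_max => /andP[/andP[h1 h2] /andP[h3 h4]].
rewrite ler_pdivrMr// in h4.
split => // z zr.
have r'2 : eps / 4 * r' <= eps / 2 * (r' - b) by nra.
have zr' : cmod z <= r' by lra.
split.
  by apply: le_trans (Hr' z zr') _; rewrite ler_expR lerD2l; nra.
have Hk : cmod (cderiv k f (z + beta)) <=
    expR (Re (gamma * z) + cmod gamma * b + eps / 4 * r').
  apply: (cderiv_bound ef) => w wk.
  have wz : cmod (w - z) <= b.
    rewrite (_ : w - z = (w - (z + beta)) + beta); last by ring.
    by apply: le_trans (cmodD _ _) _; rewrite /b addrC lerD2l.
  have wr : cmod w <= r'.
    by rewrite -(subrK z w); apply: le_trans (cmodD _ _) _; lra.
  apply: le_trans (Hr' w wr) _; rewrite ler_expR lerD2r.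
  rewrite -(subrK z w) mulrDr ReD addrC lerD2l; apply: le_trans (Re_mul_le _ _) _.
  by rewrite ler_wpM2l ?cmod_ge0.
rewrite cmodM; apply: le_trans (ler_pM (cmod_ge0 _) (cmod_ge0 _) (HD z) Hk) _.
rewrite -{1}(lnK (x := D)) ?posrE// -!expRD ler_expR.
have := ler_norm (ln D); have : eps / 8 * cmod z <= eps / 8 * (r' - b) by rewrite ler_pM2l.
have : 0 <= eps * (r' - b) by rewrite mulr_ge0 ?ltW//; lra.
move: h4; rewrite /Q; lra.
Qed.

(** On the ray of z the term p1 exp(a1 t z) outgrows the other exponential, so u^2 or v has to match
    it; their exponents per unit of t are at most 2 Re(gamma z) and Re(gamma z). *)
Lemma dominant_direction (p1 p2 a1 a2 gamma z : C) (u v : C -> C) : p1 != 0 ->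
  (forall z, u z ^+ 2 + v z = p1 * cexp (a1 * z) + p2 * cexp (a2 * z)) ->
  (forall eps r0 : R, 0 < eps -> exists r : R, [/\ r0 <= r, 1 <= r &
    forall z, cmod z <= r -> cmod (u z) <= expR (Re (gamma * z) + eps * r) /\
      cmod (v z) <= expR (Re (gamma * z) + eps * r)]) ->
  Re (a2 * z) < Re (a1 * z) ->
  Re (a1 * z) <= Num.max (2 * Re (gamma * z)) (Re (gamma * z)).
Proof.
move=> p10 uv H a21; rewrite leNgt; apply/negP; set M := Num.max _ _ => Ma1.
have z0 : 0 < cmod z.
  by rewrite cmod_gt0; apply/eqP => z0; move: a21; rewrite z0 !mulr0 ltxx.
pose d := Re (a1 * z) - M; have d0 : 0 < d by rewrite subr_gt0.
pose d2 := Re (a1 * z) - Re (a2 * z); have d20 : 0 < d2 by rewrite subr_gt0.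
have dz : 0 < d / 2 by rewrite divr_gt0.
have p1p : 0 < cmod p1 / 2 by rewrite divr_gt0// cmod_gt0.
have [T1 HT1] := exp_decay (cmod p2) d20 p1p.
have [T2 HT2] := exp_decay 2 dz p1p.
(* Then eps r = d t / 4. Squaring u doubles it, which leaves a gap of d t / 2 in the exponent. *)
pose eps := d / (4 * cmod z); have eps0 : 0 < eps by rewrite divr_gt0// mulr_gt0.
have [r [rr r1 Hr]] := H eps (Num.max T1 T2 * cmod z) eps0.
pose t := r / cmod z; have t0 : 0 < t by rewrite divr_gt0//; lra.
have Tt : Num.max T1 T2 <= t by rewrite /t ler_pdivlMr.
move: Tt; rewrite ge_max => /andP[/HT1 A1 /HT2 A2].
have tz : cmod (t%:C * z) <= r by rewrite cmodZ gtr0_norm// /t divfK// gt_eqF.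
have [Hu Hv] := Hr _ tz.
have er : eps * r = d / 4 * t by rewrite /eps /t; field; rewrite gt_eqF.
have ReT (b : C) : Re (b * (t%:C * z)) = t * Re (b * z) by rewrite mulrCA ReZ.
have tM (x : R) : x <= M -> t * x <= t * M by rewrite ler_pM2l.
have Bu : cmod (u (t%:C * z) ^+ 2) <= expR (t * M + d / 2 * t).
  rewrite cmodX expr2; apply: le_trans (ler_pM (cmod_ge0 _) (cmod_ge0 _) Hu Hu) _.
  rewrite -expRD ler_expR er ReT.
  have := tM (2 * Re (gamma * z)); rewrite /M le_max lexx => /(_ isT); lra.
have Bv : cmod (v (t%:C * z)) <= expR (t * M + d / 2 * t).
  apply: le_trans Hv _; rewrite ler_expR er ReT.
  have := tM (Re (gamma * z)); rewrite /M le_max lexx orbT => /(_ isT).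
  have : 0 < d * t by rewrite mulr_gt0.
  lra.
have : cmod (p1 * cexp (a1 * (t%:C * z))) <= cmod (p2 * cexp (a2 * (t%:C * z)))
    + 2 * expR (t * M + d / 2 * t).
  rewrite (_ : p1 * _ = u (t%:C * z) ^+ 2 + v (t%:C * z) - p2 * cexp (a2 * (t%:C * z))).
    apply: le_trans (cmodB _ _) _; rewrite addrC lerD2l.
    by apply: le_trans (cmodD _ _) _; lra.
  by rewrite uv addrK.
rewrite !cmodM !cmod_cexp !ReT.
have -> : t * Re (a2 * z) = t * Re (a1 * z) - d2 * t by rewrite /d2; ring.
have -> : t * M + d / 2 * t = t * Re (a1 * z) - d / 2 * t by rewrite /d; field.
rewrite !expRD; set E := expR (t * Re (a1 * z)); have E0 : 0 < E by exact: expR_gt0.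
apply/negP; rewrite -ltNge.
rewrite (_ : _ + _ = (cmod p2 * expR (- (d2 * t)) + 2 * expR (- (d / 2 * t))) * E); last by ring.
by rewrite ltr_pM2r//; lra.
Qed.

(** In the coordinates s = a1 / gamma and t = a2 / gamma, the hypotheses bound the linear form of
    whichever point dominates by max(2 x, x). The directions (0, 1) and (0, -1) give equal imaginary
    parts, and (1, y) and (-1, y) for all y give the rest. *)
Lemma exponents_in_segment (a1 a2 gamma : C) : a1 != a2 ->
  (forall z, Re (a2 * z) < Re (a1 * z) ->
    Re (a1 * z) <= Num.max (2 * Re (gamma * z)) (Re (gamma * z))) ->
  (forall z, Re (a1 * z) < Re (a2 * z) ->
    Re (a2 * z) <= Num.max (2 * Re (gamma * z)) (Re (gamma * z))) ->
  gamma != 0 /\ exists s t : R, [/\ a1 = s%:C * gamma, a2 = t%:C * gamma,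
    1 <= s <= 2, 1 <= t <= 2 & s != t].
Proof.
move=> a12 H1 H2.
have g0 : gamma != 0.
  apply/eqP => g0; pose z := conjc (a1 - a2).
  have dz : 0 < Re (a1 * z) - Re (a2 * z).
    by rewrite -ReB -mulrBl mulcJ /= exprn_gt0// cmod_gt0 subr_eq0.
  have := H1 z; rewrite g0 mul0r /= mulr0 maxxx -subr_gt0 => /(_ dz) h1.
  have := H2 (- z); rewrite g0 mul0r /= mulr0 maxxx !mulrN !ReN ltrN2 -subr_gt0.
  by move=> /(_ dz) h2; move: dz h1 h2; clear; lra.
split => //; pose s := a1 / gamma; pose t := a2 / gamma.
have sE : a1 = s * gamma by rewrite /s divfK.
have tE : a2 = t * gamma by rewrite /t divfK.
have st : s != t by apply/eqP => st; move/eqP: a12; rewrite sE tE st.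
have dir (a b : C) : (forall z, Re (b * gamma * z) < Re (a * gamma * z) ->
    Re (a * gamma * z) <= Num.max (2 * Re (gamma * z)) (Re (gamma * z))) ->
  forall x y : R, Re b * x + Im b * y < Re a * x + Im a * y ->
    Re a * x + Im a * y <= Num.max (2 * x) x.
  move=> H x y.
  (* The point z = (x - i y) / gamma realises the direction (x, y). *)
  have E (c : C) : Re (c * gamma * ((x +i* (- y)) / gamma)) = Re c * x + Im c * y.
    rewrite mulrA mulrAC mulfK// ReM /=; ring.
  have Eg : Re (gamma * ((x +i* (- y)) / gamma)) = x by rewrite mulrCA mulfV// mulr1.
  by have := H ((x +i* (- y)) / gamma); rewrite !E Eg.
have D1 : forall x y : R, Re t * x + Im t * y < Re s * x + Im s * y ->
    Re s * x + Im s * y <= Num.max (2 * x) x by apply: dir; rewrite -sE -tE.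
have D2 : forall x y : R, Re s * x + Im s * y < Re t * x + Im t * y ->
    Re t * x + Im t * y <= Num.max (2 * x) x by apply: dir; rewrite -sE -tE.
have Im_eq (a b : C) : (forall x y : R, Re b * x + Im b * y < Re a * x + Im a * y ->
      Re a * x + Im a * y <= Num.max (2 * x) x) ->
    (forall x y : R, Re a * x + Im a * y < Re b * x + Im b * y ->
      Re b * x + Im b * y <= Num.max (2 * x) x) -> Im a <= Im b.
  move=> Da Db; rewrite leNgt; apply/negP => ab.
  have := Da 0 1; rewrite !mulr0 !add0r !mulr1 maxxx => /(_ ab) h1.
  have := Db 0 (-1); rewrite !mulr0 !add0r !mulrN1 maxxx ltrN2 => /(_ ab) h2.
  by move: ab h1 h2; clear; lra.
have Ist : Im s = Im t.
  by apply/eqP; rewrite eq_le (Im_eq _ _ D1 D2) (Im_eq _ _ D2 D1).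
have main (a b : C) : Im a = Im b -> Re b < Re a ->
    (forall x y : R, Re b * x + Im b * y < Re a * x + Im a * y ->
      Re a * x + Im a * y <= Num.max (2 * x) x) ->
    (forall x y : R, Re a * x + Im a * y < Re b * x + Im b * y ->
      Re b * x + Im b * y <= Num.max (2 * x) x) ->
    [/\ Im a = 0, 1 <= Re b & Re a <= 2].
  clear sE tE => Iab ba Da Db.
  (* P bounds an affine function of y from above on the whole line, so its slope Im a is 0; y = 0 in
     P and N then gives the two bounds. *)
  have P y : Re a + Im a * y <= 2.
    have := Da 1 y; rewrite !mulr1 Iab ltrD2r => /(_ ba).
    by rewrite max_l//; lra.
  have N y : - Re b + Im b * y <= -1.
    have := Db (-1) y; rewrite !mulrN1 Iab ltrD2r ltrN2 => /(_ ba).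
    by rewrite max_r//; lra.
  have I0 : Im a = 0.
    apply/eqP/negP => /negP Ia; have := P ((3 - Re a) / Im a).
    by rewrite mulrC divfK//; lra.
  split => //; first by have := N 0; lra.
  by have := P 0; lra.
have realE (a : C) : Im a = 0 -> a = (Re a)%:C by case: a => x y /= ->.
have [lt_ts|lt_st|/eqP eq_st] := ltgtP (Re t) (Re s).
- have [I0 t1 s2] := main s t Ist lt_ts D1 D2.
  exists (Re s), (Re t); rewrite -(realE s I0) -(realE t); last by rewrite -Ist.
  by split=> //; rewrite ?s2 ?t1 ?gt_eqF// ?andbT ?(le_trans t1 (ltW lt_ts))//
    (le_trans (ltW lt_ts)).
- have [I0 s1 t2] := main t s (esym Ist) lt_st D2 D1.
  exists (Re s), (Re t); rewrite -(realE t I0) -(realE s); last by rewrite Ist.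
  by split=> //; rewrite ?t2 ?s1 ?lt_eqF// ?andbT ?(le_trans s1 (ltW lt_st))//
    (le_trans (ltW lt_st)).
- by move/eqP: st; case; apply/eqP; rewrite eq_complex eq_sym eq_st Ist eqxx.
Qed.

(* Every z has a rotation by a power of i in the region of exponential decay, so
   the product of the four rotates of h, divided by powers of z, tends to 0. *)
Lemma rotation_zero h (gamma : C) (d : R) : entire h -> 0 < d ->
  (forall eps r0 : R, 0 < eps -> exists r : R, [/\ r0 <= r, 1 <= r,
    forall z, cmod z <= r -> cmod (h z) <= expR (eps * r) &
    forall z, cmod z <= r -> cmod gamma * r / 2 <= Re (gamma * z) ->
      cmod (h z) <= expR (- (d * r))]) ->
  forall z, h z = 0.
Proof.
move=> eh d0 H b; apply/eqP; apply/negP => /negP hb.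
(* Dividing out the zero at the origin makes U(0) = g(0)^4 nonzero, to be contradicted by smallness
   on a circle. *)
have [n [g [eg gn0 hE]]] := entire_order0 eh hb.
pose I : C := 'i%C; have I2 : I * I = -1 by rewrite -expr2 sqr_i.
have cI : cmod I = 1 by rewrite /cmod /= expr0n expr1n add0r sqrtr1.
pose U z := g z * g (I * z) * (g (-1 * z) * g (- I * z)).
have eU : entire U.
  apply: entireM; apply: entireM.
  - exact: eg.
  - exact: entire_comp (entireZ I) eg.
  - exact: entire_comp (entireZ (-1)) eg.
  - exact: entire_comp (entireZ (- I)) eg.
have U0 : U 0 = g 0 ^+ 4 by rewrite /U !mulr0; ring.
have g0p : 0 < cmod (g 0) ^+ 4 by rewrite exprn_gt0// cmod_gt0.
have d2 : 0 < d / 2 by rewrite divr_gt0.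
have [T HT] := exp_decay 2 d2 g0p.
(* Three factors of size exp(d r / 6) against one of size exp(-d r) give exp(-d r / 2). *)
have [|r [Tr r1 h1 h2]] := H (d / 6) T; first by rewrite divr_gt0.
have r0 : 0 < r by lra.
have gh z : cmod z = r -> cmod (g z) <= cmod (h z).
  by move=> zr; rewrite hE cmodM cmodX zr ler_peMl ?cmod_ge0// exprn_ege1.
have gs z : cmod z = r -> cmod (g z) <= expR (d / 6 * r).
  by move=> zr; apply: le_trans (gh z zr) (h1 z _); rewrite zr.
have gd z : cmod z = r -> cmod gamma * r / 2 <= Re (gamma * z) ->
    cmod (g z) <= expR (- (d * r)).
  by move=> zr zg; apply: le_trans (gh z zr) (h2 z _ zg); rewrite zr.
have Ubound t : 0 <= t <= 2 * pi -> cmod (U (circle_pt r t)) <= expR (- (d / 2 * r)).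
  move=> _; set z := circle_pt r t; have zr : cmod z = r by rewrite cmod_circle gtr0_norm.
  have z1 : cmod (I * z) = r by rewrite cmodM cI mul1r.
  have z2 : cmod (-1 * z) = r by rewrite cmodM cmodN cmod1 mul1r.
  have z3 : cmod (- I * z) = r by rewrite cmodM cmodN cI mul1r.
  pose P := expR (d / 6 * r); pose Q := expR (- (d * r)).
  have P0 : 0 <= P by exact: expR_ge0.
  have Q0 : 0 <= Q by exact: expR_ge0.
  have PQ : P * P * (P * Q) = expR (- (d / 2 * r)).
    by rewrite /P /Q -!expRD; congr expR; field.
  rewrite /U !cmodM -PQ.
  have [x0 x1 x2 x3] : [/\ cmod (g z) <= P, cmod (g (I * z)) <= P,
      cmod (g (-1 * z)) <= P & cmod (g (- I * z)) <= P] by split; exact: gs.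
  have ReI : Re (gamma * (I * z)) = - Im (gamma * z).
    by rewrite (mulrCA gamma) mulrC /I ReiNIm.
  have Re1 : Re (gamma * (-1 * z)) = - Re (gamma * z).
    by rewrite mulN1r mulrN ReN.
  have ReNI : Re (gamma * (- I * z)) = Im (gamma * z).
    by rewrite mulNr mulrN ReN ReI opprK.
  (* Hence one of Re(gamma z), -Im(gamma z), -Re(gamma z), Im(gamma z), the values at the four
     rotates, is at least |gamma| r / 2. On the circle this is a sector of opening 2 pi / 3. *)
  have gz : cmod gamma * r <= `|Re (gamma * z)| + `|Im (gamma * z)|.
    by rewrite -zr -cmodM cmod_ReIm.
  have c0 := cmod_ge0 (g z); have c1 := cmod_ge0 (g (I * z)).
  have c2 := cmod_ge0 (g (-1 * z)); have c3 := cmod_ge0 (g (- I * z)).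
  have [k0|k0] := leP (cmod gamma * r / 2) (Re (gamma * z)).
    have y := gd z zr k0.
    rewrite (_ : P * P * _ = Q * P * (P * P)); last by ring.
    by rewrite !ler_pM ?mulr_ge0.
  have [k1|k1] := leP (cmod gamma * r / 2) (- Im (gamma * z)).
    have y := gd _ z1; rewrite ReI in y; have {}y := y k1.
    rewrite (_ : P * P * _ = P * Q * (P * P)); last by ring.
    by rewrite !ler_pM ?mulr_ge0.
  have [k2|k2] := leP (cmod gamma * r / 2) (- Re (gamma * z)).
    have y := gd _ z2; rewrite Re1 in y; have {}y := y k2.
    rewrite (_ : P * P * _ = P * P * (Q * P)); last by ring.
    by rewrite !ler_pM ?mulr_ge0.
  have [k3|k3] := leP (cmod gamma * r / 2) (Im (gamma * z)).
    have y := gd _ z3; rewrite ReNI in y; have {}y := y k3.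
    by rewrite !ler_pM ?mulr_ge0.
  exfalso; have n1 : `|Re (gamma * z)| < cmod gamma * r / 2.
    by rewrite ltr_norml k0 andbT ltrNl.
  have n2 : `|Im (gamma * z)| < cmod gamma * r / 2.
    by rewrite ltr_norml k3 andbT ltrNl.
  lra.
have r2 : cmod (0 : C) <= r / 2 by rewrite cmod0 divr_ge0// ltW.
have := holomorphic_bound (entire_on_disc (r := r) eU) r0 r2 Ubound.
rewrite U0 cmodX; apply/negP; rewrite -ltNge; exact: HT.
Qed.

End ExponentAnalysis.

(** * Identification of f and of the coefficient a *)

Section Conclusion.
Context {R : realType}.
Local Notation C := R[i].
Local Notation Re := (@complex.Re R).
Implicit Types (f g h : C -> C) (r : R).

Lemma dominant_square (p1 p2 a1 a2 gamma : C) (s t : R) f (v : C -> C) :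
  entire f -> (exists b, f b != 0) ->
  (forall z, f z ^+ 2 + v z = p1 * cexp (a1 * z) + p2 * cexp (a2 * z)) ->
  (forall eps r0 : R, 0 < eps -> exists r : R, [/\ r0 <= r, 1 <= r &
    forall z, cmod z <= r -> cmod (f z) <= expR (Re (gamma * z) + eps * r) /\
      cmod (v z) <= expR (Re (gamma * z) + eps * r)]) ->
  gamma != 0 -> a1 = s%:C * gamma -> a2 = t%:C * gamma -> t < s -> s <= 2 ->
  s = 2 /\ forall z, f z ^+ 2 = p1 * cexp (a1 * z).
Proof.
move=> ef [b fb] f_eq H g0 a1E a2E ts s2.
(* h is e^(o(r)), as |f|^2 <= e^(2 Re(gamma z) + o(r)), and the equation makes it
   exponentially small where Re(gamma z) is large. *)
pose q := if s == 2 then p1 else 0.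
pose h z := (f z ^+ 2 - q * cexp (a1 * z)) * cexp (- (2%:C * gamma) * z).
have eh : entire h.
  apply: entireM; last exact: entire_cexpZ.
  apply: entireB; first exact: entireX.
  by apply: entireM; [exact: entire_cst|exact: entire_cexpZ].
(* The least decay rate, per unit of Re(gamma z), among the terms of h: 1 for v, 2 - t for the p2
   term, and 2 - s for the p1 term if it has not been subtracted. *)
pose m := Num.min (Num.min 1 (2 - t)) (if s == 2 then 1 else 2 - s).
have m0 : 0 < m.
  rewrite !lt_min ltr01/= subr_gt0 (lt_le_trans ts s2)/=.
  by case: eqVneq => [_|s2']; rewrite ?ltr01// subr_gt0 lt_neqAle s2'.
have m1 : m <= 1 by rewrite !ge_min lexx.
have mt : m <= 2 - t by rewrite !ge_min lexx orbT.
have ms : s != 2 -> m <= 2 - s by move=> /negPf s2'; rewrite /m s2' ge_min lexx orbT.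
have gp : 0 < cmod gamma by rewrite cmod_gt0.
pose d0 := cmod gamma / 2 * m; have d00 : 0 < d0 by rewrite mulr_gt0// divr_gt0.
pose K := cmod p1 + cmod p2 + 1; have K1 : 1 <= K by rewrite lerDr addr_ge0 ?cmod_ge0.
have qp : cmod q <= cmod p1.
  by rewrite /q; case: ifP => _ //; rewrite cmod0 cmod_ge0.
have h0 z : h z = 0.
  move: z; apply: (rotation_zero (gamma := gamma) (d := d0 / 2) eh) => [|eps r0 eps0].
    by rewrite divr_gt0.
  (* f^2 uses e' twice, which leaves eps / 2 for the constant K. In the sector, d0 / 4 for e' and d0
     / 4 for K leave the decay d0 / 2. *)
  pose e' := Num.min (eps / 4) (d0 / 4).
  have e'0 : 0 < e' by rewrite lt_min !divr_gt0.
  have e'1 : e' <= eps / 4 by rewrite ge_min lexx.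
  have e'2 : e' <= d0 / 4 by rewrite ge_min lexx orbT.
  have [r [rr r1 Hr]] := H e' (Num.max r0 (Num.max (ln K / (eps / 2)) (ln K / (d0 / 4)))) e'0.
  move: rr; rewrite !ge_max => /and3P[r0r rK1 rK2].
  rewrite ler_pdivrMr ?divr_gt0// in rK1; rewrite ler_pdivrMr ?divr_gt0// in rK2.
  have r0' : 0 < r by exact: lt_le_trans r1.
  have KE : expR (ln K) = K by rewrite lnK// posrE (lt_le_trans ltr01).
  have K1' : K <= expR (r * (eps / 2)) by rewrite -[leLHS]KE ler_expR.
  have K2' : K <= expR (r * (d0 / 4)) by rewrite -[leLHS]KE ler_expR.
  have cg z : cmod (cexp (- (2%:C * gamma) * z)) = expR (- (2 * Re (gamma * z))).
    by rewrite cmod_cexp mulNr ReN -mulrA ReZ.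
  have ca (x : R) (w z : C) : w = x%:C * gamma ->
      cmod (cexp (w * z)) = expR (x * Re (gamma * z)).
    by move=> ->; rewrite cmod_cexp -mulrA ReZ.
  exists r; split => // z zr; have [fz vz] := Hr z zr.
  - rewrite /h mulrBl; apply: le_trans (cmodB _ _) _; rewrite !cmodM cg.
    set x := Re (gamma * z) in fz *.
    have F1 : cmod (f z) ^+ 2 * expR (- (2 * x)) <= expR (r * (eps / 2)).
      have f2 : cmod (f z) ^+ 2 <= expR (x + e' * r) ^+ 2.
        by apply: lerXn2r fz; rewrite nnegrE ?cmod_ge0 ?expR_ge0.
      apply: le_trans (ler_wpM2r (expR_ge0 _) f2) _.
      rewrite expr2 -!expRD ler_expR; have := ler_wpM2r (ltW r0') e'1; lra.
    have F2 : cmod q * cmod (cexp (a1 * z)) * expR (- (2 * x)) <= cmod p1.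
      rewrite /q; case: eqVneq => [sE|_]; last by rewrite cmod0 !mul0r cmod_ge0.
      by rewrite (ca _ _ _ a1E) -/x sE -mulrA -expRD subrr expR0 mulr1.
    rewrite -expr2; apply: le_trans (lerD F1 F2) _.
    apply: le_trans (_ : expR (r * (eps / 2)) * expR (r * (eps / 2)) <= _); last first.
      by rewrite -expRD ler_expR; lra.
    have E1 : 1 <= expR (r * (eps / 2)) by exact: le_trans K1 K1'.
    apply: le_trans (_ : K * expR (r * (eps / 2)) <= _); last first.
      by rewrite ler_wpM2r ?expR_ge0.
    have := ler_wpM2l (cmod_ge0 p1) E1; have := ler_wpM2l (cmod_ge0 p2) E1.
    have := cmod_ge0 p2; rewrite /K; lra.
  - set x := Re (gamma * z) in fz vz *; move=> zx.
    have x0 : 0 <= x by apply: le_trans zx; rewrite divr_ge0// mulr_ge0// ltW.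
    have d0x : d0 * r <= m * x.
      rewrite /d0 (_ : _ * m * r = m * (cmod gamma * r / 2)); last by field.
      by rewrite ler_pM2l.
    have decay (y : R) : m <= y -> - (y * x) <= - (d0 * r).
      by move=> my; rewrite lerN2 (le_trans d0x)// ler_wpM2r.
    pose E := expR (- (d0 * r) + d0 / 4 * r).
    have EK : K * E <= expR (- (d0 / 2 * r)).
      apply: le_trans (ler_wpM2r (expR_ge0 _) K2') _.
      by rewrite /E -expRD ler_expR; lra.
    have dr : 0 <= d0 / 4 * r by rewrite mulr_ge0 ?divr_ge0// ltW.
    have -> : h z = (p1 - q) * cexp (a1 * z) * cexp (- (2%:C * gamma) * z)
        + p2 * cexp (a2 * z) * cexp (- (2%:C * gamma) * z)
        - v z * cexp (- (2%:C * gamma) * z).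
      have fzE : f z ^+ 2 = p1 * cexp (a1 * z) + p2 * cexp (a2 * z) - v z.
        by rewrite -f_eq addrK.
      by rewrite /h fzE; ring.
    have G1 : cmod ((p1 - q) * cexp (a1 * z) * cexp (- (2%:C * gamma) * z)) <= cmod p1 * E.
      rewrite /q; case: eqVneq => [_|sn2].
        by rewrite subrr !mul0r cmod0 mulr_ge0 ?cmod_ge0 ?expR_ge0.
      rewrite subr0 !cmodM cg (ca _ _ _ a1E) -/x -mulrA -expRD ler_wpM2l ?cmod_ge0//.
      by rewrite ler_expR; have := decay _ (ms sn2); lra.
    have G2 : cmod (p2 * cexp (a2 * z) * cexp (- (2%:C * gamma) * z)) <= cmod p2 * E.
      rewrite !cmodM cg (ca _ _ _ a2E) -/x -mulrA -expRD ler_wpM2l ?cmod_ge0//.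
      by rewrite ler_expR; have := decay _ mt; lra.
    have G3 : cmod (v z * cexp (- (2%:C * gamma) * z)) <= E.
      rewrite cmodM cg -/x; apply: le_trans (ler_wpM2r (expR_ge0 _) vz) _.
      rewrite -expRD ler_expR; have := decay _ m1; have := ler_wpM2r (ltW r0') e'2; lra.
    apply: le_trans EK; apply: le_trans (cmodB _ _) _.
    apply: le_trans (lerD (cmodD _ _) (lexx _)) _.
    by apply: le_trans (lerD (lerD G1 G2) G3) _; rewrite /K; lra.
have f2 z : f z ^+ 2 = q * cexp (a1 * z).
  have := h0 z; rewrite /h => /eqP; rewrite mulf_eq0 (negPf (cexp_neq0 _)) orbF.
  by rewrite subr_eq0 => /eqP.
have [sE|sn2] := eqVneq s 2.
  by split => // z; rewrite f2 /q sE eqxx.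
have := f2 b; rewrite /q (negPf sn2) mul0r => /eqP; rewrite expf_eq0/=.
by move=> /eqP fb0; move: fb; rewrite fb0 eqxx.
Qed.

(** h = f exp(-gamma z) has the constant square p <> 0, so 2 h h' = 0 and h' = 0; no continuous
    choice of a square root is involved. *)
Lemma square_cexp f (p gamma : C) : entire f -> p != 0 ->
  (forall z, f z ^+ 2 = p * cexp (2%:C * gamma * z)) ->
  exists c, c ^+ 2 = p /\ forall z, f z = c * cexp (gamma * z).
Proof.
move=> ef p0 f2; pose h z := f z * cexp (- gamma * z).
have h2 z : h z ^+ 2 = p.
  rewrite /h exprMn f2 cexpX -(mulrA p) -cexpD.
  rewrite (_ : _ + _ = 0) ?cexp0 ?mulr1//.
  by rewrite (rmorph_nat (real_complex R)); ring.
have hn0 z : h z != 0.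
  by apply/eqP => hz; move: p0; rewrite -(h2 z) hz expr0n eqxx.
have eh : entire h by apply: entireM; [exact: ef|exact: entire_cexpZ].
have dh (z : C) : is_derive z 1 h 0.
  have d1 := derivable_is_derive (eh z).
  have d2 := cderiveM d1 d1.
  have d3 : is_derive z 1 (fun w => h w * h w) 0.
    by apply: eq_cderive (cderive_cst p z) => w; rewrite -expr2 h2.
  have E : derive1 h z * h z + h z * derive1 h z = 0.
    by rewrite -(is_derive_derive1 d2) (is_derive_derive1 d3).
  suff E0 : derive1 h z = 0 by rewrite -E0.
  have two0 : (2 : C) != 0 by rewrite pnatr_eq0.
  apply: (mulfI (hn0 z)); apply: (mulfI two0); rewrite !mulr0 -E; ring.
exists (h 0); split => // z.
have <- : h z = h 0.
  apply: (derive_eq0_cst (r := cmod z + 1) (fun w _ => dh w)).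
  by rewrite ltrDl.
by rewrite /h -mulrA -cexpD mulNr addNr cexp0 mulr1.
Qed.

Lemma cderiv_cexp f (c gamma : C) k : (forall z, f z = c * cexp (gamma * z)) ->
  forall z, cderiv k f z = c * gamma ^+ k * cexp (gamma * z).
Proof.
move=> fE; elim: k => [|k IH] z; first by rewrite /cderiv derive1n0 fE expr0 mulr1.
rewrite /cderiv derive1nS; apply: is_derive_derive1.
have d := cderiveM (cderive_cst (c * gamma ^+ k) z) (is_derive_cexpZ gamma z).
rewrite mul0r add0r mulrA -(mulrA c) -exprSr in d.
by apply: eq_cderive d => w; rewrite -IH.
Qed.

Lemma poly_eq_cst (a : {poly C}) (A : C) : (forall z, a.[z] = A) -> a = A%:P.
Proof.
move=> aA; apply/eqP; rewrite -subr_eq0; apply/eqP.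
pose s := [seq n%:R : C | n <- iota 0 (size (a - A%:P))].
apply: (roots_geq_poly_eq0 (rs := s)).
- by apply/allP => x _; rewrite rootE !hornerE aA subrr.
- rewrite map_inj_uniq ?iota_uniq// => i j /eqP.
  by rewrite eqr_nat => /eqP.
- by rewrite size_map size_iota.
Qed.

(** If mu <> 0, then at z = x / mu the right side has modulus |A| exp(x), while the polynomial is at
    most D exp(x / 2). *)
Lemma poly_eq_cexp (a : {poly C}) (A mu : C) : A != 0 ->
  (forall z, a.[z] = A * cexp (mu * z)) -> mu = 0 /\ a = A%:P.
Proof.
move=> A0 aE; suff mu0 : mu = 0.
  by split => //; apply: poly_eq_cst => z; rewrite aE mu0 mul0r cexp0 mulr1.
apply/eqP/negP => /negP mu0; have mup : 0 < cmod mu by rewrite cmod_gt0.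
have mu2 : 0 < cmod mu / 2 by rewrite divr_gt0.
have [D D0 HD] := poly_le_exp a mu2.
have Ap : 0 < cmod A by rewrite cmod_gt0.
have h2 : 0 < 1 / 2 :> R by rewrite divr_gt0.
have [T HT] := exp_decay D h2 Ap.
pose x := Num.max T 0; have x0 : 0 <= x by rewrite le_max lexx orbT.
have Tx : T <= x by rewrite le_max lexx.
have := HD (x%:C / mu); rewrite aE cmodM cmod_cexp mulrCA mulfV// mulr1 /=.
rewrite cmodM cmodV cmod_real ger0_norm//.
have -> : cmod mu / 2 * (x / cmod mu) = x - 1 / 2 * x by field; rewrite gt_eqF.
rewrite expRD (mulrCA D) [leLHS]mulrC ler_pM2l ?expR_gt0//.
by rewrite leNgt HT.
Qed.

(** T(r, f) lies between two increasing affine functions of r, so log T / log r tends to 1. *)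
Lemma growth_order_cexp f (c gamma : C) : c != 0 -> gamma != 0 ->
  (forall z, f z = c * cexp (gamma * z)) -> growth_order f = 1%E.
Proof.
move=> c0 g0 fE; have ef : entire f.
  apply: eq_entire (entireM (@entire_cst R c) (@entire_cexpZ R gamma)) => z.
  by rewrite fE.
have gp : 0 < cmod gamma by rewrite cmod_gt0.
have cp : 0 < cmod c by rewrite cmod_gt0.
pose G := cmod gamma; pose l := `|ln (cmod c)|.
have l0 : 0 <= l by exact: normr_ge0.
have up r : 0 <= r -> nevanlinna_T f r <= G * r + l.
  move=> r0; rewrite nevanlinna_T_entire//; apply: (nevanlinna_m_le ef r0).
    by apply: addr_ge0; [apply: mulr_ge0 => //; exact: ltW|exact: normr_ge0].
  move=> z zr; rewrite fE cmodM cmod_cexp -{1}(lnK (x := cmod c)) ?posrE// -expRD ler_expR.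
  by rewrite addrC lerD ?ler_norm// -zr Re_mul_le.
have low r : 0 < r -> G / 4 * r - l <= nevanlinna_T f r.
  move=> r0; rewrite nevanlinna_T_entire// nevanlinna_m_circle.
  (* log+|f| >= (v + |v|) / 2 - l, and |v| >= v^2 / (G r), which is a trigonometric
     polynomial with mean G r / 2. *)
  pose v t := Re (gamma * circle_pt r t).
  have cgz : circle_continuous (fun t => gamma * circle_pt r t).
    by apply: within_continuousM; [exact: within_continuous_cst|exact: circle_pt_continuous].
  have cv : {within `[0, 2 * pi], continuous v} by exact: within_continuous_Re cgz.
  have cl := within_continuous_logp (holomorphic_circle_continuous (entire_on_disc (r := r) ef) (ltW r0)).
  have mean0 (p : C -> C) : entire p -> p 0 = 0 ->
      circle_rmean (fun t => Re (p (circle_pt r t))) = 0.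
    move=> ep p0; rewrite -Re_circle_mean.
    by rewrite -(holomorphic_mean_value (entire_on_disc (r := r) ep) r0) p0.
  have v0 : circle_rmean v = 0.
    by apply: (mean0 (fun z => gamma * z)); [exact: entireZ|rewrite mulr0].
  pose w t := Re ((gamma * circle_pt r t) ^+ 2).
  have cw : {within `[0, 2 * pi], continuous w}.
    by have c2 := within_continuousM cgz cgz; exact: within_continuous_Re c2.
  have w0 : circle_rmean w = 0.
    apply: (mean0 (fun z => (gamma * z) ^+ 2)); last by rewrite mulr0 expr0n.
    by apply: entireX; exact: entireZ.
  have Gr : 0 < G * r by rewrite mulr_gt0.
  (* For this k, k w = v^2 / (2 G r) - G r / 4, and the first term is at most |v| / 2. *)
  pose k := (4 * (G * r))^-1; have k0 : 0 < k by rewrite invr_gt0 mulr_gt0.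
  have ccst (x : R) : {within `[0, 2 * pi], continuous (fun _ : R => x)}.
    exact: (@rwithin_continuous_cst R _ x).
  have c1 : {within `[0, 2 * pi], continuous (fun t => 1 / 2 * v t)}.
    exact: rwithin_continuousM (ccst _) cv.
  have c2 : {within `[0, 2 * pi], continuous (fun t => k * w t)}.
    exact: rwithin_continuousM (ccst _) cw.
  have c3 := rwithin_continuousD (ccst (G / 4 * r - l)) (rwithin_continuousD c1 c2).
  have -> : G / 4 * r - l = circle_rmean (fun t => (G / 4 * r - l) + (1 / 2 * v t + k * w t)).
    rewrite (circle_rmeanD (ccst _) (rwithin_continuousD c1 c2)) (circle_rmeanD c1 c2).
    by rewrite (circle_rmeanZ _ cv) (circle_rmeanZ _ cw) v0 w0 !mulr0 !addr0 circle_rmean_cst.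
  apply: (le_circle_rmean c3 cl) => t _.
  have lf : ln (cmod (f (circle_pt r t))) = ln (cmod c) + v t.
    by rewrite fE cmodM cmod_cexp lnM ?posrE ?expR_gt0// expRK.
  have l1 := ln_le_logp (cmod (f (circle_pt r t))).
  have l2 := logp_ge0 (cmod (f (circle_pt r t))).
  have zr : cmod (gamma * circle_pt r t) = G * r.
    by rewrite cmodM cmod_circle gtr0_norm.
  have vG : `|v t| <= G * r by rewrite -zr Re_cmod.
  have wE : w t = 2 * v t ^+ 2 - (G * r) ^+ 2.
    rewrite -zr sqr_cmod /w /v; case: (gamma * _) => x y /=.
    by rewrite expr2; ring.
  have kE : k * (4 * (G * r)) = 1 by rewrite /k mulVf// gt_eqF// mulr_gt0.
  have kw : k * w t <= 1 / 2 * `|v t| - G / 4 * r.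
    have vv : v t ^+ 2 <= `|v t| * (G * r).
      by rewrite -real_normK ?num_real// expr2 ler_wpM2l.
    have kv := ler_wpM2l (ltW k0) vv.
    rewrite wE (mulrAC G); set X := G * r in Gr kE vv kv *; set V := `|v t| in vv kv *.
    clearbody V X k; clear -kv kE.
    have e1 : k * (V * X) = V / 4.
      have -> : V / 4 = V / 4 * (k * (4 * X)) by rewrite kE mulr1.
      by field.
    have e2 : k * X ^+ 2 = X / 4.
      have -> : X / 4 = X / 4 * (k * (4 * X)) by rewrite kE mulr1.
      by field.
    rewrite mulrBr e2; move: kv; rewrite e1; clear; lra.
  have nl : - ln (cmod c) <= l by rewrite /l -normrN ler_norm.
  move: l1; rewrite lf; have [v0'|v0'] := ltP (v t) 0.
    by rewrite ltr0_norm// in kw; lra.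
  by rewrite ger0_norm// in kw; lra.
have bounds (e : R) : 0 < e -> exists M : R, forall r, M < r ->
    1 - e <= logp (nevanlinna_T f r) / ln r <= 1 + e.
  move=> e0; pose B := `|ln (G + l)| + `|ln (G / 8)|.
  exists (Num.max (Num.max 1 (8 * l / G)) (expR (B / e))) => r.
  rewrite !gt_max => /andP[/andP[r1 rl] rB].
  have r0 : 0 < r by exact: lt_trans r1.
  have lr : 0 < ln r by rewrite ln_gt0.
  have Be : B < e * ln r.
    by rewrite mulrC -ltr_pdivrMr// -ltr_expR lnK ?posrE.
  have T1 : nevanlinna_T f r <= (G + l) * r.
    by apply: le_trans (up r (ltW r0)) _; rewrite mulrDl lerD2l ler_peMr// ltW.
  have T2 : G / 8 * r <= nevanlinna_T f r.
    apply: le_trans (low r r0); move: rl; rewrite ltr_pdivrMr// => rl.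
    rewrite -/G in rl; lra.
  have Gl : 0 < G + l by rewrite ltr_pwDl.
  have G8 : 0 < G / 8 by rewrite divr_gt0.
  have L2 : ln (G / 8) + ln r <= logp (nevanlinna_T f r).
    rewrite -lnM ?posrE//; apply: le_trans (ln_le_logp _).
    by rewrite ler_ln ?posrE ?mulr_gt0// (lt_le_trans _ T2)// mulr_gt0.
  have L1 : logp (nevanlinna_T f r) <= `|ln (G + l)| + ln r.
    apply: le_trans (ler_logp T1) _; rewrite /logp ge_max addr_ge0 ?(ltW lr)//=.
    by rewrite lnM ?posrE// lerD2r ler_norm.
  have := ler_norm (- ln (G / 8)); rewrite normrN => n2.
  have n1 := normr_ge0 (ln (G + l)); have n3 := normr_ge0 (ln (G / 8)).
  rewrite ler_pdivlMr// ler_pdivrMr//; apply/andP; split.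
    by move: Be; rewrite /B; lra.
  by move: Be; rewrite /B; lra.
rewrite /growth_order /limf_esup; apply/eqP; rewrite eq_le; apply/andP; split.
- apply/lee_addgt0Pr => e e0; have [M HM] := bounds e e0.
  apply: (@le_trans _ _ (ereal_sup [set (logp (nevanlinna_T f r) / ln r)%:E | r in [set r | M < r]])).
    apply: ereal_inf_lbound; exists [set r | M < r] => //.
    by exists M; split => //; exact: num_real.
  apply: ge_ereal_sup => _ [r Mr <-]; rewrite -EFinD lee_fin.
  by case/andP: (HM r Mr).
- apply: le_ereal_inf_tmp => _ [V [M [_ MV]] <-].
  apply/lee_subgt0Pr => e e0; have [M' HM] := bounds e e0.
  pose r := Num.max M M' + 1.
  have Mr : M < r by rewrite /r ltr_pwDr// le_max lexx.
  have M'r : M' < r by rewrite /r ltr_pwDr// le_max lexx orbT.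
  apply: (@le_trans _ _ (logp (nevanlinna_T f r) / ln r)%:E).
    by rewrite -EFinB lee_fin; case/andP: (HM r M'r).
  by apply: ereal_sup_ubound; exists r => //; exact: MV.
Qed.

(** Once f^2 is the p1 term, the equation leaves a(z) f^(k)(z + beta) = p2 exp(a2 z), so a(z) is a
    constant times exp((a2 - gamma) z). A polynomial of this form is constant, and a2 = gamma = a1 /
    2. *)
Lemma solution_of_dominant (p1 p2 a1 a2 beta gamma : C) (a : {poly C}) k (s t : R) f :
  p1 != 0 -> p2 != 0 -> entire f -> (exists b, f b != 0) ->
  (forall z, f z ^+ 2 + a.[z] * cderiv k f (z + beta) =
    p1 * cexp (a1 * z) + p2 * cexp (a2 * z)) ->
  (forall eps r0 : R, 0 < eps -> exists r : R, [/\ r0 <= r, 1 <= r &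
    forall z, cmod z <= r -> cmod (f z) <= expR (Re (gamma * z) + eps * r) /\
      cmod (a.[z] * cderiv k f (z + beta)) <= expR (Re (gamma * z) + eps * r)]) ->
  gamma != 0 -> a1 = s%:C * gamma -> a2 = t%:C * gamma -> t < s -> s <= 2 ->
  growth_order f = 1%E /\ exists a0 : C, a = a0%:P /\ exists c : C,
    [/\ c ^+ 2 = p1, forall z, f z = c * cexp (a1 * z / 2),
        a0 * c * (a1 / 2) ^+ k * cexp (a1 * beta / 2) = p2 & a1 = 2 * a2].
Proof.
move=> p10 p20 ef fb f_eq H g0 a1E a2E ts s2.
have [sE f2] := dominant_square (v := fun z => a.[z] * cderiv k f (z + beta))
  ef fb f_eq H g0 a1E a2E ts s2.
have two : (2 : C) = 2%:C by rewrite rmorph_nat.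
have two0 : (2 : C) != 0 by rewrite pnatr_eq0.
rewrite sE -two in a1E.
have a12 : a1 / 2 = gamma by rewrite a1E mulrC mulKf.
have [|c [c2 fE]] := square_cexp (gamma := gamma) ef p10.
  by move=> z; rewrite f2 a1E -two.
have c0 : c != 0 by apply/eqP => c0; move: p10; rewrite -c2 c0 expr0n eqxx.
split; first exact: growth_order_cexp c0 g0 fE.
pose A := c * gamma ^+ k * cexp (gamma * beta).
have A0 : A != 0 by rewrite !mulf_neq0 ?cexp_neq0 ?expf_neq0.
have aE z : a.[z] = p2 / A * cexp ((a2 - gamma) * z).
  have := f_eq z; rewrite f2 => /addrI; rewrite (cderiv_cexp k fE) mulrDr cexpD => E.
  have gz := cexp_neq0 (gamma * z).
  apply: (mulIf (mulf_neq0 A0 gz)).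
  rewrite mulrBl cexpB.
  rewrite (_ : a.[z] * _ = a.[z] * (c * gamma ^+ k * (cexp (gamma * z) * cexp (gamma * beta))));
    last by rewrite /A; ring.
  by rewrite E; field; rewrite A0 gz.
have [|/eqP] := poly_eq_cexp _ aE; first by rewrite mulf_neq0 ?invr_eq0.
rewrite subr_eq0 => /eqP a2g aC.
exists (p2 / A); split => //; exists c; split => //.
- by move=> z; rewrite fE mulrAC a12.
- rewrite a12 (mulrAC a1) a12 -!mulrA.
  by rewrite (_ : c * _ = A) ?mulVf ?mulr1// /A mulrA.
- by rewrite a2g.
Qed.

End Conclusion.

Theorem theorem2 (R : realType) (p1 p2 alpha1 alpha2 beta : R[i])
    (a : {poly R[i]}) (k : nat) (f : R[i] -> R[i])
    (p1_neq0 : p1 != 0) (p2_neq0 : p2 != 0)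
    (alpha1_neq0 : alpha1 != 0) (alpha2_neq0 : alpha2 != 0)
    (alpha12 : alpha1 != alpha2)
    (a_neq0 : a != 0)
    (f_trans : transcendental_entire f)
    (f_hyper : (hyper_order f < 1)%E)
    (f_eq : forall z : R[i],
      f z ^+ 2 + a.[z] * cderiv k f (z + beta)
      = p1 * cexp (alpha1 * z) + p2 * cexp (alpha2 * z))
    (f_zeros : is_S (nevanlinna_N (fun z => (f z)^-1)) f) :
  growth_order f = 1%E /\
  exists a0 : R[i], a = a0%:P /\
    ((exists c1 : R[i],
        [/\ c1 ^+ 2 = p1,
            forall z, f z = c1 * cexp (alpha1 * z / 2),
            a0 * c1 * (alpha1 / 2) ^+ k * cexp (alpha1 * beta / 2) = p2
          & alpha1 = 2 * alpha2])
     \/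
     (exists c2 : R[i],
        [/\ c2 ^+ 2 = p2,
            forall z, f z = c2 * cexp (alpha2 * z / 2),
            a0 * c2 * (alpha2 / 2) ^+ k * cexp (alpha2 * beta / 2) = p1
          & alpha2 = 2 * alpha1])).
Proof.
have ef := f_trans.1.
have fb : exists b, f b != 0.
  apply: contrapT => f0; apply: f_trans.2; exists 0 => z; rewrite horner0.
  by apply: contrapT => /eqP fz; apply: f0; exists z.
have [c [e [c0 e0 ce]]] := exponential_type ef fb f_hyper f_eq.
have [gamma Hg] := single_exponent ef fb c0 e0 ce f_zeros.
have H := shifted_cderiv_at_scale a beta k ef Hg.
(* The hypotheses are symmetric in the two exponentials; this form serves the case where alpha_2 is
   the larger multiple of gamma. *)
have f_eq' z : f z ^+ 2 + a.[z] * cderiv k f (z + beta)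
    = p2 * cexp (alpha2 * z) + p1 * cexp (alpha1 * z) by rewrite f_eq addrC.
have [g0 [s [t [sE tE /andP[_ s2] /andP[_ t2] st]]]] := exponents_in_segment alpha12
  (fun z => dominant_direction p1_neq0 f_eq H)
  (fun z => dominant_direction p2_neq0 f_eq' H).
have [ts|ts] := ltP t s.
  have [fo [a0 [aE sol]]] :=
    solution_of_dominant p1_neq0 p2_neq0 ef fb f_eq H g0 sE tE ts s2.
  by split => //; exists a0; split => //; left.
have {}ts : s < t by rewrite lt_neqAle st.
have [fo [a0 [aE sol]]] :=
  solution_of_dominant p2_neq0 p1_neq0 ef fb f_eq' H g0 tE sE ts t2.
by split => //; exists a0; split => //; right.
Qed.
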